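(* Let $N\ge1$, $k\ge0$ be integers, $\rho>0$, $s\in\{1,\ldots,k+1\}$ and $p\in[1,+\infty]$. There exists $C$ depending only on $N$, $\rho$, $k$, $s$ and $p$ such that the following holds. Let $U$ be an open (bounded) subset of $\mathbb R^N$ with diameter $h_U$, star-shaped with respect to a ball of radius $\rho h_U$. Then, for all $m\in\{0,\ldots,s\}$ and all $v\in W^{s,p}(U)$, $$|v-\pi_U^kv|_{W^{m,p}(U)}\le C\,h_U^{s-m}\,|v|_{W^{s,p}(U)}.$$
   Context: $\mathbb P^k(U)$ is the space of (restrictions to $U$ of) polynomials in $N$ variables of total degree $\le k$. The $L^2$-projector $\pi_U^k:L^1(U)\to\mathbb P^k(U)$ is defined by $\int_U(\pi_U^kw)v=\int_Uwv$ for all $v\in\mathbb P^k(U)$. The seminorm is $|v|_{W^{s,p}(U)}=\sum_{\alpha\in\mathbb N^N,\ \alpha_1+\cdots+\alpha_N=s}\|\partial^\alpha v\|_{L^p(U)}$, where $\partial^\alpha=\partial_1^{\alpha_1}\cdots\partial_N^{\alpha_N}$ (so $|\cdot|_{W^{0,p}(U)}=\|\cdot\|_{L^p(U)}$). $U$ is star-shaped with respect to a ball $B\subset U$ if for every $x\in U$ the closed convex hull of $\{x\}\cup B$ is contained in $U$. *)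

(* Defs.v *)
From HB Require Import structures.
From mathcomp Require Import all_boot all_order all_algebra.
(* The notations of mpoly conflict with those of MathComp-Analysis, which has
   to be imported last because both define a name measure. *)
From mathcomp Require Import -(notations) multinomials.mpoly.
From mathcomp Require Import all_classical all_reals all_analysis.

Set Implicit Arguments.
Unset Strict Implicit.
Unset Printing Implicit Defensive.

Import Order.TTheory GRing.Theory Num.Theory.
Import numFieldNormedType.Exports.

Local Open Scope classical_set_scope.
Local Open Scope ring_scope.

(* The Borel sigma-algebra of R^n, generated by the coordinates like the one
   the library puts on tuples. *)
Section measurable_rV.
Context {R : realType} (n : nat).

Let coord (i : 'I_n) (x : 'rV[R]_n) : R := x ord0 i.

Let rV_set0 : g_sigma_preimage coord set0.
Proof. exact: sigma_algebra0. Qed.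

Let rV_setC A : g_sigma_preimage coord A -> g_sigma_preimage coord (~` A).
Proof. exact: sigma_algebraC. Qed.

Let rV_bigcup (F : (set 'rV[R]_n)^nat) :
  (forall i, g_sigma_preimage coord (F i)) ->
  g_sigma_preimage coord (\bigcup_i (F i)).
Proof. exact: sigma_algebra_bigcup. Qed.

HB.instance Definition _ :=
  @isMeasurable.Build (measure_tuple_display default_measure_display)
    'rV[R]_n (g_sigma_preimage coord) rV_set0 rV_setC rV_bigcup.

End measurable_rV.

Section lebesgue_measure_rV.
Context {R : realType}.

Lemma measurable_rV_coord n (i : 'I_n) :
  measurable_fun [set: 'rV[R]_n] (fun x : 'rV[R]_n => x ord0 i).
Proof.
move=> _ Y mY; rewrite setTI; apply: sub_sigma_algebra => /=.
rewrite -bigcup_seq/=; exists i => /=; first by rewrite mem_index_enum.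
by exists Y => //; rewrite setTI.
Qed.

Lemma measurable_fun_rV d (T : measurableType d) n (f : T -> 'rV[R]_n) :
  (forall i, measurable_fun [set: T] (fun t => f t ord0 i)) ->
  measurable_fun [set: T] f.
Proof.
move=> mf _ A mA; rewrite setTI.
suff : measurable `<=` [set B : set 'rV[R]_n | measurable (f @^-1` B)] by exact.
apply: smallest_sub.
  split => /= [|B mB|F mF].
  - by rewrite preimage_set0; exact: measurable0.
  - by rewrite setTD preimage_setC; exact: measurableC.
  - by rewrite preimage_bigcup; exact: bigcupT_measurable.
move=> B; rewrite -bigcup_seq => -[i _ [C mC <-]] /=.
rewrite setTI -comp_preimage -[X in measurable X]setTI.
exact: mf.
Qed.

Definition cons_rV n (p : 'rV[R]_n * measurableTypeR R) : 'rV[R]_n.+1 :=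
  row_mx (const_mx p.2 : 'rV[R]_1) p.1.

Lemma measurable_cons_rV n : measurable_fun setT (@cons_rV n).
Proof.
apply: measurable_fun_rV => i.
rewrite /cons_rV; case: (@split_ordP 1 n i) => j ->.
  rewrite [X in measurable_fun _ X](_ : _ = snd); last first.
    by apply/funext => p; apply: etrans (row_mxEl _ _ _ _) _; rewrite mxE.
  exact: measurable_snd.
rewrite [X in measurable_fun _ X]
  (_ : _ = (fun x : 'rV[R]_n => x ord0 j) \o fst); last first.
  by apply/funext => p; apply: etrans (row_mxEr _ _ _ _) _.
by apply: measurableT_comp => //; exact: measurable_rV_coord.
Qed.

Fixpoint lebesgue_measure_rV n : set 'rV[R]_n -> \bar R :=
  match n with
  | 0 => \d_(0 : 'rV[R]_0)
  | n'.+1 => pushforward (@lebesgue_measure_rV n' \x lebesgue_measure)%E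
               (@cons_rV n')
  end.

Let lebesgue_measure_rV_ex n :
  exists m : {measure set 'rV[R]_n -> \bar R},
    @lebesgue_measure_rV n = m :> (set 'rV[R]_n -> \bar R).
Proof.
elim: n => [|n [m mE]]; first by exists \d_(0 : 'rV[R]_0).
pose m' := measure_function_pushforward__canonical__measure_function_Measure
  (m \x lebesgue_measure)%E (@measurable_cons_rV n).
by exists m'; rewrite /= mE.
Qed.

Let lebesgue_measure_rV0 n : @lebesgue_measure_rV n set0 = 0%E.
Proof. by have [m ->] := lebesgue_measure_rV_ex n; exact: measure0. Qed.

Let lebesgue_measure_rV_ge0 n A : (0 <= @lebesgue_measure_rV n A)%E.
Proof. by have [m ->] := lebesgue_measure_rV_ex n; exact: measure_ge0. Qed.

Let lebesgue_measure_rV_sigma_additive n :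
  semi_sigma_additive (@lebesgue_measure_rV n).
Proof.
have [m ->] := lebesgue_measure_rV_ex n.
exact: measure_semi_sigma_additive.
Qed.

HB.instance Definition _ n := isMeasure.Build _ _ _ (@lebesgue_measure_rV n)
  (@lebesgue_measure_rV0 n) (@lebesgue_measure_rV_ge0 n)
  (@lebesgue_measure_rV_sigma_additive n).

End lebesgue_measure_rV.
Arguments lebesgue_measure_rV {R n}.

Section geometry.
Context {R : realType} {N : nat}.
Implicit Types (x y c : 'rV[R]_N) (A B U : set 'rV[R]_N).

(* The norm of the library on 'rV[R]_N is the sup norm: it gives the topology,
   but distances have to be measured with the Euclidean norm. *)
Definition enorm x : R := Num.sqrt (\sum_(i < N) x ord0 i ^+ 2).

Definition diameter U : R :=
  sup [set r | exists x y, [/\ U x, U y & r = enorm (x - y)]].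

Definition eball c (r : R) : set 'rV[R]_N := [set x | enorm (x - c) < r].

Definition closed_convex_hull A : set 'rV[R]_N :=
  smallest [set M : set 'rV[R]_N |
    closed M /\ convex_set (M : set (convex_lmodType 'rV[R]_N))] A.

Definition star_shaped U B : Prop :=
  B `<=` U /\ forall x, U x -> closed_convex_hull (x |` B) `<=` U.

End geometry.

Section sobolev.
Context {R : realType} {N : nat}.
Implicit Types (U : set 'rV[R]_N) (f g v w phi : 'rV[R]_N -> R).
Implicit Types (a : multinom N) (p : \bar R) (k m s : nat).

Local Notation mu := (@lebesgue_measure_rV R N).

Definition partial (i : 'I_N) f : 'rV[R]_N -> R :=
  fun x => 'D_(delta_mx ord0 i) f x.

(* d_1^(a_1) (... (d_N^(a_N) f)) *)
Definition partial_multi a f : 'rV[R]_N -> R :=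
  foldr (fun i g => iter (a i) (partial i) g) f (enum 'I_N).

Definition smooth f : Prop :=
  forall s : seq 'I_N, let g := foldr partial f s in
    continuous g /\ forall i x, derivable g x (delta_mx ord0 i).

Definition test_function U phi : Prop :=
  let K := closure [set x | phi x != 0] in
  [/\ smooth phi, compact K & K `<=` U].

Definition locally_integrable_rV U f : Prop :=
  measurable_fun U f /\
  forall K, K `<=` U -> compact K -> (\int[mu]_(x in K) `|f x|%:E < +oo)%E.

(* g is the weak derivative d^a v on U. *)
Definition weak_derivative U a v g : Prop :=
  [/\ locally_integrable_rV U v, locally_integrable_rV U g &
    forall phi, test_function U phi ->
      \int[mu]_(x in U) (v x * partial_multi a phi x) =
      (-1) ^+ mdeg a * \int[mu]_(x in U) (g x * phi x)].

Definition Lp_norm U p f : \bar R := 'N[mu]_p[EFin \o (f \_ U)]%E.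

Definition in_Lp U p f : Prop :=
  measurable_fun U f /\ (Lp_norm U p f < +oo)%E.

Definition in_Wsp U s p v : Prop :=
  in_Lp U p v /\
  forall a, (mdeg a <= s)%N ->
    exists2 g, weak_derivative U a v g & in_Lp U p g.

(* Some representative of the (a.e. unique) weak derivative. *)
Definition weak_partial U a v : 'rV[R]_N -> R :=
  get [set g | weak_derivative U a v g].

(* The L^p norm of d^a v on U, with value +oo if v has no weak derivative d^a v
   on U, so that the arbitrary value of weak_partial is never used. *)
Definition Lp_norm_partial U p a v : \bar R :=
  if `[< exists g, weak_derivative U a v g >]
  then Lp_norm U p (weak_partial U a v) else +oo%E.

(* bmultinom N s.+1 is the finite type of multi-indices of degree at
   most s. *)
Definition Wsp_seminorm U s p v : \bar R :=
  (\sum_(a : bmultinom N s.+1 | mdeg a == s)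
     Lp_norm_partial U p a v)%E.

(* msize is 1 + the total degree, and 0 for the zero polynomial. *)
Definition polyfun k : set ('rV[R]_N -> R) :=
  [set f | exists2 P : mpoly N R, (msize P <= k.+1)%N &
             f = fun x : 'rV[R]_N => meval (fun i => x ord0 i) P].

Definition L2_projection U k w : 'rV[R]_N -> R :=
  get [set f | polyfun k f /\
    forall q, polyfun k q ->
      \int[mu]_(x in U) (f x * q x) = \int[mu]_(x in U) (w x * q x)].

End sobolev.

(* Main.v *)
(* The only tools are translations; no smooth approximation of v is needed.
   Testing a weak gradient G of w against translated bumps gives, for almost all
   x and d, w(x + d) - w(x) = int_0^1 sum_i d_i G_i(x + t d) dt. Averaging over
   the d that lead from x to the ball B bounds |w - mean_B w| by averages of the
   translates of |G|, whence the Poincare inequality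
     ||w - mean_B w||_p <= C h sum_i ||G_i||_p,
   as averaging translates does not increase the L^p norm by more than the mass
   of the weight. Iterating on the derivatives of v yields a polynomial Q of
   degree < s with ||d^a(v - Q)||_p <= C h^(s - |a|) |v|_(s,p). Finally
   pi v - Q = pi(v - Q), and by scaling and equivalence of norms on polynomials
   ||d^a pi(w)||_p <= C h^(-|a|) ||w||_p. *)
From HB Require Import structures.
Require Import Defs.
From mathcomp Require Import all_boot all_order all_algebra.
From mathcomp Require Import -(notations) multinomials.mpoly.
From mathcomp Require Import all_classical all_reals all_analysis.
From mathcomp Require Import measurable_realfun ess_sup_inf ring lra.

Set Implicit Arguments.
Unset Strict Implicit.
Unset Printing Implicit Defensive.

Import Order.TTheory GRing.Theory Num.Theory.
Import numFieldNormedType.Exports.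

Local Open Scope classical_set_scope.
Local Open Scope ring_scope.

(** * Lebesgue measure on R^N *)

(** Mollifying [v] would force a shrinking of the domain. Translating a test function only requires
    that its support, moved along a segment, stay in [U], and star-shapedness provides this for
    segments ending in the ball. The test functions that get translated are values of the syntax
    [bexpr], whose derivatives and translates are computed formally; they suffice because box bumps
    approximate indicator functions of boxes. Sup-norm balls are boxes, so their measures are
    explicit; the Euclidean ball of radius rho h is replaced by the sup-norm ball of radius r = h
    rho / N inside it. A displacement from a point of [U] to that ball lies in a box of side 4h, so
    the weight has mass (4h)^N; dividing by the measure (2r)^N of the ball gives a Poincare constant
    h (4h / (2r))^N, that is h times a number depending on N and rho only. All derivatives are
    handled together as a jet, a family indexed by multi-indices whose members are linked by weak
    gradients: subtracting a polynomial acts memberwise, and the Poincare inequality applies to each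
    member. *)

Section measure_rV.
Context {R : realType}.
Implicit Types (n N : nat).

Lemma cons_rV0 n (p : 'rV[R]_n * measurableTypeR R) :
  cons_rV p ord0 ord0 = p.2.
Proof. by rewrite /cons_rV mxE; case: splitP => [j _|k]; rewrite ?mxE. Qed.

Lemma cons_rV_lift n (p : 'rV[R]_n * measurableTypeR R) (i : 'I_n) :
  cons_rV p ord0 (lift ord0 i) = p.1 ord0 i.
Proof.
rewrite /cons_rV mxE; case: splitP => [j|k]; first by rewrite (ord1 j).
by rewrite /bump/= !add1n => -[] /val_inj ->.
Qed.

Lemma measurable_rV_box N (A : 'I_N -> set R) :
  (forall i, measurable (A i : set (measurableTypeR R))) ->
  measurable [set x : 'rV[R]_N | forall i, A i (x ord0 i)].
Proof.
move=> mA; rewrite [X in measurable X](_ : _ =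
    \bigcap_(i in [set: 'I_N]) ((fun y : 'rV[R]_N => y ord0 i) @^-1` A i)).
  apply: fin_bigcap_measurable => // i _.
  rewrite -[X in measurable X]setTI.
  exact: (measurable_rV_coord i measurableT (mA i)).
apply/seteqP; split => y /= h i; first by move=> _; exact: h.
by have := h i I.
Qed.

(** The measure is built by adding one coordinate in front, so a box pulls back along [cons_rV] to a
    product set, and induction on the dimension peels off the factor of index 0. *)
Lemma lebesgue_measure_rV_box N (A : 'I_N -> set R) :
  (forall i, measurable (A i : set (measurableTypeR R))) ->
  lebesgue_measure_rV [set x : 'rV[R]_N | forall i, A i (x ord0 i)] =
  (\prod_(i < N) lebesgue_measure (A i))%E.
Proof.
elim: N A => [|N IH] A mA.
  rewrite big_ord0 /= diracE mem_set//.
  by move=> -[].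
rewrite big_ord_recl /= /pushforward.
rewrite (_ : _ @^-1` _ =
    [set y : 'rV[R]_N | forall i, A (lift ord0 i) (y ord0 i)] `*` A ord0).
  rewrite product_measure1E//; last first.
    exact: (measurable_rV_box (fun i => mA (lift ord0 i))).
  rewrite muleC; congr (_ * _)%E.
  exact: (IH (fun i => A (lift ord0 i)) (fun i => mA (lift ord0 i))).
apply/seteqP; split => [[y t] /= h|[y t] /= [h1 h2] i].
  split => [i|].
    by have := h (lift ord0 i); rewrite cons_rV_lift.
  by have := h ord0; rewrite cons_rV0.
case: (unliftP ord0 i) => [j|] ->; first by rewrite cons_rV_lift.
by rewrite cons_rV0.
Qed.

(** Positivity of [r] matters for [N = 0], where the right-hand side is the whole space while a ball
    of nonpositive radius is empty. *)
Lemma ball_rVE N (c : 'rV[R]_N) (r : R) : 0 < r ->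
  ball c r = [set x | forall i, `|c ord0 i - x ord0 i| < r].
Proof.
move=> r0; rewrite mx_norm_ball; apply/seteqP; split => x /=.
  move=> h i; apply: le_lt_trans h.
  rewrite [leRHS]/Num.norm/= mx_normrE.
  have := @le_bigmax _ _ _ 0 (fun i => `|(c - x) i.1 i.2|) (ord0, i).
  by rewrite /= !mxE.
move=> h; rewrite /ball_/= [ltLHS]/Num.norm/= mx_normrE.
apply: bigmax_lt => // -[i j] _ /=; rewrite !mxE.
by rewrite (ord1 i).
Qed.

Lemma closed_ball_rVE N (c : 'rV[R]_N) (r : R) : 0 <= r ->
  [set x | `|c - x| <= r] = [set x | forall i, `|c ord0 i - x ord0 i| <= r].
Proof.
move=> r0; apply/seteqP; split => x /=.
  move=> h i; apply: le_trans h.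
  rewrite [leRHS]/Num.norm/= mx_normrE.
  have := @le_bigmax _ _ _ 0 (fun i => `|(c - x) i.1 i.2|) (ord0, i).
  by rewrite /= !mxE.
move=> h; rewrite [leLHS]/Num.norm/= mx_normrE.
apply: bigmax_le => // -[i j] _ /=; rewrite !mxE.
by rewrite (ord1 i).
Qed.

Lemma ler_norm_coord N (x : 'rV[R]_N) i : `|x ord0 i| <= `|x|.
Proof.
rewrite [leRHS]/Num.norm/= mx_normrE.
exact: (@le_bigmax _ _ _ 0 (fun i => `|x i.1 i.2|) (ord0, i)).
Qed.

Lemma ball_rV_itv N (c : 'rV[R]_N) (r : R) : 0 < r ->
  ball c r = [set x | forall i, `]c ord0 i - r, c ord0 i + r[%classic (x ord0 i)].
Proof.
move=> r0; rewrite ball_rVE//; apply: eq_set => x; apply: eq_forall => i.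
by rewrite /= in_itv/= distrC ltr_distl.
Qed.

Lemma measurable_ball_rV N (c : 'rV[R]_N) (r : R) : measurable (ball c r).
Proof.
have [r0|r0] := ltP 0 r; first by
  rewrite ball_rV_itv//; apply: (@measurable_rV_box _
    (fun i => `]c ord0 i - r, c ord0 i + r[%classic)) => i; exact: measurable_itv.
rewrite (_ : ball c r = set0); first exact: measurable0.
rewrite mx_norm_ball; apply/seteqP; split => x //=.
by rewrite /ball_/= => /(le_lt_trans (normr_ge0 _)); rewrite ltNge r0.
Qed.

Lemma lebesgue_measure_ball_rV N (c : 'rV[R]_N) (r : R) : 0 < r ->
  lebesgue_measure_rV (ball c r) = ((r *+ 2) ^+ N)%:E.
Proof.
move=> r0; rewrite ball_rV_itv//.
rewrite (@lebesgue_measure_rV_box _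
  (fun i => `]c ord0 i - r, c ord0 i + r[%classic)); last first.
  by move=> i; exact: measurable_itv.
under eq_bigr => i _.
  rewrite lebesgue_measure_itv/= lte_fin ifT; last first.
    by rewrite ltrBlDr -addrA ltrDl addr_gt0.
  rewrite -EFinB (_ : _ - _ = r *+ 2); last first.
    by ring.
  over.
by rewrite -[in RHS](card_ord N) -prodr_const prodEFin.
Qed.

Lemma lebesgue_measure_rV_sigma_finite n :
  sigma_finite [set: 'rV[R]_n] (@lebesgue_measure_rV R n).
Proof.
exists (fun k => ball 0 k.+1%:R).
  apply/seteqP; split => // x _; exists (Num.truncn `|x|) => //.
  by rewrite mx_norm_ball /ball_/= sub0r normrN truncnS_gt.
move=> k; split; first exact: measurable_ball_rV.
by rewrite lebesgue_measure_ball_rV// ltry.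
Qed.

HB.instance Definition _ n := @Measure_isSigmaFinite.Build _ _ _
  (@lebesgue_measure_rV R n) (lebesgue_measure_rV_sigma_finite n).

Lemma ge0_integral_rVS n (f : 'rV[R]_n.+1 -> \bar R) :
  measurable_fun [set: 'rV[R]_n.+1] f -> (forall x, 0 <= f x)%E ->
  (\int[lebesgue_measure_rV]_x f x =
   \int[lebesgue_measure_rV]_y \int[lebesgue_measure]_t f (cons_rV (y, t)))%E.
Proof.
move=> mf f0.
have mfc : measurable_fun [set: 'rV[R]_n * measurableTypeR R]
    (fun p => f (cons_rV p)).
  by apply: measurableT_comp => //; exact: measurable_cons_rV.
transitivity (\int[@lebesgue_measure_rV R n \x @lebesgue_measure R]_p
    f (cons_rV p))%E; last first.
  exact: (@fubini_tonelli1 _ _ _ _ R (@lebesgue_measure_rV R n)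
    (@lebesgue_measure R) (fun p => f (cons_rV p)) mfc (fun p => f0 _)).
rewrite -[setT in RHS](preimage_setT (@cons_rV R n)).
rewrite -ge0_integral_pushforward//.
exact: measurable_cons_rV.
Qed.

End measure_rV.

(** * Affine changes of variables *)

Section affine.
Context {R : realType}.
Implicit Types (N : nat).

Lemma measurable_affine_R (a h : R) :
  measurable_fun [set: measurableTypeR R]
    (fun t => a + h * t : measurableTypeR R).
Proof. by apply: measurable_funD => //; exact: mulrl_measurable. Qed.

(** Both sides are measures in [A] that agree on half-open intervals, so uniqueness of the Lebesgue
    measure applies. *)
Lemma lebesgue_measure_affine (a h : R) (A : set (measurableTypeR R)) :
  0 < h -> measurable A ->
  lebesgue_measure A =
  (h%:E * pushforward lebesgue_measure (fun t : measurableTypeR R => a + h * t)%R A)%E.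
Proof.
move=> h0 mA.
pose m := mscale (NngNum (ltW h0)) (measure_function_pushforward__canonical__measure_function_Measure
  (@lebesgue_measure R) (measurable_affine_R a h)).
apply: (@lebesgue_measure_unique R m) => //= _ [[u v]] _ <-.
rewrite /m/= /mscale/= /pushforward.
rewrite (_ : _ @^-1` _ = `](u - a) / h, (v - a) / h]%classic); last first.
  apply/seteqP; split => t /=; rewrite !in_itv/= ltr_pdivrMr// ler_pdivlMr//;
    by rewrite ltrBlDl lerBrDl mulrC.
rewrite !lebesgue_measure_itv/= !lte_fin ltr_pM2r ?invr_gt0// ltrD2r.
case: ifPn => uv; last by rewrite mule0.
rewrite -!EFinB -EFinM; congr EFin.
by field; rewrite gt_eqF.
Qed.

Lemma ge0_integral_affine_R (a h : R) (f : measurableTypeR R -> \bar R) :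
  0 < h -> measurable_fun [set: measurableTypeR R] f -> (forall x, 0 <= f x)%E ->
  (\int[lebesgue_measure]_t f t =
   h%:E * \int[lebesgue_measure]_t f (a + h * t)%R)%E.
Proof.
move=> h0 mf f0.
pose m := measure_function_pushforward__canonical__measure_function_Measure
  (@lebesgue_measure R) (measurable_affine_R a h).
transitivity (\int[mscale (NngNum (ltW h0)) m]_t f t)%E.
  by apply: eq_measure_integral => A mA _ /=; exact: lebesgue_measure_affine.
rewrite ge0_integral_mscale//=; congr (_ * _)%E.
rewrite ge0_integral_pushforward//.
exact: measurable_affine_R.
Qed.

Lemma measurable_affine_rV N (c : 'rV[R]_N) (h : R) :
  measurable_fun [set: 'rV[R]_N] (fun x => c + h *: x : 'rV[R]_N).
Proof.
apply: measurable_fun_rV => i.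
under eq_fun do rewrite !mxE.
by apply: measurable_funD => //; apply: measurable_funM => //;
  exact: measurable_rV_coord.
Qed.

Lemma ge0_integral_affine_rV N (c : 'rV[R]_N) (h : R) (f : 'rV[R]_N -> \bar R) :
  0 < h -> measurable_fun [set: 'rV[R]_N] f -> (forall x, 0 <= f x)%E ->
  (\int[lebesgue_measure_rV]_x f x =
   (h ^+ N)%:E * \int[lebesgue_measure_rV]_x f (c + h *: x)%R)%E.
Proof.
move=> h0; elim: N c f => [|N IH] c f mf f0.
  rewrite expr0 mul1e; apply: eq_integral => x _; congr f.
  by apply/rowP => -[].
rewrite !ge0_integral_rVS//; last first.
  by apply: measurableT_comp => //; exact: measurable_affine_rV.
pose c' : 'rV[R]_N := \row_j c ord0 (lift ord0 j).
have cE y t : c + h *: cons_rV (y, t) =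
    cons_rV (c' + h *: y, c ord0 ord0 + h * t).
  apply/rowP => i; case: (unliftP ord0 i) => [j|] ->.
    by rewrite [RHS]cons_rV_lift [LHS]mxE [X in _ + X]mxE cons_rV_lift !mxE.
  by rewrite [RHS]cons_rV0 [LHS]mxE [X in _ + X]mxE cons_rV0.
have mfc : measurable_fun [set: 'rV[R]_N * measurableTypeR R]
    (fun p => f (cons_rV p)).
  by apply: measurableT_comp => //; exact: measurable_cons_rV.
rewrite (IH c'); last 2 first.
- exact: (measurable_fun_fubini_tonelli_F (m2 := @lebesgue_measure R) _ mfc).
- by move=> x; exact: integral_ge0.
rewrite exprSr EFinM -muleA; congr (_ * _)%E.
rewrite -ge0_integralZl//; last 3 first.
- apply: (measurable_fun_fubini_tonelli_F (m2 := @lebesgue_measure R)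
    (fun p : 'rV[R]_N * measurableTypeR R => f (c + h *: cons_rV p))) => //.
  apply: (measurableT_comp mf).
  exact: (measurableT_comp (measurable_affine_rV c h) (@measurable_cons_rV R N)).
- by move=> x _; exact: integral_ge0.
- by rewrite lee_fin ltW.
apply: eq_integral => y _.
rewrite (@ge0_integral_affine_R (c ord0 ord0) h)//.
  by congr (_ * _)%E; apply: eq_integral => t _; rewrite cE.
apply: (measurableT_comp mfc); exact: pair1_measurable.
Qed.

Lemma integral_translate N (c : 'rV[R]_N) (f : 'rV[R]_N -> \bar R) :
  measurable_fun [set: 'rV[R]_N] f ->
  (\int[lebesgue_measure_rV]_x f (x + c)%R = \int[lebesgue_measure_rV]_x f x)%E.
Proof.
move=> mf.
have ge0_tr (g : 'rV[R]_N -> \bar R) :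
    measurable_fun [set: 'rV[R]_N] g -> (forall x, 0 <= g x)%E ->
    (\int[lebesgue_measure_rV]_x g (x + c)%R = \int[lebesgue_measure_rV]_x g x)%E.
  move=> mg g0; rewrite [RHS](@ge0_integral_affine_rV _ c 1)// expr1n mul1e.
  by apply: eq_integral => x _; rewrite scale1r addrC.
rewrite integralE [RHS]integralE; congr (_ - _)%E.
- rewrite -(ge0_tr f^\+%E)//; [by apply: eq_integral => x _;
    rewrite !funeposE|exact: measurable_funepos].
- rewrite -(ge0_tr f^\-%E)//; [by apply: eq_integral => x _;
    rewrite !funenegE|exact: measurable_funeneg].
Qed.

End affine.

(** * Open sets, boxes and the Borel sigma-algebra *)

Section open_rV.
Context {R : realType} {N : nat}.

(** The balls have rational centres and radii 1/(n+1). The closed balls are required to lie in [U]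
    because a locally integrable function is integrable on compact subsets of [U], not on arbitrary
    open ones. *)
Lemma open_rV_cover (U : set 'rV[R]_N) : open U ->
  exists F : nat -> set 'rV[R]_N, U = \bigcup_n F n /\
    forall n, F n = set0 \/
      exists c r, [/\ 0 < r, F n = ball c r & [set x | `|c - x| <= r] `<=` U].
Proof.
move=> oU.
pose c (q : 'rV[rat]_N * nat) : 'rV[R]_N := map_mx ratr q.1.
pose r (q : 'rV[rat]_N * nat) : R := q.2.+1%:R^-1.
have r0 q : 0 < r q by rewrite invr_gt0.
(* Integers that code no admissible ball are sent to the empty set, which explains the first
   alternative of the statement. *)
pose F k := if unpickle k is Some q then
  if `[< [set x | `|c q - x| <= r q] `<=` U >] then ball (c q) (r q) else set0
  else set0.
exists F; split; last first.
  move=> n; rewrite /F; case: unpickle => [q|]; last by left.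
  by case: asboolP => h; [right; exists (c q), (r q)|left].
apply/seteqP; split => [x Ux|x [k _]]; last first.
  rewrite /F; case: unpickle => [q|//].
  case: asboolP => // h; rewrite mx_norm_ball /ball_/= => /ltW.
  exact: h.
have [e /= e0 xeU] : nbhs_ball x U by apply/nbhs_ballP; exact: open_nbhs_nbhs.
have [n ne] : exists n : nat, n.+1%:R^-1 < e / 2.
  exists (Num.truncn (e / 2)^-1).
  rewrite invf_plt ?posrE ?divr_gt0// ?ltr0Sn//.
  exact: truncnS_gt.
have /choice[q hq] : forall i, exists q : rat, `|ratr q - x ord0 i| < n.+1%:R^-1 :> R.
  move=> i; have /rat_in_itvoo[q] : x ord0 i - n.+1%:R^-1 < x ord0 i + n.+1%:R^-1.
    by rewrite ltrBlDr -addrA ltrDl addr_gt0// invr_gt0.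
  by rewrite in_itv/= => h; exists q; rewrite ltr_distl.
pose Q : 'rV[rat]_N * nat := (\row_i q i, n).
have cx : `|c Q - x| < r Q.
  suff : ball (c Q) (r Q) x by rewrite mx_norm_ball.
  by rewrite ball_rVE// => i /=; rewrite !mxE; exact: hq.
exists (pickle Q) => //.
rewrite /F pickleK ifT; first by rewrite mx_norm_ball.
apply/asboolP => y /= cy; apply: xeU.
rewrite mx_norm_ball /ball_/=.
rewrite -[x - y](subrKA (c Q)) (le_lt_trans (ler_normD _ _))//.
rewrite (splitr e) ltr_leD//.
  by rewrite distrC (lt_trans cx).
by rewrite (le_trans cy)// ltW.
Qed.

Lemma open_measurable_rV (U : set 'rV[R]_N) : open U -> measurable U.
Proof.
move=> /open_rV_cover[F [-> hF]]; apply: bigcupT_measurable => n.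
have [->|[c [r [_ -> _]]]] := hF n; first exact: measurable0.
exact: measurable_ball_rV.
Qed.

Lemma closed_measurable_rV (U : set 'rV[R]_N) : closed U -> measurable U.
Proof.
move=> cU; rewrite -[X in measurable X]setCK; apply: measurableC.
by apply: open_measurable_rV; exact: closed_openC.
Qed.

Lemma continuous_measurable_rV (f : 'rV[R]_N -> R) : continuous f ->
  measurable_fun [set: 'rV[R]_N] f.
Proof.
move=> /continuousP cf; apply: (measurability _ (RGenOpens.measurableE R)).
move=> _ [_ [a [b ->] <-]]; rewrite setTI; apply: open_measurable_rV.
exact/cf/interval_open.
Qed.

Definition obox (a b : 'rV[R]_N) : set 'rV[R]_N :=
  [set x | forall i, a ord0 i < x ord0 i < b ord0 i].

Lemma ball_obox (c : 'rV[R]_N) r : 0 < r ->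
  ball c r = obox (c - const_mx r) (c + const_mx r).
Proof.
move=> r0; rewrite ball_rV_itv//; apply: eq_set => x; apply: eq_forall => i.
by rewrite /= in_itv/= !mxE.
Qed.

Lemma measurable_obox a b : measurable (obox a b).
Proof.
apply: (@measurable_rV_box _ _ (fun i => `]a ord0 i, b ord0 i[%classic)) => i.
exact: measurable_itv.
Qed.

(** Unlike balls, boxes are stable under intersection: they form the pi-system used in
    [ae_eq0_obox]. *)
Lemma oboxI a b a' b' : obox a b `&` obox a' b' =
  obox (\row_i Num.max (a ord0 i) (a' ord0 i)) (\row_i Num.min (b ord0 i) (b' ord0 i)).
Proof.
apply/seteqP; split => x /=.
  move=> [h h'] i.
  have /andP[h1 h2] := h i; have /andP[h3 h4] := h' i.
  by rewrite !mxE gt_max lt_min h1 h2 h3 h4.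
move=> h; split=> i; have := h i; rewrite !mxE gt_max lt_min;
  by case/andP => /andP[? ?] /andP[? ?]; apply/andP; split.
Qed.

(** An open set is a countable union of sup-norm balls, hence of boxes, and the preimage of an open
    interval by a coordinate is open. *)
Lemma measurable_rV_obox : @measurable _ 'rV[R]_N =
  <<s [set A | exists a b, A = obox a b] >>.
Proof.
set G := [set A | _].
have openG (U : set 'rV[R]_N) : open U -> <<s G >> U.
  move=> /open_rV_cover[F [-> hF]]; apply: sigma_algebra_bigcup => n.
  have [->|[c [r [r0 -> _]]]] := hF n; first exact: sigma_algebra0.
  by rewrite ball_obox//; apply: sub_sigma_algebra; do 2 eexists.
apply/seteqP; split; last first.
  apply: smallest_sub; first exact: sigma_algebra_measurable.
  by move=> _ [a [b ->]]; exact: measurable_obox.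
apply: smallest_sub; first exact: smallest_sigma_algebra.
move=> A; rewrite -bigcup_seq => -[i _ [Y mY <-]]; rewrite setTI.
have : (@RGenOpens.G R).-sigma.-measurable Y.
  by rewrite -RGenOpens.measurableE; exact: mY.
suff : <<s @RGenOpens.G R >> `<=` [set Y |
  <<s G >> ((fun x : 'rV[R]_N => x ord0 i) @^-1` Y)].
  by apply.
apply: smallest_sub.
  split => /= [|B mB|B mB].
  - by rewrite preimage_set0; exact: sigma_algebra0.
  - by rewrite setTD preimage_setC; exact: sigma_algebraC.
  - by rewrite preimage_bigcup; exact: sigma_algebra_bigcup.
move=> _ [a [b ->]] /=; apply: openG.
have : continuous (fun x : 'rV[R]_N => x ord0 i) by exact: coord_continuous.
move/continuousP; apply; exact: interval_open.
Qed.

End open_rV.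

(** * Bump functions *)

Section flat.
Context {R : realType}.
Implicit Types (P : {poly R}) (n : nat) (t : R).

(* Derivatives of the functions exp(-1/((n + 1) t)), extended by 0 to t <= 0, are of
   this form; as n grows, flat 1 n tends to the indicator function of t > 0. *)
Definition flat P n t : R :=
  if 0 < t then P.[t^-1] * expR (- (n.+1%:R^-1 * t^-1)) else 0.

(** In the variable u = 1/t the operator d/dt is -u^2 d/du, and differentiating exp(-u/(n+1))
    contributes the term P/(n+1). *)
Definition flat_deriv P n : {poly R} := 'X ^+ 2 * (n.+1%:R^-1 *: P - P^`()).

Lemma horner_le_expn P (u : R) : 1 <= u ->
  `|P.[u]| <= (\sum_(i < size P) `|P`_i|) * u ^+ size P.
Proof.
move=> u1; rewrite horner_coef mulr_suml.
apply: le_trans (ler_norm_sum _ _ _) _; apply: ler_sum => i _.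
rewrite normrM ler_wpM2l// ger0_norm ?exprn_ge0// ?(le_trans ler01)//.
by rewrite ler_weXn2l// ltnW.
Qed.

(** With m the size of [P] and c = 1/(n+1), one has |P(1/t)| <= S t^-m, whereas exp(c/t) is at least
    its Taylor term (c/t)^(m+1)/(m+1)!; the quotient leaves one factor t, enough to differentiate at
    0. *)
Lemma flat_le P n : exists K, forall t, `|t| <= 1 -> `|flat P n t| <= K * `|t|.
Proof.
pose S := \sum_(i < size P) `|P`_i|; pose m := size P; pose c : R := n.+1%:R^-1.
have S0 : 0 <= S by exact: sumr_ge0.
have c0 : 0 < c by rewrite invr_gt0.
exists (S * (m.+1)`!%:R / c ^+ m.+1) => t t1; rewrite /flat; case: ifPn => t0; last first.
  rewrite normr0 mulr_ge0// divr_ge0// ?mulr_ge0// exprn_ge0// ltW//.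
rewrite gtr0_norm// in t1 *.
have u1 : 1 <= t^-1 by rewrite invf_ge1.
rewrite normrM (ger0_norm (expR_ge0 _)) expRN.
have h1 := horner_le_expn P u1.
have h2 : (c / t) ^+ m.+1 / (m.+1)`!%:R <= expR (c * t^-1).
  apply: le_trans (expR_ge1Dxn m _); first by rewrite lerDr.
  by rewrite divr_ge0// ltW.
have f0 : 0 < (m.+1)`!%:R :> R by rewrite ltr0n fact_gt0.
have h3 : (expR (c * t^-1))^-1 <= ((c / t) ^+ m.+1 / (m.+1)`!%:R)^-1.
  by rewrite lef_pV2 ?posrE ?expR_gt0// divr_gt0// exprn_gt0// divr_gt0.
apply: le_trans (ler_pM _ _ h1 h3) _ => //.
rewrite -/S -/m expr_div_n !exprVn !invf_div [t ^+ m.+1]exprS.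
rewrite le_eqVlt; apply/orP; left; apply/eqP; field.
by rewrite !gt_eqF ?exprn_gt0.
Qed.

Lemma is_derive_flat P n t :
  is_derive t 1 (flat P n) (flat (flat_deriv P n) n t).
Proof.
have [t0|t0|->] := ltgtP t 0.
- apply: (@near_eq_is_derive _ _ _ (cst 0)); last first.
    rewrite [X in is_derive _ _ _ X](_ : _ = 0); first exact: is_derive_cst.
    by rewrite /flat ltNge (ltW t0).
  near=> s; rewrite /flat ifF//; apply/negbTE; rewrite -leNgt ltW//.
  by near: s; exact: lt_nbhsl.
- have tn0 : t != 0 by rewrite gt_eqF.
  pose g s := P.[s^-1] * expR (- (n.+1%:R^-1 * s^-1)).
  apply: (@near_eq_is_derive _ _ _ g).
    near=> s; rewrite /flat ifT//.
    by near: s; exact: lt_nbhsr.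
  have dV : is_derive t 1 (fun s : R => s^-1) (- t ^- 2).
    by apply: is_derive_eq (is_deriveV _ _) _ => //; rewrite scaler1.
  have dN : is_derive t 1 (fun s : R => - (n.+1%:R^-1 * s^-1)) (n.+1%:R^-1 * t ^- 2).
    apply: is_derive_eq (is_deriveN (is_deriveZ n.+1%:R^-1 dV)) _.
    by rewrite /= scalerN opprK.
  have dE := @is_derive1_comp R expR (fun s : R => - (n.+1%:R^-1 * s^-1)) t _ _
    (is_derive_expR _) dN.
  have dP := @is_derive1_comp R (horner P) (fun s : R => s^-1) t _ _
    (is_derive_poly P t^-1) dV.
  apply: is_derive_eq (is_deriveM dP dE) _.
  rewrite /flat t0 /flat_deriv !hornerE /= /GRing.scale/=.
  by rewrite exprVn; ring.
- rewrite [X in is_derive _ _ _ X](_ : _ = 0); last by rewrite /flat ltxx.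
  (* The difference quotient of [flat P n] at 0 is [flat ('X * P) n], so the linear bound for
     ['X * P] makes it tend to 0. *)
  have [K hK] := flat_le ('X * P) n.
  have cv : h^-1 *: ((flat P n \o shift 0) (h *: 1) - flat P n 0) @[h --> 0^'] --> (0 : R).
    apply/cvgr0Pnorm_le => e e0; near=> h.
    have h0 : h != 0 by near: h; exact: nbhs_dnbhs_neq.
    rewrite (_ : _ *: _ = flat ('X * P) n h); last first.
      rewrite /= /GRing.scale/= addr0 mulr1 /flat ltxx subr0.
      case: ifPn => _; last by rewrite mulr0.
      by rewrite hornerM hornerX mulrA.
    have h1 : `|h| <= 1.
      by near: h; apply: (@dnbhs0_le _ R^o).
    apply: le_trans (hK _ h1) _.
    have : `|h| <= e / (`|K| + 1).
      by near: h; apply: (@dnbhs0_le _ R^o); rewrite divr_gt0// ltr_wpDl.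
    rewrite ler_pdivlMr ?ltr_wpDl// => he; apply: le_trans he.
    by rewrite mulrC ler_wpM2l// (le_trans (ler_norm _))// lerDl.
  by apply: DeriveDef; [apply/cvg_ex; exists 0|exact/cvg_lim].
Unshelve. all: end_near. Qed.

Lemma continuous_flat P n : continuous (flat P n).
Proof.
move=> t; apply: differentiable_continuous; apply/derivable1_diffP.
by case: (is_derive_flat P n t).
Qed.

End flat.

Section line_derivative.
Context {R : realType} {V : normedModType R}.

Lemma is_derive_line (f : V -> R) (x v : V) (t l : R) :
  is_derive (x + t *: v) v f l <->
  is_derive t 1 (fun s => f (x + s *: v)) l.
Proof.
have E : (fun h => h^-1 *: ((f \o shift (x + t *: v)) (h *: v) - f (x + t *: v))) =
    (fun h => h^-1 *: (((fun s => f (x + s *: v)) \o shift t) (h *: (1 : R)) -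
      f (x + t *: v))).
  apply/funext => h /=; congr (_ *: (f _ - _)).
  by rewrite [h *: (1 : R)]mulr1 scalerDl addrCA.
by split => -[d1 d2]; apply: DeriveDef;
  rewrite /derivable/derive in d1 d2 *; rewrite -?E// ?E// in d1 d2 *.
Qed.

End line_derivative.

Section bump_expr.
Context {R : realType} {N : nat}.
Implicit Types (x d a b : 'rV[R]_N) (i j : 'I_N).

(* The leaf BFlat P n i s a denotes x |-> flat P n (s * x_i + a). *)
Inductive bexpr :=
| BConst of R
| BFlat of {poly R} & nat & 'I_N & R & R
| BAdd of bexpr & bexpr
| BMul of bexpr & bexpr.

Implicit Types (e : bexpr) (t : R).

Fixpoint beval (e : bexpr) x : R :=
  match e with
  | BConst r => r
  | BFlat P n i s a => flat P n (s * x ord0 i + a)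
  | BAdd e1 e2 => beval e1 x + beval e2 x
  | BMul e1 e2 => beval e1 x * beval e2 x
  end.

Fixpoint bderiv i (e : bexpr) : bexpr :=
  match e with
  | BConst r => BConst 0
  | BFlat P n j s a =>
      if i == j then BMul (BConst s) (BFlat (flat_deriv P n) n j s a) else BConst 0
  | BAdd e1 e2 => BAdd (bderiv i e1) (bderiv i e2)
  | BMul e1 e2 => BAdd (BMul (bderiv i e1) e2) (BMul e1 (bderiv i e2))
  end.

Fixpoint btrans d (e : bexpr) : bexpr :=
  match e with
  | BConst r => BConst r
  | BFlat P n j s a => BFlat P n j s (s * d ord0 j + a)
  | BAdd e1 e2 => BAdd (btrans d e1) (btrans d e2)
  | BMul e1 e2 => BMul (btrans d e1) (btrans d e2)
  end.

Lemma beval_btrans d e x : beval (btrans d e) x = beval e (x + d).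
Proof.
elim: e => //= [P n j s a|e1 -> e2 ->|e1 -> e2 ->]//.
by rewrite mxE mulrDr addrA.
Qed.

Lemma bderiv_btrans i d e : bderiv i (btrans d e) = btrans d (bderiv i e).
Proof.
by elim: e => //= [P n j s a|e1 -> e2 ->|e1 -> e2 ->]//; case: ifP.
Qed.

(** Symmetry of mixed derivatives comes from the formal rules: a leaf depends on a single
    coordinate, so at a leaf either i = j or both mixed derivatives vanish. *)
Lemma beval_bderivC i j e x :
  beval (bderiv i (bderiv j e)) x = beval (bderiv j (bderiv i e)) x.
Proof.
elim: e => //= [P n l s a|e1 -> e2 ->|e1 h1 e2 h2]//.
  have [->|jl] := eqVneq j l; have [->|il] := eqVneq i l => //=;
    rewrite ?eqxx ?(negbTE il) ?(negbTE jl)//=; by rewrite mul0r mulr0 addr0.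
by rewrite h1 h2; ring.
Qed.

Lemma is_derive_beval_line e x d t :
  is_derive t 1 (fun u => beval e (x + u *: d))
    (\sum_i d ord0 i * beval (bderiv i e) (x + t *: d)).
Proof.
elim: e => /= [r|P n j s a|e1 h1 e2 h2|e1 h1 e2 h2].
- by rewrite big1; [exact: is_derive_cst|move=> i _; rewrite mulr0].
- have dl : is_derive t 1 (fun u => s * (x + u *: d) ord0 j + a) (s * d ord0 j).
    rewrite [X in is_derive _ _ X _](_ : _ =
        (fun u : R => (s * d ord0 j) *: u + (s * x ord0 j + a))); last first.
      by apply/funext => u; rewrite !mxE /GRing.scale/=; ring.
    apply: is_derive_eq
      (is_deriveD (is_deriveZ (s * d ord0 j) (is_derive_id t 1))
                  (is_derive_cst (s * x ord0 j + a) t 1)) _.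
    by rewrite /GRing.scale/= mulr1 addr0.
  have := @is_derive1_comp R (flat P n) _ t _ _ (is_derive_flat _ _ _) dl.
  move=> h; apply: is_derive_eq h _.
  rewrite (bigD1 j)//= eqxx/= big1 ?addr0; first by ring.
  by move=> i ij; rewrite (negbTE ij)/= mulr0.
- by apply: is_derive_eq (is_deriveD h1 h2) _; rewrite -big_split/=;
    apply: eq_bigr => i _; rewrite mulrDr.
- apply: is_derive_eq (is_deriveM h1 h2) _.
  rewrite /GRing.scale/= !mulr_sumr -big_split/=; apply: eq_bigr => i _; ring.
Qed.

Lemma is_derive_beval e x i :
  is_derive x (delta_mx ord0 i) (beval e) (beval (bderiv i e) x).
Proof.
have := is_derive_beval_line e x (delta_mx ord0 i) 0.
move/is_derive_line; rewrite scale0r addr0 => h; apply: is_derive_eq h _.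
rewrite (bigD1 i)//= mxE !eqxx mul1r big1 ?addr0// => j ji.
by rewrite mxE (negbTE ji) andbF mul0r.
Qed.

Lemma partial_beval i e : partial i (beval e) = beval (bderiv i e).
Proof. by apply/funext => x; case: (is_derive_beval e x i). Qed.

Lemma continuous_beval e : continuous (beval e).
Proof.
elim: e => /= [r|P n j s a|e1 h1 e2 h2|e1 h1 e2 h2] x.
- exact: cst_continuous.
- apply: (@continuous_comp _ _ _ (fun x : 'rV[R]_N => s * x ord0 j + a) (flat P n));
    last exact: continuous_flat.
  apply: continuousD; last exact: cst_continuous.
  by apply: continuousM; [exact: cst_continuous|exact: coord_continuous].
- exact: continuousD (h1 x) (h2 x).
- exact: continuousM (h1 x) (h2 x).
Qed.

Lemma smooth_beval e : smooth (beval e).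
Proof.
move=> s g.
have [e' ->] : exists e', g = beval e'.
  rewrite /g; elim: s {g} => [|i s [e' IH]] /=; first by exists e.
  by exists (bderiv i e'); rewrite IH partial_beval.
split; first exact: continuous_beval.
by move=> i x; case: (is_derive_beval e' x i).
Qed.

Lemma bump_test_function (U : set 'rV[R]_N) a b e :
  [set x : 'rV[R]_N | forall i, a ord0 i <= x ord0 i <= b ord0 i] `<=` U ->
  (forall x : 'rV[R]_N, ~ (forall i, a ord0 i <= x ord0 i <= b ord0 i) -> beval e x = 0) ->
  test_function U (beval e).
Proof.
set K := [set x | _] => KU e0.
have cK : closed K.
  rewrite [X in closed X](_ : _ = \bigcap_(i in [set: 'I_N])
    ((fun x : 'rV[R]_N => x ord0 i) @^-1` `[a ord0 i, b ord0 i]%classic)).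
    apply: closed_bigI => i _.
    apply: closed_comp; last exact: interval_closed.
    by move=> x _; exact: coord_continuous.
  apply/seteqP; split => [x Kx i _|x Kx i].
    by rewrite /= in_itv/=; exact: Kx.
  by have := Kx i I; rewrite /= in_itv.
have sK : closure [set x | beval e x != 0] `<=` K.
  rewrite [X in _ `<=` X](closure_id K).1//; apply: closure_subset => x /=.
  by apply: contraPP => /= h; move/e0: h => ->; rewrite eqxx.
split; [exact: smooth_beval| |exact: subset_trans KU].
apply: subclosed_compact sK; first exact: closed_closure.
apply: bounded_closed_compact => //.
exists (`|a| + `|b|); split; first by rewrite num_real.
move=> M hM x Kx; apply: ltW; apply: le_lt_trans hM.
rewrite [leLHS]/Num.norm/= mx_normrE; apply: bigmax_le; first exact: addr_ge0.
move=> [i j] _ /=; rewrite (ord1 i) ler_norml.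
have /andP[h1 h2] := Kx j.
have := ler_norm_coord a j; have := ler_norm_coord b j.
rewrite !ler_norml => /andP[h3 h4] /andP[h5 h6].
have := normr_ge0 a; have := normr_ge0 b => ? ?.
by apply/andP; split; lra.
Qed.

(** Each coordinate contributes two flat factors, one vanishing up to a_i and one from b_i on; both
    tend to 1 strictly inside as n grows. *)
Definition box_bump n a b : bexpr :=
  foldr (fun i e => BMul (BMul (BFlat 1 n i 1 (- a ord0 i)) (BFlat 1 n i (-1) (b ord0 i)))
    e)
    (BConst 1) (enum 'I_N).

Lemma box_bumpE n a b x : beval (box_bump n a b) x =
  \prod_i (flat 1 n (x ord0 i - a ord0 i) * flat 1 n (b ord0 i - x ord0 i)).
Proof.
rewrite /box_bump -big_enum/=; elim: (enum _) => [|i s IH] /=; first by rewrite big_nil.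
by rewrite big_cons IH mul1r mulN1r [- _ + _]addrC.
Qed.

Lemma flat1_ge0 n (t : R) : 0 <= flat 1 n t.
Proof. by rewrite /flat; case: ifP => // _; rewrite hornerC mul1r expR_ge0. Qed.

Lemma flat1_le1 n (t : R) : flat 1 n t <= 1.
Proof.
rewrite /flat; case: ifPn => // t0; rewrite hornerC mul1r expR_le1 oppr_le0.
by rewrite mulr_ge0// invr_ge0// ltW.
Qed.

Lemma cvg_flat1 (t : R) : 0 < t -> flat 1 n t @[n --> \oo] --> (1 : R).
Proof.
move=> t0; rewrite /flat t0.
under eq_cvg do rewrite hornerC mul1r.
suff : expR (- (n.+1%:R^-1 * t^-1)) @[n --> \oo] --> (expR 0 : R) by rewrite expR0.
apply: (@cvg_comp _ _ _ (fun n : nat => - (n.+1%:R^-1 * t^-1)) expR _ (nbhs (0 : R)));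
  last exact: continuous_expR.
have := cvgN (cvgMr_tmp (b := t^-1) (@cvg_harmonic R)).
rewrite mul0r oppr0 => h; exact: h.
Qed.

Lemma box_bump_ge0 n a b x : 0 <= beval (box_bump n a b) x.
Proof.
by rewrite box_bumpE; apply: prodr_ge0 => i _; rewrite mulr_ge0// flat1_ge0.
Qed.

Lemma box_bump_le1 n a b x : beval (box_bump n a b) x <= 1.
Proof.
rewrite box_bumpE; apply: prodr_ile1 => i _.
by rewrite mulr_ge0 ?flat1_ge0//= mulr_ile1 ?flat1_ge0 ?flat1_le1.
Qed.

Lemma box_bump_out n a b x : ~ obox a b x -> beval (box_bump n a b) x = 0.
Proof.
move=> /existsNP[i hi]; rewrite box_bumpE (bigD1 i)//= /flat !subr_gt0.
by case: ifP hi => h1; case: ifP => h2; rewrite ?mulr0 ?mul0r// h1 h2.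
Qed.

Lemma cvg_box_bump a b x :
  beval (box_bump n a b) x @[n --> \oo] --> (\1_(obox a b) x : R).
Proof.
rewrite indicE; have [/set_mem xab|/negP xab] := boolP (x \in obox a b); last first.
  rewrite (_ : (fun _ => _) = cst 0); first exact: cvg_cst.
  by apply/funext => n; rewrite box_bump_out// => h; apply: xab; rewrite inE.
under eq_cvg do rewrite box_bumpE.
suff : \prod_i (flat 1 n (x ord0 i - a ord0 i) * flat 1 n (b ord0 i - x ord0 i))
    @[n --> \oo] --> \prod_(i < N) (1 * 1 : R) by rewrite mulr1 big1_eq.
apply: cvg_big => //; first exact: mul_continuous.
by move=> i _; have /andP[ax xb] := xab i; apply: cvgM;
  apply: cvg_flat1; rewrite subr_gt0.
Qed.

End bump_expr.

(** * The fundamental lemma of the calculus of variations *)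

Section fundamental_lemma.
Context {R : realType} {N : nat}.
Implicit Types (U : set 'rV[R]_N) (f g phi : 'rV[R]_N -> R) (a b : 'rV[R]_N).
Local Notation mu := (@lebesgue_measure_rV R N).

Lemma test_function_bounded U phi : test_function U phi ->
  exists M, forall x, `|phi x| <= M.
Proof.
move=> [sphi cK KU]; have [cphi _] := sphi [::].
have /compact_bounded[M [_ hM]] : compact (phi @` closure [set x | phi x != 0]).
  by apply: continuous_compact => //; apply: continuous_subspaceT.
exists (`|M| + 1) => x; have [->|px0] := eqVneq (phi x) 0.
  by rewrite normr0 addr_ge0.
apply: hM; first by rewrite ltr_pwDr// ler_norm.
by exists x => //; exact: subset_closure.
Qed.

Lemma measurable_test_function U phi : test_function U phi ->
  measurable_fun [set: 'rV[R]_N] phi.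
Proof. by move=> [/(_ [::])[cphi _] _ _]; exact: continuous_measurable_rV. Qed.

(** On the compact closure of the support [f] is integrable and [phi] is bounded; elsewhere the
    product vanishes. *)
Lemma test_function_integrable U f phi : open U ->
  locally_integrable_rV U f -> test_function U phi ->
  mu.-integrable U (EFin \o (fun x => f x * phi x)).
Proof.
move=> oU [mf fint] tphi; have [M hM] := test_function_bounded tphi.
have mphi := measurable_test_function tphi.
have [_ cK KU] := tphi; set K := closure _ in cK KU.
have mU := open_measurable_rV oU.
have mK : measurable K by apply: closed_measurable_rV; exact: closed_closure.
have iK : mu.-integrable K (EFin \o (fun x => f x * phi x)).
  rewrite [X in mu.-integrable _ X](_ : _ = (EFin \o f) \* (EFin \o phi))%E; last first.
    by apply/funext => x; rewrite /= EFinM.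
  apply: integrableMl => //.
  - apply/integrableP; split.
      by apply/measurable_EFinP; exact: measurable_funS mf.
    exact: fint K KU cK.
  - exact: measurable_funTS.
  - exists M; split; first exact: num_real.
    by move=> x Mx y _; exact: le_trans (hM y) (ltW Mx).
apply/(integrable_mkcond _ mU); move/(integrable_mkcond _ mK) : iK.
congr (mu.-integrable _ _); apply/funext => x; rewrite /patch.
case: ifPn => [/set_mem/KU Ux|xK]; first by rewrite mem_set.
case: ifPn => // _ /=; have [->|p0] := eqVneq (phi x) 0; first by rewrite mulr0.
by case/negP: xK; rewrite inE; exact: subset_closure.
Qed.

(** Dominated convergence along the bumps gives integral 0 over every sub-box. The sets over which
    the integral of [g] vanishes form a Dynkin system, hence contain all measurable sets, and so [g]
    vanishes almost everywhere. *)
Lemma ae_eq0_obox a b g :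
  mu.-integrable (obox a b) (EFin \o g) ->
  (forall n a' b', (forall i, a ord0 i <= a' ord0 i) -> (forall i, b' ord0 i <= b ord0 i) ->
    (\int[mu]_(x in obox a b) (g x * beval (box_bump n a' b') x) = 0)%R) ->
  {ae mu, forall x, obox a b x -> g x = 0}.
Proof.
move=> ig g0; have mab := @measurable_obox R N a b.
have mg : measurable_fun (obox a b) g.
  by apply/measurable_EFinP; exact: measurable_int ig.
have ibump n a' b' :
    mu.-integrable (obox a b) (EFin \o (fun x => g x * beval (box_bump n a' b') x)).
  rewrite [X in mu.-integrable _ X](_ : _ =
    (EFin \o g) \* (EFin \o beval (box_bump n a' b')))%E; last first.
    by apply/funext => x; rewrite /= EFinM.
  apply: integrableMl => //.
    by apply: measurable_funTS; apply: continuous_measurable_rV; exact: continuous_beval.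
  exists 1; split; first exact: num_real.
  move=> x x1 y _ /=; rewrite ger0_norm ?box_bump_ge0//.
  exact: le_trans (box_bump_le1 _ _ _ _) (ltW x1).
have box0 a' b' : (forall i, a ord0 i <= a' ord0 i) -> (forall i, b' ord0 i <= b ord0 i) ->
    (\int[mu]_(x in obox a' b' `&` obox a b) (g x)%:E = 0)%E.
  move=> aa' bb'.
  have [] := @dominated_convergence _ _ _ mu (obox a b) mab
    (fun n x => (g x * beval (box_bump n a' b') x)%:E)
    ((EFin \o g) \_ (obox a' b')) (fun x => `|(g x)%:E|%E).
  - by move=> n; exact: measurable_int (ibump n a' b').
  - apply: (measurable_restrict _ (measurable_obox _ _) mab).1.
    by apply: measurable_funS (measurable_int _ ig) => //; exact: subIsetl.
  - apply: aeW => x _.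
    rewrite /patch; have := @cvg_box_bump R N a' b' x; rewrite indicE.
    case: ifPn => xab cv.
      rewrite -[X in _ --> X]/((g x)%:E) -[g x in X in _ --> X]mulr1.
      by apply: cvg_EFin; [exact: nearW|exact: cvgMl_tmp].
    rewrite [X in _ --> X](_ : _ = (g x * 0)%:E); last by rewrite mulr0.
    by apply: cvg_EFin; [exact: nearW|exact: cvgMl_tmp].
  - exact: integrable_abse.
  - apply: aeW => x n _; rewrite EFinM abseM -[leRHS]mule1 lee_wpmul2l//.
    by rewrite lee_fin ger0_norm ?box_bump_ge0// box_bump_le1.
  move=> _ _; rewrite -integral_mkcondl => cv.
  suff : (fun n => \int[mu]_(x in obox a b) (g x * beval (box_bump n a' b') x)%:E)%E =
      cst 0%E by move=> h; rewrite h in cv; exact: (cvg_unique _ cv (cvg_cst _)).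
  apply/funext => n; have := g0 n a' b' aa' bb'.
  rewrite /Rintegral => /eqP; rewrite fine_eq0; first by move/eqP.
  exact: (integrable_fin_num mab (ibump n a' b')).
have := @integral_ae_eq _ _ _ mu _ mab (cst 0%E) (EFin \o g) ig.
move=> /(_ (measurable_cst _)) h.
have {}h : ae_eq mu (obox a b) (EFin \o g) (cst 0%E).
  apply: h => E Eab mE; rewrite integral0.
  rewrite -(setIidl Eab).
  have : <<s [set A : set 'rV[R]_N | exists a b, A = obox a b] >> E.
    by rewrite -measurable_rV_obox.
  move: E {Eab mE}.
  apply: dynkin_induction; first exact: measurable_rV_obox.
  - by move=> _ _ [a1 [b1 ->]] [a2 [b2 ->]]; rewrite oboxI; do 2 eexists.
  - by rewrite setTI -[X in integral _ X](setIid (obox a b)); exact: box0.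
  (* An arbitrary box is first intersected with [obox a b], so that its corners satisfy the
     inequalities required by [box0]. *)
  - move=> _ [a1 [b1 ->]] /=.
    rewrite -(setIid (obox a b)) setIA oboxI; apply: box0 => i.
      by rewrite mxE le_max lexx orbT.
    by rewrite mxE ge_min lexx orbT.
  - move=> S mS S0.
    have := @integral_setU _ _ _ mu (S `&` obox a b) (~` S `&` obox a b) (EFin \o g).
    rewrite -setIUl setUv setTI => /(_ (measurableI _ _ mS mab)).
    move=> /(_ (measurableI _ _ (measurableC mS) mab) (measurable_int _ ig)).
    rewrite S0 add0e => <-.
      by rewrite -[X in integral _ X](setIid (obox a b)); exact: box0.
    by apply/disj_setPS => x [[Sx _] [nSx _]].
  - move=> F mF tF F0; rewrite setI_bigcupl integral_bigcup//.
    + by apply: eseries0 => i _ _; exact: F0.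
    + by apply: trivIset_setIr.
    + by move=> k; exact: measurableI.
    + rewrite -setI_bigcupl; apply: integrableS ig => //.
      by apply: measurableI => //; exact: bigcup_measurable.
by apply: filterS h => x /= /[apply] -[].
Qed.

Lemma ae_bigcup (F : nat -> set 'rV[R]_N) (P : 'rV[R]_N -> Prop) :
  (forall n, {ae mu, forall x, F n x -> P x}) ->
  {ae mu, forall x, (\bigcup_n F n) x -> P x}.
Proof.
move=> h.
by have := ae_foralln h; apply: filterS => x hx [n _ Fx]; exact: hx Fx.
Qed.

(** By the countable cover it suffices to argue on one ball; its closure lies in [U], so every bump
    of a sub-box is a test function on [U]. *)
Lemma fundamental_lemma U g : open U -> locally_integrable_rV U g ->
  (forall e, test_function U (beval e) ->
    (\int[mu]_(x in U) (g x * beval e x) = 0)%R) ->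
  {ae mu, forall x, U x -> g x = 0}.
Proof.
move=> oU lg g0; have [F [UE hF]] := open_rV_cover oU.
rewrite UE; apply: ae_bigcup => n.
have [->|[c [r [r0 -> cU]]]] := hF n; first exact: aeW.
rewrite ball_obox//; set a := c - _; set b := c + _.
have abU : [set x : 'rV[R]_N | forall i, a ord0 i <= x ord0 i <= b ord0 i] `<=` U.
  move=> x /= xab; apply: cU; rewrite closed_ball_rVE ?(ltW r0)// => i /=.
  by have := xab i; rewrite !mxE distrC ler_distl.
have oabU : obox a b `<=` U.
  by move=> x xab; apply: abU => i /=; have /andP[/ltW -> /ltW ->] := xab i.
have [mg ig] := lg.
have mU := open_measurable_rV oU.
apply: ae_eq0_obox.
  apply/integrableP; split.
    by apply/measurable_EFinP; exact: measurable_funS oabU mg.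
  pose K := [set x : 'rV[R]_N | `|c - x| <= r].
  have cK : compact K.
    apply: bounded_closed_compact.
      exists (`|c| + r); split; first exact: num_real.
      move=> M hM x /= cx; apply: ltW; apply: le_lt_trans hM.
      rewrite -[x in leLHS](subKr c) (le_trans (ler_normB _ _))//.
      by rewrite lerD2l.
    have -> : K = closed_ball c r by rewrite closed_ballE.
    exact: closed_ball_closed.
  apply: le_lt_trans (ig _ cU cK).
  apply: ge0_subset_integral => //.
  - exact: measurable_obox.
  - by apply: closed_measurable_rV; apply: compact_closed => //; exact: norm_hausdorff.
  - by do 2 apply: measurableT_comp => //; exact: measurable_funS cU mg.
  - by move=> x; rewrite /a /b -ball_obox// mx_norm_ball => /ltW.
move=> n' a' b' aa' bb'.
have tb : test_function U (beval (box_bump n' a' b')).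
  apply: (bump_test_function (a := a') (b := b')).
    move=> x h; apply: abU => i /=; have /andP[h1 h2] := h i.
    by rewrite (le_trans (aa' i))// (le_trans h2).
  move=> x h; apply: box_bump_out => h'; apply: h => i.
  by have /andP[/ltW -> /ltW ->] := h' i.
rewrite -[RHS](g0 _ tb) Rintegral_mkcond [RHS]Rintegral_mkcond.
apply: eq_Rintegral => x _; rewrite /patch.
case: ifPn => [/set_mem/oabU/mem_set ->//|xab]; case: ifPn => // _.
rewrite box_bump_out ?mulr0// => h; case/negP: xab; rewrite inE => i.
have /andP[h1 h2] := h i.
by rewrite (le_lt_trans (aa' i))// (lt_le_trans h2).
Qed.

End fundamental_lemma.

(** * Differences of a function with a weak gradient *)

Section fubini_Rintegral.
Context d1 d2 (T1 : measurableType d1) (T2 : measurableType d2) (R : realType).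
Variables (m1 : {sigma_finite_measure set T1 -> \bar R}).
Variables (m2 : {sigma_finite_measure set T2 -> \bar R}).
Variable f : T1 * T2 -> R.
Hypothesis intf : (m1 \x m2)%E.-integrable setT (EFin \o f).

(** The real-valued inner integral takes a default value where the extended one is infinite;
    integrability confines this to a null set. *)
Lemma integral_Rintegral1 :
  (\int[m1]_x (\int[m2]_y f (x, y))%:E = \int[(m1 \x m2)]_p (f p)%:E)%E.
Proof.
rewrite -(integral12_prod_meas1 intf).
have mF := measurable_fubini_F intf.
apply: ae_eq_integral => //.
  by do 2 apply: measurableT_comp => //.
apply: filterS (ae_integrable1 intf) => x ix _ /=.
by rewrite fineK// (integrable_fin_num measurableT ix).
Qed.

Lemma integrable_Rintegral1 :
  m1.-integrable setT (EFin \o (fun x => \int[m2]_y f (x, y))).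
Proof.
have /integrableP[mF iF] := integrable_fubini_F intf.
apply/integrableP; split; first by do 2 apply: measurableT_comp => //.
apply: le_lt_trans iF; apply: ge0_le_integral => //.
- by do 3 apply: measurableT_comp => //.
- exact: measurableT_comp.
- move=> x _; rewrite /= /fubini_F /Rintegral.
  by case: integral => //=; rewrite normr0 leey.
Qed.

Lemma integral_Rintegral2 :
  (\int[m2]_y (\int[m1]_x f (x, y))%:E = \int[(m1 \x m2)]_p (f p)%:E)%E.
Proof.
rewrite -(integral21_prod_meas1 intf).
have mG := measurable_fubini_G intf.
apply: ae_eq_integral => //.
  by do 2 apply: measurableT_comp => //.
apply: filterS (ae_integrable2 intf) => x ix _ /=.
by rewrite fineK// (integrable_fin_num measurableT ix).
Qed.

Lemma integrable_Rintegral2 :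
  m2.-integrable setT (EFin \o (fun y => \int[m1]_x f (x, y))).
Proof.
have mf := measurable_int _ intf.
have mG := measurable_fubini_G intf.
apply/integrableP; split; first by do 2 apply: measurableT_comp => //.
apply: le_lt_trans ((integrable21ltyP _ _ mf).1 intf).
apply: ge0_le_integral => //.
- by do 3 apply: measurableT_comp => //.
- apply: (measurable_fun_fubini_tonelli_G (abse \o (EFin \o f))) => //=.
  exact: measurableT_comp.
- move=> y _; rewrite /= /Rintegral.
  apply: (@le_trans _ _ `|\int[m1]_x (f (x, y))%:E|)%E.
    by case: integral => //=; rewrite normr0 leey.
  apply: le_abse_integral => //; apply: (measurableT_comp mf).
  exact: pair2_measurable.
Qed.

Lemma Rintegral_Fubini :
  \int[m1]_x \int[m2]_y f (x, y) = \int[m2]_y \int[m1]_x f (x, y).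
Proof.
by rewrite {1}/Rintegral integral_Rintegral1 -integral_Rintegral2.
Qed.

End fubini_Rintegral.

Section translation_average.
Context {R : realType} {N : nat} d (T : measurableType d).
Variable nu : {sigma_finite_measure set T -> \bar R}.
Variable theta : T -> 'rV[R]_N.
Hypothesis mtheta : measurable_fun [set: T] theta.
Local Notation mu := (@lebesgue_measure_rV R N).

Lemma measurable_add_rV :
  measurable_fun [set: 'rV[R]_N * T] (fun p => p.1 + theta p.2).
Proof.
apply: measurable_fun_rV => i; under eq_fun do rewrite mxE.
apply: measurable_funD.
  exact: (measurableT_comp (measurable_rV_coord i) measurable_fst).
apply: (measurableT_comp (measurable_rV_coord i)).
exact: (measurableT_comp mtheta measurable_snd).
Qed.

(** Integrating in x first, translation invariance removes [theta], and the double integral of the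
    absolute value is the product of the two L^1 norms. *)
Lemma integrable_translation_average (c : T -> R) (f : 'rV[R]_N -> R) :
  nu.-integrable setT (EFin \o c) -> mu.-integrable setT (EFin \o f) ->
  (mu \x nu)%E.-integrable setT (fun p => (c p.2 * f (p.1 + theta p.2))%:E).
Proof.
move=> ic intf.
have mf : measurable_fun setT f by apply/measurable_EFinP; exact: measurable_int intf.
have mc : measurable_fun setT c by apply/measurable_EFinP; exact: measurable_int ic.
have mm : measurable_fun [set: 'rV[R]_N * T] (fun p => (c p.2 * f (p.1 + theta p.2))%:E).
  apply/measurable_EFinP; apply: measurable_funM.
    exact: (measurableT_comp mc measurable_snd).
  exact: (measurableT_comp mf measurable_add_rV).
apply/(integrable21ltyP _ _ mm) => /=.
under eq_integral => t _.
  under eq_integral do rewrite normrM EFinM.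
  rewrite ge0_integralZl//; last first.
    apply/measurable_EFinP; apply: measurableT_comp => //.
    apply: (measurableT_comp mf); apply: measurable_fun_rV => i.
    by under eq_fun do rewrite mxE; apply: measurable_funD => //;
      exact: measurable_rV_coord.
  rewrite (integral_translate (theta t) (f := fun x => `|f x|%:E)); last first.
    by apply/measurable_EFinP; apply: measurableT_comp.
  over.
move/integrableP : ic => [_ ic]; move/integrableP : intf => [_ intf].
rewrite ge0_integralZr//.
- by rewrite lte_mul_pinfty// ?integral_ge0// ge0_fin_numE ?integral_ge0.
- by apply/measurable_EFinP; apply: measurableT_comp.
- exact: integral_ge0.
Qed.

End translation_average.

Section Rintegral_extra.
Context d (T : measurableType d) (R : realType).
Variable m : {measure set T -> \bar R}.

Lemma Rintegral_sum (I : Type) (s : seq I) (F : I -> T -> R) :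
  (forall i, m.-integrable setT (EFin \o F i)) ->
  \int[m]_x (\sum_(i <- s) F i x) = \sum_(i <- s) \int[m]_x F i x.
Proof.
move=> iF; rewrite /Rintegral.
under eq_integral do rewrite -sumEFin.
rewrite (integral_sum _ (f := fun i x => (F i x)%:E))//.
rewrite sum_fine// => i _; exact: (integrable_fin_num measurableT (iF i)).
Qed.

Lemma integrableM_bounded (D : set T) (f g : T -> R) (M : R) : measurable D ->
  m.-integrable D (EFin \o f) -> measurable_fun D g ->
  (forall x, D x -> `|g x| <= M) -> m.-integrable D (EFin \o (fun x => f x * g x)).
Proof.
move=> mD intf mg gM.
rewrite [X in m.-integrable _ X](_ : _ = (EFin \o f) \* (EFin \o g))%E; last first.
  by apply/funext => x; rewrite /= EFinM.
apply: integrableMl => //; exists M; split; first exact: num_real.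
by move=> x Mx y Dy; exact: le_trans (gM y Dy) (ltW Mx).
Qed.

Lemma integrableB_EFin (D : set T) (f g : T -> R) : measurable D ->
  m.-integrable D (EFin \o f) -> m.-integrable D (EFin \o g) ->
  m.-integrable D (EFin \o (fun x => f x - g x)).
Proof.
move=> mD jf jg; rewrite [X in m.-integrable _ X](_ : _ =
  ((EFin \o f) \- (EFin \o g))%E); first exact: integrableB.
by apply/funext => x; rewrite /= EFinB.
Qed.

Lemma ae_eq_Rintegral (f g : T -> R) :
  measurable_fun setT f -> measurable_fun setT g ->
  {ae m, forall x, f x = g x} -> \int[m]_x f x = \int[m]_x g x.
Proof.
move=> mf mg fg; rewrite /Rintegral; congr fine; apply: ae_eq_integral => //.
- exact/measurable_EFinP.
- exact/measurable_EFinP.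
- by apply: filterS fg => x -> _.
Qed.

End Rintegral_extra.

Section translation_identity.
Context {R : realType} {N : nat}.
Implicit Types (U O : set 'rV[R]_N) (f w psi : 'rV[R]_N -> R) (d : 'rV[R]_N).
Local Notation mu := (@lebesgue_measure_rV R N).
Local Notation leb := (@lebesgue_measure R).
Local Notation I01 := (\1_`[0%R, 1%R] : R -> R).

Lemma Rintegral_translate f d : measurable_fun [set: 'rV[R]_N] f ->
  \int[mu]_x f (x + d) = \int[mu]_x f x.
Proof.
move=> mf; rewrite /Rintegral.
by rewrite (integral_translate d (f := EFin \o f))//; exact/measurable_EFinP.
Qed.

Lemma measurable_line d : measurable_fun [set: measurableTypeR R]
  (fun t : measurableTypeR R => t *: d : 'rV[R]_N).
Proof.
apply: measurable_fun_rV => i; under eq_fun do rewrite mxE.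
exact: mulrr_measurable.
Qed.

Lemma integrable_I01 : leb.-integrable setT (EFin \o I01).
Proof. exact: integrable_indic_itv. Qed.

Definition line_average d f : 'rV[R]_N -> R :=
  fun x => \int[leb]_t (I01 t * f (x + t *: d)).

Lemma integrable_line_average d f : mu.-integrable setT (EFin \o f) ->
  mu.-integrable setT (EFin \o line_average d f).
Proof.
move=> intf.
have := integrable_translation_average (measurable_line d) integrable_I01 intf.
exact: integrable_Rintegral1.
Qed.

Lemma integrable_line_average_r d f psi M : mu.-integrable setT (EFin \o f) ->
  measurable_fun setT psi -> (forall x, `|psi x| <= M) ->
  (mu \x leb)%E.-integrable setT
    (fun p => (I01 p.2 * f p.1 * psi (p.1 + p.2 *: d))%:E).
Proof.
move=> intf mpsi psiM.
apply: (integrableM_bounded (M := M)) => //.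
  have := integrable_translation_average (nu := leb) (theta := fun=> 0)
    (measurable_cst _) integrable_I01 intf.
  by congr (_.-integrable _ _); apply/funext => p; rewrite addr0.
exact: (measurableT_comp mpsi (measurable_add_rV (measurable_line _))).
Qed.

Lemma line_averageMl d f psi M x : 
  measurable_fun setT psi -> (forall x, `|psi x| <= M) ->
  \int[leb]_t (I01 t * f x * psi (x + t *: d)) = f x * line_average d psi x.
Proof.
move=> mpsi psiM; rewrite /line_average -RintegralZl//.
  by apply: eq_Rintegral => t _; rewrite [in RHS]mulrCA mulrA.
apply: (integrableM_bounded (M := M)) => //; first exact: integrable_I01.
apply: (measurableT_comp mpsi).
apply: measurable_fun_rV => i; under eq_fun do rewrite mxE.
apply: measurable_funD => //.
exact: (measurableT_comp (measurable_rV_coord i) (measurable_line _)).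
Qed.

Lemma integrableM_line_average d f psi M : mu.-integrable setT (EFin \o f) ->
  measurable_fun setT psi -> (forall x, `|psi x| <= M) ->
  mu.-integrable setT (EFin \o (fun x => f x * line_average d psi x)).
Proof.
move=> intf mpsi psiM.
have := integrable_Rintegral1 (integrable_line_average_r d intf mpsi psiM).
congr (_.-integrable _ _); apply/funext => x /=.
by rewrite (line_averageMl _ _ _ mpsi psiM).
Qed.

Lemma Rintegral_line_translate d f psi M t : mu.-integrable setT (EFin \o f) ->
  measurable_fun setT psi -> (forall x, `|psi x| <= M) ->
  \int[mu]_x (I01 t * f x * psi (x + t *: d)) =
  I01 t * \int[mu]_x (f x * psi (x + t *: d)).
Proof.
move=> intf mpsi psiM; rewrite -RintegralZl//.
  by apply: eq_Rintegral => x _; rewrite mulrA.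
apply: (integrableM_bounded (M := M)) => //.
apply: (measurableT_comp mpsi); apply: measurable_fun_rV => i.
by under eq_fun do rewrite mxE; apply: measurable_funD => //; exact: measurable_rV_coord.
Qed.

Lemma line_average_swap d f psi M : mu.-integrable setT (EFin \o f) ->
  measurable_fun setT psi -> (forall x, `|psi x| <= M) ->
  \int[mu]_x (f x * line_average d psi x) =
  \int[leb]_t (I01 t * \int[mu]_x (f x * psi (x + t *: d))).
Proof.
move=> intf mpsi psiM.
have h := integrable_line_average_r d intf mpsi psiM.
transitivity (\int[leb]_t \int[mu]_x (I01 t * f x * psi (x + t *: d))).
  rewrite -(Rintegral_Fubini h)/=; apply: eq_Rintegral => x _.
  by rewrite (line_averageMl _ _ _ mpsi psiM).
by apply: eq_Rintegral => t _; exact: (Rintegral_line_translate _ _ intf mpsi psiM).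
Qed.

(** The adjoint of averaging along d is averaging along -d: for each t the substitution of x - t d
    for x moves the translation from [f] to [psi], and Fubini exchanges x and t. *)
Lemma line_average_dual d f psi M : mu.-integrable setT (EFin \o f) ->
  measurable_fun setT psi -> (forall x, `|psi x| <= M) ->
  \int[mu]_x (line_average d f x * psi x) = \int[mu]_x (f x * line_average (- d) psi x).
Proof.
move=> intf mpsi psiM.
have mf : measurable_fun setT f by apply/measurable_EFinP; exact: measurable_int intf.
have ia := integrable_translation_average (measurable_line d) integrable_I01 intf.
have h1 : (mu \x leb)%E.-integrable setT
    (fun p => (I01 p.2 * f (p.1 + p.2 *: d) * psi p.1)%:E).
  apply: (integrableM_bounded (M := M)) => //.
  exact: (measurableT_comp mpsi measurable_fst).
have h2 := integrable_line_average_r (- d) intf mpsi psiM.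
transitivity (\int[mu]_x \int[leb]_t (I01 t * f (x + t *: d) * psi x)).
  have /integrableP[/measurable_EFinP ml _] := integrable_line_average d intf.
  apply: ae_eq_Rintegral.
  - exact: measurable_funM.
  - by have /integrableP[/measurable_EFinP] := integrable_Rintegral1 h1.
  - apply: filterS (ae_integrable1 ia) => x ix.
    by rewrite RintegralZr.
rewrite (Rintegral_Fubini h1)/=.
transitivity (\int[leb]_t \int[mu]_x (I01 t * f x * psi (x + t *: (- d)))).
  apply: eq_Rintegral => t _.
  rewrite -[LHS](Rintegral_translate (t *: (- d))).
    by apply: eq_Rintegral => x _; rewrite -addrA -scalerDr addNr scaler0 addr0.
  apply: measurable_funM => //; apply: measurable_funM => //.
  apply: (measurableT_comp mf); apply: measurable_fun_rV => i.
  by under eq_fun do rewrite mxE; apply: measurable_funD => //; exact: measurable_rV_coord.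
rewrite -(Rintegral_Fubini h2)/=.
by apply: eq_Rintegral => x _; rewrite (line_averageMl _ _ _ mpsi psiM).
Qed.

Lemma Rintegral_beval_line (e : @bexpr R N) x d :
  \sum_i d ord0 i * line_average d (beval (bderiv i e)) x = beval e (x + d) - beval e x.
Proof.
have cl (e' : @bexpr R N) : continuous (fun t : R => beval e' (x + t *: d)).
  move=> t; apply: differentiable_continuous; apply/derivable1_diffP.
  by case: (is_derive_beval_line e' x d t).
have il i : leb.-integrable setT
    (EFin \o (fun t => I01 t * beval (bderiv i e) (x + t *: d))).
  have [M [_ hM]] : bounded_set ((fun t : R => beval (bderiv i e) (x + t *: d)) @`
    `[0, 1]%classic).
    apply: compact_bounded; apply: continuous_compact; last exact: segment_compact.
    by apply: continuous_subspaceT; exact: cl.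
  have := @integrable_mkcond _ _ R leb `[0,1]%classic
    (EFin \o (fun t => beval (bderiv i e) (x + t *: d))) (measurable_itv _).
  rewrite (_ : _ \_ _ = EFin \o (fun t => I01 t * beval (bderiv i e) (x + t *: d)));
    last first.
    apply/funext => t; rewrite /patch /= indicE; case: ifPn => _; by rewrite ?mul1r ?mul0r.
  move=> [+ _]; apply.
  apply: measurable_bounded_integrable => //.
  - by rewrite /= lebesgue_measure_itv/= lte_fin ltr01 -EFinB ltry.
  - by apply: measurable_funTS; apply: continuous_measurable_fun; exact: cl.
  - exists M; split; first exact: num_real.
    by move=> y My t t01; apply: hM => //; exists t.
pose u (t : R) := beval e (x + t *: d).
transitivity (\int[leb]_t (\sum_i (d ord0 i * (I01 t * beval (bderiv i e) (x + t *: d))))).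
  rewrite Rintegral_sum; last by move=> i;
    exact: (integrableZl measurableT (d ord0 i) (il i)).
  by apply: eq_bigr => i _; rewrite RintegralZl.
pose du (t : R) := \sum_i d ord0 i * beval (bderiv i e) (x + t *: d).
have cdu : continuous du.
  move=> t; apply: cvg_big; first exact: add_continuous.
  by move=> i _; apply: cvgMl_tmp; exact: cl.
have dut (t : R) : is_derive t 1 u (du t) by exact: is_derive_beval_line.
have du01 : derivable_oo_LRcontinuous u 0 1.
  split; first by move=> t _; case: (dut t).
  - by apply: cvg_at_right_filter; exact: cl.
  - by apply: cvg_at_left_filter; exact: cl.
have FTC := @continuous_FTC2 R du u 0 1 ltr01 (continuous_subspaceT cdu) du01.
have {FTC} : (\int[leb]_(t in `[0%R, 1%R]) (du t)%:E = (u 1)%:E - (u 0)%:E)%E.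
  by apply: FTC => t _; rewrite derive1E; case: (dut t).
rewrite -EFinB integral_mkcond => h.
rewrite /Rintegral (_ : (\int[leb]_t _)%E = (u 1 - u 0)%:E).
  by rewrite /= /u scale1r scale0r addr0.
rewrite -h; apply: eq_integral => t _; rewrite /patch /= /du.
under eq_bigr do rewrite mulrCA.
by rewrite -mulr_sumr indicE; case: ifPn => t01; rewrite ?mul1r ?mul0r.
Qed.

Lemma test_function_btrans U O (e : @bexpr R N) d : test_function O (beval e) ->
  (forall x, O x -> U (x - d)) -> test_function U (beval (btrans d e)).
Proof.
move=> [_ cK KO] OU; set K := closure _ in cK KO.
have cK' : compact ((fun x => x - d) @` K).
  apply: continuous_compact => //; apply: continuous_subspaceT => x.
  by apply: (@continuousB _ _ _ id (cst d)) => //; exact: cst_continuous.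
have sK : closure [set x | beval (btrans d e) x != 0] `<=` (fun x => x - d) @` K.
  rewrite [X in _ `<=` X](closure_id _).1; last first.
    by apply: compact_closed => //; exact: norm_hausdorff.
  apply: closure_subset => x /=; rewrite beval_btrans => xd.
  by exists (x + d); [exact: subset_closure|rewrite addrK].
split; first exact: smooth_beval.
  by apply: subclosed_compact sK => //; exact: closed_closure.
by apply: subset_trans sK _ => _ [x Kx <-]; exact: OU (KO _ Kx).
Qed.

Lemma test_function_partial U phi i :
  test_function U phi -> test_function U (partial i phi).
Proof.
move=> [sphi cK KU].
have sK : closure [set x | partial i phi x != 0] `<=` closure [set x | phi x != 0].
  rewrite [X in _ `<=` X](closure_id _).1; last exact: closed_closure.
  apply: closure_subset => x /=; apply: contraPP => nx.
  have oc : open (~` closure [set x | phi x != 0]) by exact/closed_openC/closed_closure.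
  have nearx : \near x, phi x = 0.
    apply: filterS (open_nbhs_nbhs (conj oc nx)) => y /= ny.
    by apply/eqP; apply: contrapT => /negP py; apply: ny; exact: subset_closure.
  apply/negP; rewrite negbK /partial.
  have -> : 'D_(delta_mx ord0 i) phi x = 'D_(delta_mx ord0 i) (cst 0) x.
    exact: near_eq_derive.
  by rewrite derive_cst.
split; last exact: subset_trans KU.
  by move=> s; have := sphi (rcons s i); rewrite foldr_rcons.
by apply: subclosed_compact sK => //; exact: closed_closure.
Qed.

(* Only bump expressions serve as test functions: the class is stable under
   translation and differentiation, and rich enough for fundamental_lemma. *)
Definition weak_gradient U w (G : 'I_N -> 'rV[R]_N -> R) : Prop :=
  forall (e : @bexpr R N) i, test_function U (beval e) ->
    \int[mu]_(x in U) (w x * beval (bderiv i e) x) =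
    - \int[mu]_(x in U) (G i x * beval e x).

Lemma test_function_eq0 U phi : test_function U phi -> forall x, ~ U x -> phi x = 0.
Proof.
move=> [_ _ KU] x nUx; apply/eqP; apply: contrapT => /negP px; apply: nUx.
by apply: KU; exact: subset_closure.
Qed.

(** By [fundamental_lemma], it suffices to test the difference of the two sides against each e
    supported in [O]. The hypothesis on segments makes all translates of e by t d, with t in [0,1],
    test functions on [U], where the weak gradient is available. *)
Lemma weak_gradient_translate U O w (G : 'I_N -> 'rV[R]_N -> R) d :
  open U -> open O ->
  mu.-integrable U (EFin \o w) -> (forall i, mu.-integrable U (EFin \o G i)) ->
  weak_gradient U w G ->
  (forall x, O x -> forall t, 0 <= t <= 1 -> U (x + t *: d)) ->
  {ae mu, forall x, O x ->
    (w \_ U) (x + d) - (w \_ U) x = \sum_i d ord0 i * line_average d (G i \_ U) x}.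
Proof.
move=> oU oO iw iG wG OU.
have mU := open_measurable_rV oU; have mO := open_measurable_rV oO.
have patchE (f : 'rV[R]_N -> R) : (EFin \o f) \_ U = EFin \o (f \_ U).
  by rewrite restrict_EFin.
have iw' : mu.-integrable setT (EFin \o (w \_ U)).
  by rewrite -patchE; exact/(integrable_mkcond _ mU).
have iG' i : mu.-integrable setT (EFin \o (G i \_ U)).
  by rewrite -patchE; exact/(integrable_mkcond _ mU).
have mw : measurable_fun setT (w \_ U) by apply/measurable_EFinP; exact: measurable_int iw'.
have iwd : mu.-integrable setT (EFin \o (fun x => (w \_ U) (x + d))).
  have mwd : measurable_fun [set: 'rV[R]_N] (fun x => (w \_ U) (x + d)).
    apply: (measurableT_comp mw); apply: measurable_fun_rV => i.
    by under eq_fun do rewrite mxE; apply: measurable_funD => //;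
      exact: measurable_rV_coord.
  apply/integrableP; split; first exact/measurable_EFinP.
  rewrite (integral_translate d (f := fun x => `|(w \_ U x)%:E|%E)).
    by case/integrableP : iw'.
  by apply: measurableT_comp => //; exact/measurable_EFinP.
pose S x := \sum_i d ord0 i * line_average d (G i \_ U) x.
have iL i : mu.-integrable setT (EFin \o (fun x => d ord0 i * line_average d (G i \_ U) x)).
  exact: (integrableZl measurableT (d ord0 i) (integrable_line_average d (iG' i))).
have iS : mu.-integrable setT (EFin \o S).
  rewrite [X in mu.-integrable _ X](_ : _ =
    (fun x => \sum_i (d ord0 i * line_average d (G i \_ U) x)%:E)%E).
    exact: (@integrable_sum _ _ _ mu setT measurableT _ _ _
      (fun i x => (d ord0 i * line_average d (G i \_ U) x)%:E) (fun i _ => iL i)).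
  by apply/funext => x; rewrite /= sumEFin.
pose g x := (w \_ U) (x + d) - (w \_ U) x - S x.
have ig : mu.-integrable setT (EFin \o g).
  exact: (integrableB_EFin measurableT (integrableB_EFin measurableT iwd iw') iS).
have lg : locally_integrable_rV O g.
  have /integrableP[mg gfin] := ig.
  split; first by apply: measurable_funTS; exact/measurable_EFinP.
  move=> K KO cK.
  apply: le_lt_trans gfin; apply: ge0_subset_integral => //.
    by apply: closed_measurable_rV; apply: compact_closed => //; exact: norm_hausdorff.
  apply/measurable_EFinP; apply: measurableT_comp => //.
  exact/measurable_EFinP.
have : {ae mu, forall x, O x -> g x = 0}.
  apply: (fundamental_lemma oO lg) => e te.
  have [M hM] := test_function_bounded te.
  have me := measurable_test_function te.
  have e0 := test_function_eq0 te.
  rewrite Rintegral_mkcond.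
  transitivity (\int[mu]_x (g x * beval e x)).
    apply: eq_Rintegral => x _; rewrite /patch; case: ifPn => // xO.
    by rewrite e0 ?mulr0// => Ox; case/negP: xO; rewrite inE.
  have iM f : mu.-integrable setT (EFin \o f) ->
      mu.-integrable setT (EFin \o (fun x => f x * beval e x)).
    by move=> jf; exact: (integrableM_bounded measurableT jf me (fun x _ => hM x)).
  (* Duality moves the average onto e; for each fixed t the weak gradient is tested against the
     translate of e; [line_average_swap] then reassembles the average of the derivative of e. *)
  have dE i : \int[mu]_x (line_average d (G i \_ U) x * beval e x) =
      - \int[mu]_x ((w \_ U) x * line_average (- d) (beval (bderiv i e)) x).
    have tde : test_function O (beval (bderiv i e)).
      by rewrite -partial_beval; exact: test_function_partial.
    have [M' hM'] := test_function_bounded tde.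
    rewrite (line_average_dual _ (iG' i) me hM) (line_average_swap _ (iG' i) me hM).
    rewrite (line_average_swap _ iw' (measurable_test_function tde) hM').
    rewrite -mulN1r -RintegralZl//; last first.
      have h := integrable_line_average_r (- d) iw' (measurable_test_function tde) hM'.
      have := integrable_Rintegral2 h.
      congr (_.-integrable _ _); apply/funext => t /=; congr EFin.
      exact: (Rintegral_line_translate _ _ iw' (measurable_test_function tde) hM').
    apply: eq_Rintegral => t _; rewrite mulrCA mulN1r.
    have [t01|t01] := boolP (t \in `[0, 1]%classic); last first.
      by rewrite indicE (negbTE t01) !mul0r.
    congr (_ * _).
    have tt : test_function U (beval (btrans (t *: (- d)) e)).
      apply: (test_function_btrans te) => x Ox; rewrite scalerN opprK; apply: OU => //.
      by move: t01; rewrite inE/= in_itv.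
    have := wG _ i tt; rewrite Rintegral_mkcond [in X in _ = - X]Rintegral_mkcond.
    have pM (f1 f2 : 'rV[R]_N -> R) : (fun x => f1 x * f2 x) \_ U = fun x =>
      (f1 \_ U) x * f2 x.
      by apply/funext => x; rewrite /patch; case: ifP => // _; rewrite mul0r.
    rewrite !pM bderiv_btrans.
    under eq_Rintegral do rewrite beval_btrans.
    under [in X in _ = - X]eq_Rintegral do rewrite beval_btrans.
    by move=> ->; rewrite opprK.
  transitivity (\int[mu]_x ((w \_ U) (x + d) * beval e x) -
      \int[mu]_x ((w \_ U) x * beval e x) -
      \sum_i d ord0 i * \int[mu]_x (line_average d (G i \_ U) x * beval e x)).
    under eq_Rintegral do rewrite !mulrBl.
    rewrite RintegralB//; last 2 first.
    - exact: (integrableB_EFin measurableT (iM _ iwd) (iM _ iw')).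
    - exact: iM.
    rewrite RintegralB//; [|exact: iM|exact: iM].
    congr (_ - _); under eq_Rintegral do rewrite mulr_suml.
    rewrite (@Rintegral_sum _ _ _ mu _ _
      (fun i x => d ord0 i * line_average d (G i \_ U) x * beval e x)).
      apply: eq_bigr => i _; rewrite -RintegralZl//;
        last exact: iM (integrable_line_average d (iG' i)).
      by apply: eq_Rintegral => x _; rewrite mulrA.
    by move=> i; exact: iM (iL i).
  under [X in _ - X]eq_bigr do rewrite dE mulrN -mulNr.
  have iwl i : mu.-integrable setT (EFin \o (fun x =>
      (w \_ U) x * line_average (- d) (beval (bderiv i e)) x)).
    have tde : test_function O (beval (bderiv i e)).
      by rewrite -partial_beval; exact: test_function_partial.
    have [M' hM'] := test_function_bounded tde.
    exact: (integrableM_line_average _ iw' (measurable_test_function tde) hM').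
  (* By the fundamental theorem of calculus, the averages of the derivatives of e along -d, weighted
     by the -d_i, add up to e(x - d) - e(x). Translating by d then cancels everything. *)
  transitivity (\int[mu]_x ((w \_ U) (x + d) * beval e x) -
      \int[mu]_x ((w \_ U) x * beval e x) -
      \int[mu]_x ((w \_ U) x * (beval e (x - d) - beval e x))).
    congr (_ - _).
    transitivity (\int[mu]_x \sum_i (- d ord0 i *
        ((w \_ U) x * line_average (- d) (beval (bderiv i e)) x))).
      rewrite Rintegral_sum.
        by apply: eq_bigr => i _; rewrite RintegralZl.
      by move=> i; exact: (integrableZl measurableT (- d ord0 i) (iwl i)).
    apply: eq_Rintegral => x _; rewrite -Rintegral_beval_line mulr_sumr.
    by apply: eq_bigr => i _; rewrite mxE mulrCA.
  under [in X in _ - X]eq_Rintegral do rewrite mulrBr.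
  have med : measurable_fun [set: 'rV[R]_N] (fun x => beval e (x - d)).
    apply: (measurableT_comp me); apply: measurable_fun_rV => i.
    by under eq_fun do rewrite mxE; apply: measurable_funD => //;
      exact: measurable_rV_coord.
  have ied : mu.-integrable setT (EFin \o (fun x => (w \_ U) x * beval e (x - d))).
    exact: (integrableM_bounded measurableT iw' med (fun x _ => hM (x - d))).
  rewrite (RintegralB measurableT ied (iM _ iw')).
  rewrite -(Rintegral_translate d (f := fun x => (w \_ U) x * beval e (x - d))).
    under [in X in _ - (X - _)]eq_Rintegral do rewrite addrK.
    by rewrite subrr.
  exact: measurable_funM.
by apply: filterS => x /= /[apply] /eqP; rewrite subr_eq0 => /eqP.
Qed.

End translation_identity.

(** * Averages of translates in L^p *)

Section Lnorm_extra.
Context d (T : measurableType d) (R : realType).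
Variable m : {measure set T -> \bar R}.
Implicit Types (f g : T -> \bar R) (p : \bar R).
Local Open Scope ereal_scope.

Lemma le_Lnorm p f g : 1 <= p ->
  measurable_fun setT f -> measurable_fun setT g ->
  {ae m, forall x, `|f x| <= `|g x|} -> 'N[m]_p[f] <= 'N[m]_p[g].
Proof.
move=> p1 mf mg fg; rewrite unlock /Lnorm; case: p p1 => [r|_|//]; last first.
  by case: ifPn => // _; exact: le_ess_sup.
rewrite lee_fin => r1; have r0 : (0 < r)%R by exact: lt_le_trans r1.
apply: gt0_ler_poweR; rewrite ?invr_ge0 ?(ltW r0)//.
- by rewrite in_itv/= leey andbT; apply: integral_ge0 => x _; exact: poweR_ge0.
- by rewrite in_itv/= leey andbT; apply: integral_ge0 => x _; exact: poweR_ge0.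
apply: ae_ge0_le_integral => //.
- by move=> x _; exact: poweR_ge0.
- by apply: (measurableT_comp (measurable_poweR _)); exact: measurableT_comp.
- by move=> x _; exact: poweR_ge0.
- by apply: (measurableT_comp (measurable_poweR _)); exact: measurableT_comp.
apply: filterS fg => x fgx _; apply: gt0_ler_poweR => //; rewrite ?(ltW r0)//.
- by rewrite in_itv/= abse_ge0 leey.
- by rewrite in_itv/= abse_ge0 leey.
Qed.

(** Jensen's inequality for a measure of mass M, obtained from Hoelder applied to [\1_D] and
    [\1_D * g] with exponents q = r/(r-1) and r. The case r = 1 is separate since q would be
    infinite. *)
Lemma integral_indic_poweR_le (D : set T) (M r : R) (g : T -> R) :
  measurable D -> m D = M%:E -> (1 <= r)%R ->
  measurable_fun setT g -> (forall x, 0 <= g x)%R ->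
  (\int[m]_x (\1_D x * g x)%:E) `^ r <=
  (M `^ (r - 1))%:E * \int[m]_x (\1_D x * g x `^ r)%:E.
Proof.
move=> mD DM r1 mg g0.
have M0 : (0 <= M)%R by rewrite -lee_fin -DM.
have mD1 : measurable_fun setT (\1_D : T -> R) by exact: measurable_indic.
have r0 : (0 < r)%R by exact: lt_le_trans r1.
move: r1; rewrite le_eqVlt => /predU1P[<-|r1].
  rewrite subrr powRr0 mul1e poweRe1; last first.
    by apply: integral_ge0 => x _; rewrite lee_fin mulr_ge0.
  by under [leRHS]eq_integral do rewrite powRr1//.
pose q := (r / (r - 1))%R.
have rB0 : (0 < r - 1)%R by rewrite subr_gt0.
have q0 : (0 < q)%R by rewrite divr_gt0.
have rq : (q^-1 + r^-1 = 1)%R by rewrite /q; field; rewrite !gt_eqF.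
have indicX (x : T) (s : R) : (0 < s)%R -> ((\1_D x : R) `^ s = \1_D x)%R.
  by move=> s0; rewrite indicE; case: (_ \in _); rewrite ?powR1// powR0// gt_eqF.
have := @hoelder _ _ R m (\1_D) (fun x => \1_D x * g x)%R q r mD1
  (measurable_funM mD1 mg) q0 r0 rq.
have -> : 'N[m]_1[EFin \o (\1_D \* (fun x => \1_D x * g x))%R] =
  \int[m]_x (\1_D x * g x)%:E.
  rewrite Lnorm1; apply: eq_integral => x _ /=.
  rewrite ger0_norm ?mulr_ge0// mulrA; congr (_ * _)%:E.
  by rewrite indicE; case: (_ \in _); rewrite ?mulr1 ?mulr0.
have -> : 'N[m]_q%:E[EFin \o \1_D] = (M `^ (q^-1))%:E.
  rewrite -poweR_EFin -DM -[D in m D]setIT -integral_indic// unlock /Lnorm.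
  congr (_ `^ _); apply: eq_integral => x _.
  by rewrite /= ger0_norm// indicX.
move=> h.
have {h} : (\int[m]_x (\1_D x * g x)%:E) `^ r <=
    ((M `^ q^-1)%:E * 'N[m]_r%:E[EFin \o (fun x => \1_D x * g x)%R]) `^ r.
  apply: gt0_ler_poweR h; rewrite ?(ltW r0)// in_itv/= leey andbT.
    by apply: integral_ge0 => x _; rewrite lee_fin mulr_ge0.
  by apply: mule_ge0; [rewrite lee_fin; exact: powR_ge0|exact: Lnorm_ge0].
rewrite poweRM; [|by rewrite lee_fin powR_ge0|exact: Lnorm_ge0].
rewrite poweR_Lnorm ?gt_eqF// poweR_EFin -powRrM.
have -> : (q^-1 * r = r - 1)%R by rewrite /q; field; rewrite !gt_eqF.
congr (_ <= _ * _); apply: eq_integral => x _ /=.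
by rewrite ger0_norm ?mulr_ge0// powRM// indicX.
Qed.

Lemma Lnorm_ge0_EFin (p : \bar R) (M : R) f : (0 <= M)%R -> 1 <= p ->
  measurable_fun setT f -> 'N[m]_p[(fun x => M%:E * f x)] = M%:E * 'N[m]_p[f].
Proof.
move=> M0 p1 mf; rewrite unlock /Lnorm; case: p p1 => [r|_|//].
  rewrite lee_fin => r1; have r0 : (0 < r)%R by exact: lt_le_trans r1.
  under eq_integral => x _.
    rewrite abseM poweRM ?abse_ge0// gee0_abs ?lee_fin// poweR_EFin. over.
  rewrite ge0_integralZl//.
  - rewrite poweRM; first by rewrite poweR_EFin -powRrM divff ?gt_eqF// powRr1.
      by rewrite lee_fin powR_ge0.
    by apply: integral_ge0 => x _; exact: poweR_ge0.
  - by apply: (measurableT_comp (measurable_poweR _)); exact: measurableT_comp.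
  - by move=> x _; exact: poweR_ge0.
  - by rewrite lee_fin powR_ge0.
case: ifPn => mT; last by rewrite mule0.
rewrite -ess_supZl//; congr ess_sup; apply/funext => x /=.
by rewrite abseM gee0_abs ?lee_fin.
Qed.

End Lnorm_extra.

Section product_measure_sigma_finite.
Context d1 d2 (T1 : measurableType d1) (T2 : measurableType d2) (R : realType).
Variables (m1 : {sigma_finite_measure set T1 -> \bar R}).
Variables (m2 : {sigma_finite_measure set T2 -> \bar R}).

Lemma product_measure1_sigma_finite : sigma_finite setT (m1 \x m2)%E.
Proof.
have /sigma_finiteP[F [TF ndF Foo]] := sigma_finiteT m1.
have /sigma_finiteP[G [TG ndG Goo]] := sigma_finiteT m2.
exists (fun n => F n `*` G n).
  apply/seteqP; split => // -[x y] _.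
  have [n _ Fx] : (\bigcup_n F n) x by rewrite -TF.
  have [k _ Gy] : (\bigcup_n G n) y by rewrite -TG.
  exists (maxn n k) => //; split => /=.
    by move: Fx; exact/subsetPset/ndF/leq_maxl.
  by move: Gy; exact/subsetPset/ndG/leq_maxr.
move=> k; have [mF F_fin] := Foo k; have [mG G_fin] := Goo k.
split; first exact: measurableX.
by rewrite product_measure1E// lte_mul_pinfty// ge0_fin_numE.
Qed.

(* The library makes the product measure sigma-finite only for subprobability
   factors. *)
Definition product_sigma_finite : {sigma_finite_measure set (T1 * T2)%type -> \bar R} :=
  HB.pack_for (SigmaFiniteMeasure.type (T1 * T2)%type R) (product_measure1 m1 m2)
    (Measure_isSigmaFinite.Build _ _ _ (product_measure1 m1 m2)
       product_measure1_sigma_finite).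

End product_measure_sigma_finite.

Section Lnorm_average.
Context {R : realType} {N : nat} d (T : measurableType d).
Variable nu : {sigma_finite_measure set T -> \bar R}.
Variable theta : T -> 'rV[R]_N.
Hypothesis mtheta : measurable_fun [set: T] theta.
Local Notation mu := (@lebesgue_measure_rV R N).
Local Open Scope ereal_scope.

(** The average is not normalised: it multiplies constants by [nu D]. The abstract parameter space
    lets [theta] be a displacement d or a point t d of a segment. *)
Definition average (D : set T) (f : 'rV[R]_N -> R) (x : 'rV[R]_N) : \bar R :=
  \int[nu]_t (\1_D t * f (x + theta t)%R)%:E.

Lemma measurable_average_integrand (D : set T) (f : 'rV[R]_N -> R) :
  measurable D -> measurable_fun setT f ->
  measurable_fun [set: 'rV[R]_N * T]
    (fun p => (\1_D p.2 * f (p.1 + theta p.2)%R)%:E).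
Proof.
move=> mD mf; apply/measurable_EFinP; apply: measurable_funM.
  have m1D : measurable_fun setT (\1_D : T -> R) by exact: measurable_indic.
  exact: (measurableT_comp m1D measurable_snd).
exact: (measurableT_comp mf (measurable_add_rV mtheta)).
Qed.

Lemma measurable_average (D : set T) (f : 'rV[R]_N -> R) :
  measurable D -> measurable_fun setT f -> (forall x, 0 <= f x)%R ->
  measurable_fun setT (average D f).
Proof.
move=> mD mf f0.
apply: (measurable_fun_fubini_tonelli_F (m2 := nu) _
  (measurable_average_integrand mD mf)) => x.
by rewrite lee_fin mulr_ge0.
Qed.

Lemma average_ge0 (D : set T) (f : 'rV[R]_N -> R) x :
  (forall x, 0 <= f x)%R -> 0 <= average D f x.
Proof. by move=> f0; apply: integral_ge0 => t _; rewrite lee_fin mulr_ge0. Qed.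

Lemma integral_average (D : set T) (M : R) (f : 'rV[R]_N -> R) :
  measurable D -> nu D = M%:E -> measurable_fun setT f -> (forall x, 0 <= f x)%R ->
  \int[mu]_x average D f x = M%:E * \int[mu]_x (f x)%:E.
Proof.
move=> mD DM mf f0.
rewrite (fubini_tonelli (m1 := mu) (m2 := nu) _ (measurable_average_integrand mD mf))/=;
  last first.
  by move=> x; rewrite lee_fin mulr_ge0.
have mfE : measurable_fun setT (EFin \o f) by exact/measurable_EFinP.
under eq_integral => t _.
  under eq_integral do rewrite EFinM.
  rewrite ge0_integralZl//; last 2 first.
  - apply: (measurableT_comp mfE); apply: measurable_fun_rV => i.
    by under eq_fun do rewrite mxE; apply: measurable_funD => //;
      exact: measurable_rV_coord.
  - by move=> x _; rewrite lee_fin.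
  rewrite (integral_translate (theta t) (f := EFin \o f))//.
  over.
rewrite ge0_integralZr//.
- congr (_ * _); rewrite -DM -[D in RHS]setIT; exact: integral_indic.
- by apply/measurable_EFinP; exact: measurable_indic.
- by apply: integral_ge0 => x _; rewrite lee_fin.
Qed.

(** For finite p = r, Jensen at each x gives the factor M^(r-1) and Tonelli with translation
    invariance one more factor M; the r-th root leaves M. For p = +oo a null set has to be followed
    through the translations. *)
Lemma Lnorm_average (D : set T) (M : R) (p : \bar R) (f : 'rV[R]_N -> R) :
  measurable D -> nu D = M%:E -> 1 <= p ->
  measurable_fun setT f -> (forall x, 0 <= f x)%R -> 'N[mu]_p[EFin \o f] < +oo ->
  'N[mu]_p[average D f] <= M%:E * 'N[mu]_p[EFin \o f].
Proof.
move=> mD DM p1 mf f0.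
have M0 : (0 <= M)%R by rewrite -lee_fin -DM.
rewrite unlock /Lnorm; case: p p1 => [r|_|//].
  rewrite lee_fin => r1 _; have r0 : (0 < r)%R by exact: lt_le_trans r1.
  have -> : M%:E = (M `^ r)%:E `^ r^-1.
    by rewrite poweR_EFin -powRrM divff ?gt_eqF// powRr1.
  rewrite -poweRM ?lee_fin ?powR_ge0//; last first.
    by apply: integral_ge0 => x _; exact: poweR_ge0.
  apply: gt0_ler_poweR; rewrite ?invr_ge0 ?(ltW r0)//.
  - by rewrite in_itv/= leey andbT; apply: integral_ge0 => x _; exact: poweR_ge0.
  - rewrite in_itv/= leey andbT mule_ge0 ?lee_fin ?powR_ge0//.
    by apply: integral_ge0 => x _; rewrite lee_fin powR_ge0.
  have mfr : measurable_fun setT (fun x => f x `^ r)%R.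
    exact: (measurableT_comp (measurable_powR r) mf).
  apply: (@le_trans _ _ (\int[mu]_x ((M `^ (r - 1))%:E * average D (fun x => f x `^ r)%R
    x))).
    apply: ge0_le_integral => //.
    + by move=> x _; exact: poweR_ge0.
    + apply: (measurableT_comp (measurable_poweR _)); apply: measurableT_comp => //.
      exact: measurable_average.
    + apply: measurable_funeM; apply: measurable_average => // x; exact: powR_ge0.
    + move=> x _; rewrite gee0_abs ?average_ge0//.
      apply: integral_indic_poweR_le => //.
      apply: (measurableT_comp mf).
      exact: (measurableT_comp (measurable_add_rV mtheta) (pair1_measurable x)).
  rewrite ge0_integralZl//; last 3 first.
  - by apply: measurable_average => // x; exact: powR_ge0.
  - by move=> x _; apply: average_ge0 => y; exact: powR_ge0.
  - by rewrite lee_fin powR_ge0.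
  rewrite (integral_average mD DM mfr); last by move=> x; exact: powR_ge0.
  rewrite muleA -EFinM.
  have -> : (M `^ (r - 1) * M = M `^ r)%R.
    move: M0; rewrite le_eqVlt => /predU1P[<-|M0].
      by rewrite mulr0 powR0// gt_eqF.
    by rewrite -[X in (_ * X)%R]powRr1 ?(ltW M0)// -powRD ?subrK// (gt_eqF M0) implybT.
  rewrite lee_wpmul2l ?lee_fin ?powR_ge0//.
  under [leRHS]eq_integral do rewrite /= ger0_norm//.
  exact: lexx.
case: ifPn => muT; last by rewrite mule0.
set S := ess_sup _ _ => Sfin.
have S0 : 0 <= S by apply: ess_sup_gee => //; apply: aeW => x; exact: abse_ge0.
have Sf : S \is a fin_num by rewrite ge0_fin_numE.
pose s := fine S; have Ss : S = s%:E by rewrite /s fineK.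
pose B := [set x | (s < f x)%R].
have s0 : (0 <= s)%R by rewrite -lee_fin -Ss.
have mB : measurable B.
  have := mf measurableT _ (measurable_itv `]s, +oo[).
  rewrite setTI; congr measurable.
  by apply/seteqP; split => x; rewrite /= in_itv/= andbT.
have muB : mu B = 0.
  apply: (negligibleP mu mB).1.
  have := ess_sup_ge mu (abse \o (EFin \o f)); rewrite -/S Ss.
  apply: negligibleS => x /=; rewrite /B/= => sf; apply/negP.
  by rewrite -ltNge lte_fin ger0_norm.
have m1B : measurable_fun setT (\1_B : 'rV[R]_N -> R) by exact: measurable_indic.
have m1D : measurable_fun setT (\1_D : T -> R) by exact: measurable_indic.
(* [B] is the null set where [f] exceeds its essential supremum s. Its averaged indicator has
   integral 0, so for almost every x the point x + theta t avoids [B] for almost all t in [D], and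
   the average at x is at most s M. *)
have iB : \int[mu]_x `|average D \1_B x| = 0.
  under eq_integral do rewrite gee0_abs ?average_ge0//.
  rewrite (integral_average mD DM m1B)//.
  by rewrite integral_indic// setIT [X in _ * X]muB mule0.
have mab : measurable_fun setT (average D \1_B) by exact: measurable_average.
move/(ae_eq_integral_abs _ measurableT mab) : iB => aeB.
apply/ess_supP; apply: filterS aeB => x /(_ I) /= ax.
rewrite gee0_abs ?average_ge0//.
have mx (g : 'rV[R]_N -> R) : measurable_fun setT g ->
    measurable_fun setT (fun t => (\1_D t * g (x + theta t)%R)%:E).
  move=> mg.
  exact: (measurableT_comp (measurable_average_integrand mD mg) (pair1_measurable x)).
have : \int[nu]_t `|(\1_D t * \1_B (x + theta t)%R)%:E| = 0.
  by rewrite -ax; apply: eq_integral => t _; rewrite gee0_abs// lee_fin mulr_ge0.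
move/(ae_eq_integral_abs _ measurableT (mx _ m1B)) => aet.
rewrite Ss muleC.
have -> : s%:E * M%:E = \int[nu]_t (s%:E * (\1_D t)%:E).
  rewrite ge0_integralZl//; last exact/measurable_EFinP.
  by rewrite integral_indic// setIT; congr (_ * _).
apply: ae_ge0_le_integral => //.
- by move=> t _; rewrite lee_fin mulr_ge0.
- exact: mx.
- by move=> t _; rewrite -EFinM lee_fin mulr_ge0.
- by apply: measurable_funeM; exact/measurable_EFinP.
apply: filterS aet => t /(_ I) /= [] /eqP; rewrite mulf_eq0 => /orP[/eqP ->|].
  by move=> _; rewrite mul0r mule0.
rewrite indicE pnatr_eq0 eqb0 => tB _; rewrite -EFinM lee_fin mulrC ler_wpM2r//.
by rewrite leNgt; apply: contra tB => h; rewrite inE.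
Qed.

End Lnorm_average.

(** * The Poincare inequality *)

Section poincare.
Context {R : realType} {N : nat}.
Implicit Types (U : set 'rV[R]_N) (w : 'rV[R]_N -> R) (d : 'rV[R]_N).
Local Notation mu := (@lebesgue_measure_rV R N).
Local Notation leb := (@lebesgue_measure R).
Local Notation I01 := (\1_`[0%R, 1%R] : R -> R).

(* ball is the ball of the sup norm, hence a box of measure (2 r)^N. *)
Definition star_box U (c : 'rV[R]_N) (r h : R) : Prop :=
  [/\ 0 < r, 0 < h, ball c r `<=` U,
    forall x y, U x -> U y -> `|x - y| <= h &
    forall x y, U x -> ball c r y -> forall t, 0 <= t <= 1 -> U (x + t *: (y - x))].

Lemma le_norm_Rintegral (disp : measure_display) (T : measurableType disp)
  (m : {measure set T -> \bar R})
    (f : T -> R) : measurable_fun setT f ->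
  (`|\int[m]_x f x|%:E <= \int[m]_x `|f x|%:E)%E.
Proof.
move=> mf; apply: (@le_trans _ _ `|\int[m]_x (f x)%:E|)%E.
  by rewrite /Rintegral; case: integral => //=; rewrite normr0 leey.
by apply: le_abse_integral => //; exact/measurable_EFinP.
Qed.

Lemma measurable_id_rV : measurable_fun [set: 'rV[R]_N] (id : 'rV[R]_N -> 'rV[R]_N).
Proof. exact: measurable_id. Qed.

(** Extended-real counterpart of [line_average]: for nonnegative [F], Tonelli applies to it without
    any integrability condition. *)
Definition line_integral (F : 'rV[R]_N -> R) d (x : 'rV[R]_N) : \bar R :=
  (\int[leb]_t (I01 t * F (x + t *: d)%R)%:E)%E.

Lemma measurable_scale_rV : measurable_fun [set: 'rV[R]_N * measurableTypeR R]
  (fun q => q.2 *: q.1 : 'rV[R]_N).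
Proof.
apply: measurable_fun_rV => i; under eq_fun do rewrite mxE.
apply: measurable_funM; first exact: measurable_snd.
exact: (measurableT_comp (measurable_rV_coord i) measurable_fst).
Qed.

Lemma measurable_I01 : measurable_fun [set: measurableTypeR R] I01.
Proof. by apply: measurable_indic; exact: measurable_itv. Qed.

Lemma measurable_line_integrand (F : 'rV[R]_N -> R) : measurable_fun setT F ->
  measurable_fun [set: ('rV[R]_N * 'rV[R]_N) * measurableTypeR R]
    (fun p => (I01 p.2 * F (p.1.1 + p.2 *: p.1.2)%R)%:E).
Proof.
move=> mF; apply/measurable_EFinP; apply: measurable_funM.
  exact: (measurableT_comp measurable_I01 measurable_snd).
apply: (measurableT_comp mF); apply: measurable_fun_rV => i.
under eq_fun do rewrite !mxE; apply: measurable_funD.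
  apply: (measurableT_comp (measurable_rV_coord i)).
  exact: (measurableT_comp measurable_fst measurable_fst).
apply: measurable_funM; first exact: measurable_snd.
apply: (measurableT_comp (measurable_rV_coord i)).
exact: (measurableT_comp measurable_snd measurable_fst).
Qed.

Lemma measurable_line_integral (F : 'rV[R]_N -> R) : measurable_fun setT F ->
  (forall x, 0 <= F x) ->
  measurable_fun [set: 'rV[R]_N * 'rV[R]_N] (fun p => line_integral F p.2 p.1).
Proof.
move=> mF F0; apply: (measurable_fun_fubini_tonelli_F (m2 := leb) _
  (measurable_line_integrand mF)) => p.
by rewrite lee_fin mulr_ge0.
Qed.

(** Displacement d and parameter t are merged into one parameter (d, t) with displacement t d, so
    that a single use of [Lnorm_average] bounds the whole double integral. *)
Lemma average_line_integral (F : 'rV[R]_N -> R) (B : set 'rV[R]_N) (x : 'rV[R]_N) :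
  measurable B -> measurable_fun setT F -> (forall x, 0 <= F x) ->
  (average (product_sigma_finite mu leb)
    (fun q : 'rV[R]_N * measurableTypeR R => q.2 *: q.1)
     (B `*` `[0%R, 1%R]%classic) F x =
   \int[mu]_d ((\1_B d)%:E * line_integral F d x))%E.
Proof.
move=> mB mF F0; rewrite /average.
rewrite (fubini_tonelli1 (m1 := mu) (m2 := leb)
  (fun q => (\1_(B `*` `[0%R, 1%R]%classic) q * F (x + q.2 *: q.1)%R)%:E))/=; last 2 first.
- have mD : measurable (B `*` `[0%R, 1%R]%classic : set ('rV[R]_N * measurableTypeR R)).
    by apply: measurableX => //; exact: measurable_itv.
  exact: (measurableT_comp (measurable_average_integrand measurable_scale_rV mD mF)
    (pair1_measurable x)).
- by move=> q; rewrite lee_fin mulr_ge0.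
apply: eq_integral => d _; rewrite /fubini_F /line_integral -ge0_integralZl//.
- apply: eq_integral => t _; rewrite -EFinM mulrA; congr (_ * _)%:E.
  rewrite !indicE -natrM mulnb; congr (_%:R).
  by rewrite in_setX.
- exact: (measurableT_comp (measurable_line_integrand mF) (pair1_measurable (x, d))).
- by move=> t _; rewrite lee_fin mulr_ge0.
Qed.

(** The domain on which [weak_gradient_translate] holds depends on d. Encoding it by indicator
    factors makes both sides functions of all pairs (x, d), the form that [ae_ae_swap] requires. The
    factor h bounds the coordinates of d, as x and x + d both lie in [U]. *)
Lemma weak_gradient_increment_le U w (G : 'I_N -> 'rV[R]_N -> R) c r h d :
  open U -> star_box U c r h ->
  mu.-integrable U (EFin \o w) -> (forall i, mu.-integrable U (EFin \o G i)) ->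
  weak_gradient U w G ->
  {ae mu, forall x,
    ((\1_U x * \1_(ball c r) (x + d) * `|(w \_ U) (x + d) - (w \_ U) x|)%:E <=
     h%:E * line_integral (fun y => (\sum_i `|(G i \_ U) y|)%R) d x)%E}.
Proof.
move=> oU [r0 h0 cU Uh star] iw iG wG.
have mU := open_measurable_rV oU.
have mG i : measurable_fun setT (G i \_ U).
  apply: (measurable_restrictT _ mU).1; apply/measurable_EFinP.
  exact: measurable_int (iG i).
pose O := U `&` [set x | ball c r (x + d)].
have oO : open O.
  apply: openI => //.
  have /continuousP : continuous (fun x : 'rV[R]_N => x + d).
    by move=> x; apply: (@continuousD _ _ _ id (cst d)) => //; exact: cst_continuous.
  by apply; exact: ball_open.
have OU x : O x -> forall t, 0 <= t <= 1 -> U (x + t *: d).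
  by move=> [Ux bx] t t01; have := star _ _ Ux bx _ t01; rewrite addrAC subrr add0r.
have F0 x : 0 <= \sum_i `|(G i \_ U) x| by exact: sumr_ge0.
have := weak_gradient_translate oU oO iw iG wG OU.
apply: filterS => x xO.
have l0 : (0 <= line_integral (fun y => (\sum_i `|(G i \_ U) y|)%R) d x)%E.
  by apply: integral_ge0 => t _; rewrite lee_fin mulr_ge0.
have rhs0 : (0 <= h%:E * line_integral (fun y => (\sum_i `|(G i \_ U) y|)%R) d x)%E.
  by rewrite mule_ge0// lee_fin ltW.
have [Ux|Ux] := pselect (U x); last by rewrite indicE memNset// !mul0r.
have [bx|bx] := pselect (ball c r (x + d)); last first.
  by rewrite [\1_(ball c r) _]indicE memNset// mulr0 mul0r.
rewrite !indicE !mem_set// !mul1r (xO (conj Ux bx)).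
have dh i : `|d ord0 i| <= h.
  apply: le_trans (ler_norm_coord d i) _.
  by have := Uh _ _ (cU _ bx) Ux; rewrite addrAC subrr add0r.
apply: (@le_trans _ _ (\sum_i h%:E * `|line_average d (G i \_ U) x|%:E)%E).
  rewrite (eq_bigr (fun i => (h * `|line_average d (G i \_ U) x|)%:E))//.
  rewrite sumEFin lee_fin; apply: le_trans (ler_norm_sum _ _ _) _.
  by apply: ler_sum => i _; rewrite normrM ler_wpM2r.
rewrite -ge0_sume_distrr//.
rewrite lee_wpmul2l ?lee_fin ?(ltW h0)//.
have ml i : measurable_fun [set: measurableTypeR R]
  (fun t => I01 t * (G i \_ U) (x + t *: d)).
  apply/measurable_EFinP.
  exact: (measurableT_comp (measurable_line_integrand (mG i)) (pair1_measurable (x, d))).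
rewrite /line_integral.
under eq_integral do rewrite mulr_sumr -sumEFin.
rewrite ge0_integral_sum//; last first.
  move=> i; apply/measurable_EFinP.
  have : measurable_fun [set: measurableTypeR R]
      (fun t => `|I01 t * (G i \_ U) (x + t *: d)|).
    by apply: measurableT_comp => //; exact: ml.
  congr measurable_fun; apply/funext => t /=.
  by rewrite normrM ger0_norm.
apply: lee_sum => i _; apply: le_trans (le_norm_Rintegral _ (ml i)) _.
by rewrite le_eqVlt; apply/orP; left; apply/eqP; apply: eq_integral => t _;
  rewrite normrM (ger0_norm (_ : 0 <= I01 t)).
Qed.

(** Tonelli for the indicator of the exceptional set: if almost every section in one direction is
    null, so is almost every section in the other. *)
Lemma ae_ae_swap (disp1 disp2 : measure_display)
    (T1 : measurableType disp1) (T2 : measurableType disp2)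
    (m1 : {sigma_finite_measure set T1 -> \bar R})
    (m2 : {sigma_finite_measure set T2 -> \bar R}) (f g : T1 * T2 -> \bar R) :
  measurable_fun setT f -> measurable_fun setT g ->
  (forall y, {ae m1, forall x, (f (x, y) <= g (x, y))%E}) ->
  {ae m1, forall x, {ae m2, forall y, (f (x, y) <= g (x, y))%E}}.
Proof.
move=> mf mg fg; pose A := [set p | (g p < f p)%E].
have mA : measurable A by rewrite -[A]setTI; exact: measurable_lte.
have m1A : measurable_fun setT (fun p => (\1_A p)%:E : \bar R).
  by apply/measurable_EFinP; exact: measurable_indic.
have A0 p : (0 <= (\1_A p)%:E :> \bar R)%E by rewrite lee_fin.
have : (\int[m1]_x `|\int[m2]_y (\1_A (x, y))%:E| = 0)%E.
  under eq_integral do rewrite gee0_abs ?integral_ge0//.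
  rewrite (fubini_tonelli (m1 := m1) (m2 := m2) _ m1A)//.
  apply: integral0_eq => y _.
  have my : measurable_fun setT (fun x => (\1_A (x, y))%:E : \bar R).
    exact: (measurableT_comp m1A (pair2_measurable y)).
  rewrite (ae_eq_integral (cst 0%E))//; first exact: integral0.
  apply: filterS (fg y) => x fgx _ /=.
  by rewrite indicE memNset// /A/= => /(le_lt_trans fgx); rewrite ltxx.
have mF := measurable_fun_fubini_tonelli_F (m2 := m2) _ m1A (A0).
move/(ae_eq_integral_abs _ measurableT mF); apply: filterS => x /(_ I) /= x0.
have mx : measurable_fun setT (fun y => (\1_A (x, y))%:E : \bar R).
  exact: (measurableT_comp m1A (pair1_measurable x)).
have : (\int[m2]_y `|(\1_A (x, y))%:E| = 0)%E.
  by rewrite -x0; apply: eq_integral => y _; rewrite gee0_abs.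
move/(ae_eq_integral_abs _ measurableT mx); apply: filterS => y /(_ I) /= [] /eqP.
rewrite indicE pnatr_eq0 eqb0 => nA; rewrite leNgt; apply: contra nA => h.
by rewrite inE.
Qed.

(** Displacements between points of [U] have sup norm at most h; the radius 2h turns this non-strict
    bound into membership in an open ball. *)
Definition segment_params (h : R) : set ('rV[R]_N * measurableTypeR R)%type :=
  (ball (0 : 'rV[R]_N) (h *+ 2) : set 'rV[R]_N) `*` `[0%R, 1%R]%classic.

Definition segment_average (h : R) (F : 'rV[R]_N -> R) : 'rV[R]_N -> \bar R :=
  average (product_sigma_finite mu leb)
    (fun q : 'rV[R]_N * measurableTypeR R => q.2 *: q.1) (segment_params h) F.

Lemma poincare_pointwise U w (G : 'I_N -> 'rV[R]_N -> R) c r h :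
  open U -> star_box U c r h ->
  mu.-integrable U (EFin \o w) -> (forall i, mu.-integrable U (EFin \o G i)) ->
  weak_gradient U w G ->
  {ae mu, forall x, U x ->
    (`|w x - (r *+ 2) ^- N * \int[mu]_(y in ball c r) w y|%:E <=
     ((r *+ 2) ^- N * h)%:E * segment_average h
       (fun y => (\sum_i `|(G i \_ U) y|)%R) x)%E}.
Proof.
move=> oU sU iw iG wG; have [r0 h0 cU Uh star] := sU.
have mU := open_measurable_rV oU.
set Q := ball c r; have mQ : measurable Q by exact: measurable_ball_rV.
have muQ : mu Q = ((r *+ 2) ^+ N)%:E by exact: lebesgue_measure_ball_rV.
have rN0 : 0 < (r *+ 2) ^+ N by rewrite exprn_gt0// mulrn_wgt0.
have mG i : measurable_fun setT (G i \_ U).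
  apply: (measurable_restrictT _ mU).1; apply/measurable_EFinP.
  exact: measurable_int (iG i).
have mw : measurable_fun setT (w \_ U).
  by apply: (measurable_restrictT _ mU).1; apply/measurable_EFinP; exact: measurable_int iw.
pose F (y : 'rV[R]_N) := \sum_i `|(G i \_ U) y|.
have mF : measurable_fun setT F.
  by apply: measurable_sum => i; exact: measurableT_comp.
have F0 x : 0 <= F x by exact: sumr_ge0.
have madd : measurable_fun [set: 'rV[R]_N * 'rV[R]_N] (fun p => p.1 + p.2).
  exact: (measurable_add_rV measurable_id_rV).
have mind (B : set 'rV[R]_N) : measurable B -> measurable_fun setT (\1_B : _ -> R).
  exact: measurable_indic.
pose Phi (p : 'rV[R]_N * 'rV[R]_N) :=
  \1_U p.1 * \1_Q (p.1 + p.2) * `|(w \_ U) (p.1 + p.2) - (w \_ U) p.1|.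
have mPhi : measurable_fun setT Phi.
  apply: measurable_funM.
    apply: measurable_funM; first exact: (measurableT_comp (mind _ mU) measurable_fst).
    exact: (measurableT_comp (mind _ mQ) madd).
  apply: measurableT_comp => //; apply: measurable_funB.
    exact: (measurableT_comp mw madd).
  exact: (measurableT_comp mw measurable_fst).
pose Psi (p : 'rV[R]_N * 'rV[R]_N) := (h%:E * line_integral F p.2 p.1)%E.
have mPsi : measurable_fun setT Psi.
  by apply: measurable_funeM; exact: measurable_line_integral.
have mEPhi : measurable_fun setT (EFin \o Phi) by exact/measurable_EFinP.
have := ae_ae_swap (m1 := mu) mu mEPhi mPsi
  (fun d => weak_gradient_increment_le d oU sU iw iG wG).
apply: filterS => x aex Ux.
rewrite /segment_average average_line_integral//; last exact: measurable_ball_rV.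
have iwQ : mu.-integrable Q (EFin \o w) by exact: integrableS iw.
have icQ : mu.-integrable Q (EFin \o (fun=> w x)).
  apply: measurable_bounded_integrable => //; first by rewrite [X in (X < _)%E]muQ ltry.
  exact: bounded_cst.
(* The deviation from the mean is the mean of the differences w(x) - w(y); the substitution y = d +
   x then turns these into increments of [w] along d. *)
have -> : w x - (r *+ 2) ^- N * \int[mu]_(y in Q) w y =
    (r *+ 2) ^- N * \int[mu]_(y in Q) (w x - w y).
  rewrite RintegralB// Rintegral_cst// [X in fine X]muQ /= mulrBr mulrCA mulVf ?mulr1//.
  by rewrite gt_eqF.
rewrite normrM (ger0_norm (ltW _)) ?invr_gt0// EFinM EFinM -muleA.
rewrite lee_wpmul2l ?lee_fin ?invr_ge0 ?(ltW rN0)//.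
have mB : measurable (ball (0 : 'rV[R]_N) (h *+ 2)) by exact: measurable_ball_rV.
have mwwx : measurable_fun [set: 'rV[R]_N] (fun y => \1_Q y * `|(w \_ U) y - (w \_ U) x|).
  apply: measurable_funM; first exact: mind.
  by apply: measurableT_comp => //; exact: measurable_funB.
rewrite Rintegral_mkcond; apply: le_trans (le_norm_Rintegral _ _) _.
  apply: (measurable_restrictT _ mQ).1; apply: measurable_funB => //.
  by apply/measurable_EFinP; exact: measurable_int iwQ.
rewrite (eq_integral (fun y => (\1_Q y * `|(w \_ U) y - (w \_ U) x|)%:E)); last first.
  move=> y _; rewrite [X in `|X|%:E]patchE indicE; case: ifPn => [yQ|_].
    have Uy : U y by exact/cU/set_mem.
    by rewrite mul1r [in RHS]/patch (mem_set Uy) (mem_set Ux) distrC.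
  by rewrite mul0r normr0.
have mE : measurable_fun [set: 'rV[R]_N]
    (fun y => (\1_Q y * `|(w \_ U) y - (w \_ U) x|)%:E) by exact/measurable_EFinP.
rewrite -(integral_translate x mE).
have mL : measurable_fun [set: 'rV[R]_N]
    (fun d => ((\1_(ball (0 : 'rV[R]_N) (h *+ 2)) d)%:E * line_integral F d x)%E).
  apply: emeasurable_funM; first by apply/measurable_EFinP; exact: mind.
  exact: (measurableT_comp (measurable_line_integral mF F0) (pair1_measurable x)).
have L0 d : (0 <= line_integral F d x)%E.
  by apply: integral_ge0 => t _; rewrite lee_fin mulr_ge0.
rewrite -ge0_integralZl//; last 2 first.
- by move=> d _; apply: mule_ge0; rewrite ?lee_fin.
- by rewrite lee_fin ltW.
apply: ae_ge0_le_integral => //.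
- apply: (measurableT_comp mE); apply: measurable_fun_rV => i.
  by under eq_fun do rewrite mxE; apply: measurable_funD => //; exact: measurable_rV_coord.
- by move=> d _; apply: mule_ge0; [rewrite lee_fin ltW|apply: mule_ge0; rewrite ?lee_fin].
- exact: measurable_funeM.
apply: filterS aex => d; rewrite /Phi /Psi/= => h1 _.
have [Qd|Qd] := pselect (Q (d + x)); last first.
  rewrite [\1_Q _]indicE memNset// mul0r.
  by apply: mule_ge0; [rewrite lee_fin ltW|apply: mule_ge0; rewrite ?lee_fin].
have Bd : ball (0 : 'rV[R]_N) (h *+ 2) d.
  rewrite mx_norm_ball /ball_/= sub0r normrN.
  have := Uh _ _ (cU _ Qd) Ux; rewrite addrK => /le_lt_trans; apply.
  by rewrite mulr2n ltrDr.
have e1 : \1_U x = 1 :> R by rewrite indicE mem_set.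
have e2 : \1_(ball (0 : 'rV[R]_N) (h *+ 2)) d = 1 :> R by rewrite indicE mem_set.
by move: h1; rewrite e1 e2 mul1r mul1e addrC.
Qed.

End poincare.

(** * Elementary properties of the L^p norm on a set *)

Section Lp_facts.
Context {R : realType} {N : nat}.
Implicit Types (U : set 'rV[R]_N) (f g w : 'rV[R]_N -> R) (p : \bar R).
Local Notation mu := (@lebesgue_measure_rV R N).
Local Open Scope ereal_scope.

Lemma eminkowski_sum (I : Type) (s : seq I) (F : I -> 'rV[R]_N -> R) p : 1 <= p ->
  (forall i, measurable_fun setT (F i)) ->
  'N[mu]_p[EFin \o (fun x => \sum_(i <- s) F i x)%R] <=
  \sum_(i <- s) 'N[mu]_p[EFin \o F i].
Proof.
move=> p1 mF; elim: s => [|i s IH].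
  rewrite big_nil (_ : _ \o _ = cst 0).
    by rewrite Lnorm0// gt_eqF// (lt_le_trans _ p1)// lte01.
  by apply/funext => x; rewrite /= big_nil.
rewrite big_cons.
rewrite (_ : _ \o _ = EFin \o (F i \+ (fun x => \sum_(i <- s) F i x))%R); last first.
  by apply/funext => x; rewrite /= big_cons.
apply: le_trans (eminkowski mu (mF i) _ p1) _; last by rewrite leeD2l.
exact: measurable_sum.
Qed.

Lemma measurable_patch U f : measurable U -> measurable_fun U f ->
  measurable_fun setT (f \_ U).
Proof. by move=> mU mf; exact: (measurable_restrictT _ mU).1. Qed.

Lemma le_Lp_norm U p f g : 1 <= p -> measurable U ->
  measurable_fun U f -> measurable_fun U g ->
  {ae mu, forall x, U x -> (`|f x| <= `|g x|)%R} -> Lp_norm U p f <= Lp_norm U p g.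
Proof.
move=> p1 mU mf mg fg; apply: le_Lnorm => //.
- by apply/measurable_EFinP; exact: measurable_patch.
- by apply/measurable_EFinP; exact: measurable_patch.
apply: filterS fg => x fgx; rewrite /= lee_fin /patch.
by case: ifPn => // /set_mem.
Qed.

Lemma Lp_normD U p f g : 1 <= p -> measurable U ->
  measurable_fun U f -> measurable_fun U g ->
  Lp_norm U p (fun x => f x + g x)%R <= Lp_norm U p f + Lp_norm U p g.
Proof.
move=> p1 mU mf mg; rewrite /Lp_norm.
have -> : (fun x => f x + g x)%R \_ U = ((f \_ U) \+ (g \_ U))%R.
  by apply/funext => x; rewrite /patch /=; case: ifP => // _; rewrite addr0.
by apply: eminkowski => //; exact: measurable_patch.
Qed.

Lemma Lp_norm_ge0 U p f : 0 <= Lp_norm U p f.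
Proof. exact: Lnorm_ge0. Qed.

Lemma Lp_normN U p f : Lp_norm U p (fun x => - f x)%R = Lp_norm U p f.
Proof.
rewrite /Lp_norm -[RHS]oppe_Lnorm; congr Lnorm; apply/funext => x /=.
by rewrite /patch; case: ifP => // _; rewrite oppr0.
Qed.

Lemma Lp_normB U p f g : 1 <= p -> measurable U ->
  measurable_fun U f -> measurable_fun U g ->
  Lp_norm U p (fun x => f x - g x)%R <= Lp_norm U p f + Lp_norm U p g.
Proof.
move=> p1 mU mf mg; rewrite -[Lp_norm U p g]Lp_normN.
by apply: (Lp_normD (g := fun x => - g x)%R) => //; exact: measurableT_comp.
Qed.

Lemma Lp_norm_ae_eq U p f g : 1 <= p -> measurable U ->
  measurable_fun U f -> measurable_fun U g ->
  {ae mu, forall x, U x -> f x = g x} -> Lp_norm U p f = Lp_norm U p g.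
Proof.
move=> p1 mU mf mg fg; apply/eqP; rewrite eq_le; apply/andP; split;
  apply: le_Lp_norm => //; by apply: filterS fg => x /[apply] ->.
Qed.

Lemma bounded_measure_lty U : measurable U -> bounded_set U -> mu U < +oo.
Proof.
move=> mU [M [_ hM]].
have r0 : (0 < `|M| + 2)%R by rewrite ltr_wpDl.
have UB : U `<=` ball (0%R : 'rV[R]_N) (`|M| + 2)%R.
  move=> x Ux; rewrite mx_norm_ball /ball_/= sub0r normrN.
  have M1 : (M < `|M| + 1)%R by rewrite ltr_pwDr// ler_norm.
  by apply: le_lt_trans (hM _ M1 x Ux) _; rewrite ltrD2l ltr1n.
have : mu U <= mu (ball (0%R : 'rV[R]_N) (`|M| + 2)%R).
  by apply: le_measure; rewrite ?inE//; exact: measurable_ball_rV.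
by move/le_lt_trans; apply; rewrite [X in X < _]lebesgue_measure_ball_rV ?ltry.
Qed.

(** [U] has finite measure, so |f| is dominated by 1 + |f|^r for finite p = r, and by the essential
    supremum for p = +oo. *)
Lemma in_Lp_integrable U p f : 1 <= p -> measurable U -> bounded_set U ->
  in_Lp U p f -> mu.-integrable U (EFin \o f).
Proof.
move=> p1 mU bU [mf]; rewrite /Lp_norm => Nf.
have muU := bounded_measure_lty mU bU.
have mfU := measurable_patch mU mf.
apply/integrableP; split; first exact/measurable_EFinP.
case: p p1 Nf => [r r1 Nf|_ Nf|//].
  rewrite lee_fin in r1; have r0 : (0 < r)%R by exact: lt_le_trans r1.
  move/(poweR_lty r) : Nf; rewrite poweR_Lnorm ?gt_eqF// => Nf.
  apply: (@le_lt_trans _ _ (\int[mu]_(x in U) (1 + (`|f x| `^ r)%:E))).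
    apply: ge0_le_integral => //.
    - by apply: measurableT_comp => //; exact/measurable_EFinP.
    - apply: emeasurable_funD => //; apply/measurable_EFinP.
      by apply: (measurableT_comp (measurable_powR r)); exact: measurableT_comp.
    - move=> x _; rewrite /= -EFinD lee_fin.
      have [f1|f1] := leP `|f x|%R 1%R; first by rewrite (le_trans f1)// lerDl powR_ge0.
      rewrite (@le_trans _ _ (`|f x| `^ r)%R)// ?lerDr//.
      by rewrite -[X in (X <= _)%R]powRr1// ler_powR// ltW.
  rewrite ge0_integralD//; last first.
    apply/measurable_EFinP.
    by apply: (measurableT_comp (measurable_powR r)); exact: measurableT_comp.
  have -> : \int[mu]_(x in U) (1 : \bar R) = mu U by rewrite integral_cst ?mul1e.
  apply: lte_add_pinfty; first exact: muU.
  rewrite integral_mkcond.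
  apply: le_lt_trans Nf; rewrite le_eqVlt; apply/orP; left; apply/eqP.
  apply: eq_integral => x _; rewrite /= /patch; case: ifP => // _.
  by rewrite /= normr0 powR0// gt_eqF.
(* For p = +oo the norm is 0 by convention when the whole space is null; then [U] is null too. *)
move: Nf; rewrite unlock /Lnorm; case: ifPn => mT Nf; last first.
  have U0 : mu U = 0.
    apply/eqP; rewrite eq_le measure_ge0 andbT.
    by apply: (@le_trans _ _ (mu setT)); [apply: le_measure; rewrite ?inE|rewrite leNgt].
  rewrite (@integral_abs_eq0 _ _ _ mu U (EFin \o f)) ?ltry//.
  exact/measurable_EFinP.
have aeS := ess_sup_ge mu (abse \o (EFin \o f \_ U)).
set S := ess_sup _ _ in Nf aeS.
have S0 : 0 <= S by apply: ess_sup_gee => //; apply: aeW => x; exact: abse_ge0.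
apply: (@le_lt_trans _ _ (\int[mu]_(x in U) S)).
  apply: ae_ge0_le_integral => //.
  - by apply: measurableT_comp => //; exact/measurable_EFinP.
  - by apply: filterS aeS => x h Ux; move: h; rewrite /= /patch mem_set.
by rewrite integral_cst// lte_mul_pinfty// ge0_fin_numE.
Qed.

End Lp_facts.

Section poincare_Lp.
Context {R : realType} {N : nat}.
Implicit Types (U : set 'rV[R]_N) (f g w : 'rV[R]_N -> R) (p : \bar R).
Local Notation mu := (@lebesgue_measure_rV R N).
Local Notation leb := (@lebesgue_measure R).

Lemma measurable_segment_params h : measurable (@segment_params R N h).
Proof. by apply: measurableX; [exact: measurable_ball_rV|exact: measurable_itv]. Qed.

Lemma measure_segment_params h : 0 < h ->
  product_sigma_finite mu leb (segment_params h) = ((h *+ 4) ^+ N)%:E.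
Proof.
move=> h0; rewrite /segment_params.
transitivity ((mu \x leb)%E (ball (0 : 'rV[R]_N) (h *+ 2) `*` `[0%R, 1%R]%classic)) => //.
rewrite product_measure1E//; last exact: measurable_ball_rV.
rewrite [X in (X * _)%E]lebesgue_measure_ball_rV ?mulrn_wgt0//.
rewrite [X in (_ * X)%E]lebesgue_measure_itv/= lte_fin ltr01 -EFinB subr0 mule1.
by rewrite -mulrnA.
Qed.

Lemma Lnorm_segment_average h p f : 0 < h -> (1 <= p)%E ->
  measurable_fun setT f -> (forall x, 0 <= f x) -> ('N[mu]_p[EFin \o f] < +oo)%E ->
  ('N[mu]_p[segment_average h f] <= ((h *+ 4) ^+ N)%:E * 'N[mu]_p[EFin \o f])%E.
Proof.
move=> h0 p1 mf f0 Nf; apply: Lnorm_average => //.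
- exact: measurable_scale_rV.
- exact: measurable_segment_params.
- exact: measure_segment_params.
Qed.

(** The constant [c0] is the mean of [w] over the ball, whose measure (2r)^N is divided out; h
    bounds the displacements, and (4h)^N is the mass of [segment_params]. *)
Lemma poincare U c r h p w (G : 'I_N -> 'rV[R]_N -> R) :
  (1 <= p)%E -> open U -> bounded_set U -> star_box U c r h ->
  in_Lp U p w -> (forall i, in_Lp U p (G i)) -> weak_gradient U w G ->
  exists c0, (Lp_norm U p (fun x => w x - c0)%R <=
    ((r *+ 2) ^- N * h * (h *+ 4) ^+ N)%:E * \sum_i Lp_norm U p (G i))%E.
Proof.
move=> p1 oU bU sU Lw LG wG; have mU := open_measurable_rV oU.
have [r0 h0 _ _ _] := sU.
have iw := in_Lp_integrable p1 mU bU Lw.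
have iG i := in_Lp_integrable p1 mU bU (LG i).
exists ((r *+ 2) ^- N * \int[mu]_(y in ball c r) w y).
set c0 := _ * _; set F := fun y => \sum_i `|(G i \_ U) y|.
have mG i : measurable_fun setT (G i \_ U) by apply: measurable_patch => //; case: (LG i).
have mF : measurable_fun setT F.
  by apply: measurable_sum => i; exact: measurableT_comp.
have F0 x : 0 <= F x by exact: sumr_ge0.
have rN0 : 0 < (r *+ 2) ^+ N by rewrite exprn_gt0// mulrn_wgt0.
have C0 : 0 <= (r *+ 2) ^- N * h by rewrite mulr_ge0 ?invr_ge0// ltW.
have NF : ('N[mu]_p[EFin \o F] <= \sum_i Lp_norm U p (G i))%E.
  have mnG i : measurable_fun setT (fun y => `|(G i \_ U) y|).
    exact: measurableT_comp.
  apply: le_trans (eminkowski_sum (index_enum 'I_N) p1 mnG) _.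
  apply: lee_sum => i _; rewrite /Lp_norm -[leRHS]Lnorm_abse.
  by rewrite le_eqVlt eqxx.
have NFfin : ('N[mu]_p[EFin \o F] < +oo)%E.
  apply: le_lt_trans NF _; apply/lte_sum_pinfty => i _; by case: (LG i).
apply: (@le_trans _ _
  ('N[mu]_p[(fun x => ((r *+ 2) ^- N * h)%:E * segment_average h F x)])%E).
  apply: le_Lnorm => //.
  - apply/measurable_EFinP; apply: measurable_patch => //.
    by apply: measurable_funB => //; case: Lw.
  - apply: measurable_funeM.
    apply: measurable_average => //; [exact: measurable_scale_rV|exact:
      measurable_segment_params].
  apply: filterS (poincare_pointwise oU sU iw iG wG) => x hx.
  have a0 : (0 <= segment_average h F x)%E by exact: average_ge0.
  rewrite [leRHS]gee0_abs ?mule_ge0 ?lee_fin// /= /patch.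
  case: ifPn => [/set_mem/hx//|_]; rewrite normr0 mule_ge0 ?lee_fin//.
rewrite Lnorm_ge0_EFin//; last first.
  by apply: measurable_average => //; [exact: measurable_scale_rV|exact:
    measurable_segment_params].
rewrite [in leRHS]EFinM -muleA lee_wpmul2l ?lee_fin//.
apply: le_trans (Lnorm_segment_average h0 p1 mF F0 NFfin) _.
by rewrite lee_wpmul2l// lee_fin exprn_ge0// mulrn_wge0// ltW.
Qed.

End poincare_Lp.

(** * Weak derivatives and polynomials *)

Section polynomial_functions.
Context {R : realType} {N : nat}.
Implicit Types (P Q : mpoly N R) (x v : 'rV[R]_N) (a : multinom N) (i : 'I_N).
Implicit Types (U : set 'rV[R]_N) (phi : 'rV[R]_N -> R).
Local Notation mu := (@lebesgue_measure_rV R N).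

Definition peval P x : R := meval (fun i => x ord0 i) P.

Lemma mpoly_ring_ind (K : mpoly N R -> Prop) :
  (forall c, K (mpolyC N c)) -> (forall i, K (mpolyX R (mnm1 i))) ->
  (forall P Q, K P -> K Q -> K (P + Q)) -> (forall P Q, K P -> K Q -> K (P * Q)) ->
  forall P, K P.
Proof.
move=> KC KX KD KM; have KXe i n : K (mpolyX R (mnm1 i) ^+ n).
  elim: n => [|n IH]; first by rewrite expr0; exact: (KC 1).
  by rewrite exprS; exact: KM.
apply: mpolyind => [|c m p _ _ Kp]; first by have := KC 0; rewrite mpolyC0.
apply: KD => //; rewrite -mul_mpolyC; apply: (KM) => //.
by rewrite mpolyXE_id; apply: (big_ind K) => [|P Q KP KQ|i _];
  [exact: (KC 1)|exact: KM|exact: KXe].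
Qed.

Lemma is_derive_peval P x i :
  is_derive x (delta_mx ord0 i) (peval P) (peval (mderiv i P) x).
Proof.
elim/mpoly_ring_ind: P => [c|j|P Q dP dQ|P Q dP dQ].
- rewrite (_ : peval _ = cst c); last by apply/funext => y; exact: mevalC.
  by rewrite /peval mderivC meval0; exact: is_derive_cst.
- rewrite (_ : peval _ = fun y : 'rV[R]_N => y ord0 j); last first.
    by apply/funext => y; exact: mevalXU.
  have h : is_derive (0 : R) 1 (fun s : R => (x + s *: delta_mx ord0 i) ord0 j)
      ((i == j)%:R : R).
    rewrite [X in is_derive _ _ X _](_ : _ =
        (fun s : R => (i == j)%:R *: s + x ord0 j)); last first.
      by apply/funext => s; rewrite !mxE /GRing.scale/= eq_sym addrC mulrC.
    apply: is_derive_eq (is_deriveD (is_deriveZ (i == j)%:R (is_derive_id (0 : R) 1))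
      (is_derive_cst (x ord0 j) (0 : R) 1)) _.
    by rewrite /GRing.scale/= mulr1 addr0.
  move/(is_derive_line (fun y : 'rV[R]_N => y ord0 j)) : h.
  rewrite scale0r addr0 => h; apply: is_derive_eq h _.
  rewrite /peval mderivX mevalZ mevalX mnm1E eq_sym.
  case: eqVneq => [->|_]; last by rewrite mul0r.
  by rewrite mul1r big1// => k _; rewrite mnmBE subnn expr0.
- rewrite (_ : peval _ = peval P + peval Q); last first.
    by apply/funext => y; exact: mevalD.
  by rewrite /peval mderivD mevalD; exact: is_deriveD.
- rewrite (_ : peval _ = peval P * peval Q); last first.
    by apply/funext => y; exact: mevalM.
  rewrite /peval mderivM mevalD !mevalM; apply: is_derive_eq (is_deriveM dP dQ) _.
  by rewrite /GRing.scale/= addrC [X in X + _]mulrC.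
Qed.

Lemma continuous_peval P : continuous (peval P).
Proof.
elim/mpoly_ring_ind: P => [c|j|P Q dP dQ|P Q dP dQ].
- rewrite (_ : peval _ = cst c); last by apply/funext => y; exact: mevalC.
  by move=> ?; exact: cst_continuous.
- rewrite (_ : peval _ = fun y : 'rV[R]_N => y ord0 j); last first.
    by apply/funext => y; exact: mevalXU.
  exact: coord_continuous.
- rewrite (_ : peval _ = peval P \+ peval Q); last first.
    by apply/funext => y; exact: mevalD.
  by move=> x; apply: continuousD; [exact: dP|exact: dQ].
- rewrite (_ : peval _ = peval P \* peval Q); last first.
    by apply/funext => y; exact: mevalM.
  by move=> x; apply: continuousM; [exact: dP|exact: dQ].
Qed.

Lemma measurable_peval P (D : set 'rV[R]_N) : measurable_fun D (peval P).
Proof. by apply: measurable_funTS; apply: continuous_measurable_rV;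
  exact: continuous_peval. Qed.

Lemma peval_bounded P (D : set 'rV[R]_N) : bounded_set D ->
  exists M, forall x, D x -> `|peval P x| <= M.
Proof.
move=> [M [_ hM]].
pose K := [set x : 'rV[R]_N | `|x| <= `|M| + 1].
have cK : compact K.
  apply: bounded_closed_compact.
    by exists (`|M| + 1); split; [exact: num_real|move=> r hr x /= /le_trans; apply;
      exact: ltW].
  apply: (@closed_comp _ _ (fun x : 'rV[R]_N => `|x|) [set y | y <= `|M| + 1]).
    by move=> x _; exact: norm_continuous.
  exact: closed_le.
have /compact_bounded[B [_ hB]] : compact (peval P @` K).
  by apply: continuous_compact => //; apply: continuous_subspaceT; exact: continuous_peval.
exists (`|B| + 1) => x Dx; apply: hB; first by rewrite ltr_pwDr// ler_norm.
exists x => //; apply: hM => //; by rewrite ltr_pwDr// ler_norm.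
Qed.

(** The average of the derivative over the segment from x to x + v is F(x + v) - F(x), whose
    integral vanishes by translation invariance. By duality with the constant 1, averaging along v
    does not change the integral. *)
Lemma integral_partial_eq0 (F : 'rV[R]_N -> R) v :
  mu.-integrable setT (EFin \o F) ->
  (forall x, derivable F x v) -> continuous (fun x => 'D_v F x) ->
  mu.-integrable setT (EFin \o (fun x => 'D_v F x)) ->
  \int[mu]_x 'D_v F x = 0.
Proof.
move=> iF dF cdF idF.
have mF : measurable_fun setT F by apply/measurable_EFinP; exact: measurable_int iF.
have dl x (t : R) : is_derive t 1 (fun u => F (x + u *: v)) ('D_v F (x + t *: v)).
  exact: (is_derive_line F x v t _).1 (derivableP (dF _)).
have cl x : continuous (fun t : R => F (x + t *: v)).
  by move=> t; apply: differentiable_continuous; apply/derivable1_diffP; case: (dl x t).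
have cdl x : continuous (fun t : R => 'D_v F (x + t *: v)).
  move=> t; apply: (@continuous_comp _ _ _ (fun t : R => x + t *: v) (fun x => 'D_v F x)).
    apply: (@continuousD _ _ _ (cst x) (fun t : R => t *: v)); first exact: cst_continuous.
    by apply: (@cvgZr_tmp _ _ _ _ _ id); exact: cvg_id.
  exact: cdF.
have E x : line_average v (fun x => 'D_v F x) x = F (x + v) - F x.
  have dl01 : derivable_oo_LRcontinuous (fun u : R => F (x + u *: v)) 0 1.
    split; first by move=> t _; case: (dl x t).
    - by apply: cvg_at_right_filter; exact: cl.
    - by apply: cvg_at_left_filter; exact: cl.
  have FTC := @continuous_FTC2 R _ _ 0 1 ltr01 (continuous_subspaceT (cdl x)) dl01.
  have {FTC} h : (\int[lebesgue_measure]_(t in `[0%R, 1%R]) ('D_v F (x + t *: v))%:E =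
     (F (x + 1 *: v))%:E - (F (x + 0 *: v))%:E)%E.
    by apply: FTC => t _; rewrite derive1E; case: (dl x t).
  rewrite /line_average /Rintegral.
  rewrite (_ : (\int[lebesgue_measure]_t _)%E = (F (x + v) - F x)%:E)//.
  rewrite EFinB; move: h; rewrite scale1r scale0r addr0 => <-.
  rewrite [RHS]integral_mkcond; apply: eq_integral => t _; rewrite /patch /= indicE.
  by case: ifP => _; rewrite ?mul1r ?mul0r.
have n1 (x : 'rV[R]_N) : `|cst (1 : R) x| <= 1 by rewrite normr1.
have m1 : measurable_fun [set: 'rV[R]_N] (cst (1 : R)) by exact: measurable_cst.
have h := line_average_dual v idF m1 n1.
transitivity (\int[mu]_x ('D_v F x * line_average (- v) (cst 1) x)).
  apply: eq_Rintegral => x _; rewrite /line_average /=.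
  under eq_Rintegral do rewrite mulr1.
  rewrite /Rintegral integral_indic// setIT /= lebesgue_measure_itv/= lte_fin ltr01.
  by rewrite -EFinB subr0 mulr1.
rewrite -h.
have iFv : mu.-integrable setT (EFin \o (fun x => F (x + v))).
  have mFv : measurable_fun [set: 'rV[R]_N] (fun x => F (x + v)).
    apply: (measurableT_comp mF); apply: measurable_fun_rV => i.
    by under eq_fun do rewrite mxE; apply: measurable_funD => //;
      exact: measurable_rV_coord.
  apply/integrableP; split; first exact/measurable_EFinP.
  rewrite (integral_translate v (f := fun x => `|(F x)%:E|%E)).
    by case/integrableP : iF.
  by apply: measurableT_comp => //; exact/measurable_EFinP.
transitivity (\int[mu]_x (F (x + v) - F x)).
  by apply: eq_Rintegral => x _; rewrite mulr1 E.
by rewrite RintegralB// Rintegral_translate// subrr.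
Qed.

End polynomial_functions.

Section weak_derivatives.
Context {R : realType} {N : nat}.
Implicit Types (P Q : mpoly N R) (x : 'rV[R]_N) (a : multinom N) (i : 'I_N).
Implicit Types (U : set 'rV[R]_N) (phi f g v : 'rV[R]_N -> R).
Local Notation mu := (@lebesgue_measure_rV R N).

Lemma compact_measurable_rV (K : set 'rV[R]_N) : compact K -> measurable K.
Proof.
by move=> cK; apply: closed_measurable_rV; apply: compact_closed => //;
  exact: norm_hausdorff.
Qed.

Lemma locally_integrable_peval U P : locally_integrable_rV U (peval P).
Proof.
split; first exact: measurable_peval.
move=> K _ cK; have mK := compact_measurable_rV cK.
have bK := compact_bounded cK.
have [M hM] := peval_bounded P bK.
have : mu.-integrable K (EFin \o peval P).
  apply: measurable_bounded_integrable => //.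
  - exact: bounded_measure_lty.
  - exact: measurable_peval.
  - by exists M; split; [exact: num_real|move=> r Mr x Kx;
      exact: le_trans (hM x Kx) (ltW Mr)].
by case/integrableP.
Qed.

Lemma locally_integrable_rVB U f g : open U -> locally_integrable_rV U f ->
  locally_integrable_rV U g -> locally_integrable_rV U (fun x => f x - g x).
Proof.
move=> oU [mf lf] [mg lg]; have mU := open_measurable_rV oU; split;
  first exact: measurable_funB.
move=> K KU cK; have mK := compact_measurable_rV cK.
have iK (h : 'rV[R]_N -> R) : measurable_fun U h -> (\int[mu]_(x in K) `|h x|%:E < +oo)%E ->
    mu.-integrable K (EFin \o h).
  by move=> mh lh; apply/integrableP; split => //; apply/measurable_EFinP;
    exact: (measurable_funS mU KU mh).
have := integrableB_EFin mK (iK _ mf (lf _ KU cK)) (iK _ mg (lg _ KU cK)).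
by case/integrableP.
Qed.

Lemma test_functionT U phi : test_function U phi -> test_function setT phi.
Proof. by move=> [sphi cK _]; split. Qed.

Lemma Rintegral_test U f phi : test_function U phi ->
  \int[mu]_(x in U) (f x * phi x) = \int[mu]_x (f x * phi x).
Proof.
move=> tphi; rewrite Rintegral_mkcond; apply: eq_Rintegral => x _; rewrite /patch.
case: ifPn => // xU; rewrite (test_function_eq0 tphi) ?mulr0// => Ux.
by case/negP: xU; rewrite inE.
Qed.

Lemma peval_by_parts U P phi i : open U -> test_function U phi ->
  \int[mu]_(x in U) (peval P x * partial i phi x) =
  - \int[mu]_(x in U) (peval (mderiv i P) x * phi x).
Proof.
move=> oU tphi; have tdphi := test_function_partial i tphi.
rewrite (Rintegral_test _ tphi) (Rintegral_test _ tdphi).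
have sphi := tphi; case: sphi => sphi _ _.
have [cphi dphi] := sphi [::]; have [cdphi _] := sphi [:: i].
have iP Q psi : test_function U psi ->
    mu.-integrable setT (EFin \o (fun x => peval Q x * psi x)).
  move=> tpsi; apply: test_function_integrable; first exact: openT.
    exact: locally_integrable_peval.
  exact: test_functionT tpsi.
pose F x := peval P x * phi x.
have dF x : is_derive x (delta_mx ord0 i) F
    (peval (mderiv i P) x * phi x + peval P x * partial i phi x).
  have h := is_deriveM (is_derive_peval P x i) (derivableP (dphi i x)).
  by apply: is_derive_eq h _; rewrite /GRing.scale/= addrC [phi x * _]mulrC.
have DF : (fun x => 'D_(delta_mx ord0 i) F x) =
    (fun x => peval (mderiv i P) x * phi x + peval P x * partial i phi x).
  by apply/funext => x; case: (dF x).
have : \int[mu]_x 'D_(delta_mx ord0 i) F x = 0.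
  apply: integral_partial_eq0.
  - exact: iP.
  - by move=> x; case: (dF x).
  - rewrite DF => x.
    exact: continuousD (continuousM (@continuous_peval _ _ (mderiv i P) x) (cphi x))
      (continuousM (@continuous_peval _ _ P x) (cdphi x)).
  - rewrite DF.
    have := integrableD measurableT (iP (mderiv i P) _ tphi) (iP P _ tdphi).
    by congr (_.-integrable _ _).
rewrite DF RintegralD//; [|exact: iP|exact: iP].
by move/eqP; rewrite addrC addr_eq0 => /eqP.
Qed.

Lemma partial_multi_foldr a f : partial_multi a f =
  foldr partial f (flatten [seq nseq (a i) i | i <- enum 'I_N]).
Proof.
rewrite /partial_multi; elim: (enum _) => //= i s ->.
by rewrite foldr_cat; elim: (a i) => //= n ->.
Qed.

Lemma size_multi_index a : size (flatten [seq nseq (a i) i | i <- enum 'I_N]) = mdeg a.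
Proof.
rewrite size_flatten /shape -map_comp sumnE big_map mdegE big_enum /=.
by apply: eq_bigr => i _; rewrite size_nseq.
Qed.

Lemma test_function_foldr U phi (s : seq 'I_N) :
  test_function U phi -> test_function U (foldr partial phi s).
Proof. by move=> tphi; elim: s => //= i s; exact: test_function_partial. Qed.

Lemma test_function_multi U phi a :
  test_function U phi -> test_function U (partial_multi a phi).
Proof. by rewrite partial_multi_foldr; exact: test_function_foldr. Qed.

Lemma peval_by_parts_seq U P phi (s : seq 'I_N) : open U -> test_function U phi ->
  \int[mu]_(x in U) (peval P x * foldr partial phi s x) =
  (-1) ^+ size s * \int[mu]_(x in U) (peval (foldr (@mderiv N R) P s) x * phi x).
Proof.
move=> oU tphi; elim: s P => [|i s IH] P /=; first by rewrite expr0 mul1r.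
rewrite (peval_by_parts _ _ oU (test_function_foldr s tphi)) IH exprS mulN1r mulNr.
congr (- (_ * _)); apply: eq_Rintegral => x _; congr (peval _ _ * _).
rewrite -foldr_rcons; rewrite (@mderiv_perm N R _ (i :: s))//.
by rewrite perm_rcons.
Qed.

Lemma weak_derivative_peval U a P : open U ->
  weak_derivative U a (peval P) (peval (mderivm a P)).
Proof.
move=> oU; split; [exact: locally_integrable_peval|exact: locally_integrable_peval|].
move=> phi tphi; rewrite mderivm_foldr -size_multi_index partial_multi_foldr.
exact: peval_by_parts_seq.
Qed.

Lemma weak_derivativeB U a f1 g1 f2 g2 : open U ->
  weak_derivative U a f1 g1 -> weak_derivative U a f2 g2 ->
  weak_derivative U a (fun x => f1 x - f2 x) (fun x => g1 x - g2 x).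
Proof.
move=> oU [lf1 lg1 h1] [lf2 lg2 h2]; have mU := open_measurable_rV oU.
split; [exact: locally_integrable_rVB|exact: locally_integrable_rVB|].
move=> phi tphi; have tm := test_function_multi a tphi.
have distr F1 F2 psi : locally_integrable_rV U F1 -> locally_integrable_rV U F2 ->
    test_function U psi ->
    \int[mu]_(x in U) ((F1 x - F2 x) * psi x) =
    \int[mu]_(x in U) (F1 x * psi x) - \int[mu]_(x in U) (F2 x * psi x).
  move=> l1 l2 tpsi; under eq_Rintegral do rewrite mulrBl.
  by rewrite RintegralB//; exact: test_function_integrable.
by rewrite !distr// h1// h2// mulrBr.
Qed.

Lemma weak_derivative_unique U a v g1 g2 : open U ->
  weak_derivative U a v g1 -> weak_derivative U a v g2 ->
  {ae mu, forall x, U x -> g1 x = g2 x}.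
Proof.
move=> oU [lf lg1 h1] [_ lg2 h2]; have mU := open_measurable_rV oU.
have : {ae mu, forall x, U x -> g1 x - g2 x = 0}.
  apply: fundamental_lemma => //; first exact: locally_integrable_rVB.
  move=> e te; under eq_Rintegral do rewrite mulrBl.
  rewrite RintegralB//; [|exact: test_function_integrable..].
  have := h1 _ te; rewrite (h2 _ te) => /(mulfI _) ->; first by rewrite subrr.
  by rewrite signr_eq0.
by apply: filterS => x /[apply] /eqP; rewrite subr_eq0 => /eqP.
Qed.

(** [partial_multi] applies the partial derivatives in a fixed order, whereas increasing a
    multi-index inserts one in the middle. Only adjacent exchanges of [bderiv] are needed to reorder
    them. *)
Lemma beval_bderiv_perm (s1 s2 : seq 'I_N) (e : @bexpr R N) : perm_eq s1 s2 ->
  foldr partial (beval e) s1 = foldr partial (beval e) s2.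
Proof.
have fE s : exists e', foldr partial (beval e) s = beval e'.
  elim: s => [|i s [e' IH]] /=; first by exists e.
  by exists (bderiv i e'); rewrite IH partial_beval.
have move_front (s : seq 'I_N) i : i \in s ->
    foldr partial (beval e) s = foldr partial (beval e) (i :: rem i s).
  elim: s => [|j s IH]; first by rewrite in_nil.
  rewrite in_cons /=; have [-> _|ne /= iS] := eqVneq i j; first by [].
  rewrite (IH iS) ?[j == i]eq_sym ?(negbTE ne) /=.
  have [e' ->] := fE (rem i s); rewrite !partial_beval.
  by apply/funext => x; exact: beval_bderivC.
elim: s1 s2 => [|i s1 IH] s2; first by rewrite perm_sym => /perm_small_eq ->.
move=> p12; have i2 : i \in s2 by rewrite -(perm_mem p12) mem_head.
rewrite (move_front _ _ i2) /= (IH (rem i s2))//.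
by rewrite -(perm_cons i) (permPl p12) perm_to_rem.
Qed.

(** The derivative of order a is tested against the i-th partial derivative of e, that of order a +
    e_i against e itself. The integrals against [v] coincide, and the signs (-1)^|a| and
    (-1)^(|a|+1) leave the minus sign of [weak_gradient]. *)
Lemma weak_derivative_gradient U a v g (G : 'I_N -> 'rV[R]_N -> R) : open U ->
  weak_derivative U a v g ->
  (forall i, weak_derivative U (mnm_add a (mnm1 i)) v (G i)) ->
  weak_gradient U g G.
Proof.
move=> oU [_ _ hg] hG e i te; have [_ _ hGi] := hG i.
have tde : test_function U (beval (bderiv i e)).
  by rewrite -partial_beval; exact: test_function_partial.
have h1 := hg _ tde; have h2 := hGi _ te.
have E : partial_multi a (beval (bderiv i e)) =
  partial_multi (mnm_add a (mnm1 i)) (beval e).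
  rewrite !partial_multi_foldr -partial_beval -foldr_rcons.
  apply: beval_bderiv_perm; rewrite -cats1.
  (* The two index lists are compared by counting, since appending i at the end does not give the
     sorted list of a + e_i. *)
  apply/seq.permP => p; rewrite count_cat !count_flatten -!map_comp !sumnE !big_map.
  rewrite [RHS](eq_bigr (fun j => count p (nseq (a j) j) + count p (nseq (i == j) j))%N);
    last first.
    by move=> j _; rewrite /= mnmDE mnm1E nseqD count_cat.
  rewrite big_split /=; congr (_ + _)%N.
  rewrite (bigD1_seq i) /= -?enumT ?enum_uniq ?mem_enum//.
  rewrite eqxx /= big1 ?addn0// => j ji.
  by rewrite eq_sym (negbTE ji).
rewrite E in h1; move: h2; rewrite h1 mdegD mdeg1 addn1 exprS mulN1r mulNr.
rewrite -mulrN => /(mulfI _) -> //; by rewrite signr_eq0.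
Qed.

Lemma weak_derivative0 U v : locally_integrable_rV U v -> weak_derivative U mnm0 v v.
Proof.
move=> lv; split => // phi tphi.
rewrite mdeg0 expr0 mul1r partial_multi_foldr (eq_map (_ : _ =1 fun=> [::])).
  by rewrite (_ : flatten _ = [::])//; elim: (enum _).
by move=> i /=; rewrite mnm0E.
Qed.

End weak_derivatives.

(** * Approximation of jets by polynomials *)

Section jets.
Context {R : realType} {N : nat}.
Implicit Types (P Q : mpoly N R) (a b : multinom N) (i : 'I_N) (p : \bar R).
Implicit Types (U : set 'rV[R]_N) (f w : 'rV[R]_N -> R).
Implicit Types (g : multinom N -> 'rV[R]_N -> R).
Local Notation mu := (@lebesgue_measure_rV R N).

Lemma in_Lp_bounded U p f M : (1 <= p)%E -> measurable U -> bounded_set U ->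
  measurable_fun U f -> (forall x, U x -> `|f x| <= M) -> in_Lp U p f.
Proof.
move=> p1 mU bU mf fM; split=> //.
have muU := bounded_measure_lty mU bU.
apply: (@le_lt_trans _ _ (Lp_norm U p (cst M))).
  apply: le_Lp_norm => //; apply: aeW => x Ux; apply: le_trans (fM x Ux) _.
  exact: ler_norm.
rewrite /Lp_norm unlock /Lnorm; case: p p1 => [r r1|_|//].
  rewrite lee_fin in r1; have r0 : 0 < r by exact: lt_le_trans r1.
  apply: poweR_lty.
  rewrite (eq_integral (fun x => (`|M| `^ r)%:E * (\1_U x)%:E)%E); last first.
    move=> x _; rewrite /= /patch indicE; case: ifP => _ /=; first by rewrite mule1.
    by rewrite normr0 powR0 ?mule0// gt_eqF.
  rewrite ge0_integralZl//; last by apply/measurable_EFinP; exact: measurable_indic.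
  rewrite integral_indic// setIT lte_mul_pinfty// lee_fin powR_ge0//.
case: ifPn => // mT; apply: (@le_lt_trans _ _ (`|M|%:E)); last exact: ltry.
apply/ess_supP; apply: aeW => x /=; rewrite lee_fin /patch.
by case: ifP => // _; rewrite normr0.
Qed.

Lemma in_Lp_peval U p P : (1 <= p)%E -> measurable U -> bounded_set U ->
  in_Lp U p (peval P).
Proof.
move=> p1 mU bU; have [M hM] := peval_bounded P bU.
by apply: in_Lp_bounded hM => //; exact: measurable_peval.
Qed.

Lemma in_LpB U p f w : (1 <= p)%E -> measurable U ->
  in_Lp U p f -> in_Lp U p w -> in_Lp U p (fun x => f x - w x).
Proof.
move=> p1 mU [mf Nf] [mw Nw]; split; first exact: measurable_funB.
by apply: le_lt_trans (Lp_normB p1 mU mf mw) _; exact: lte_add_pinfty.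
Qed.

Lemma weak_gradientB U f w (F W : 'I_N -> 'rV[R]_N -> R) : open U ->
  mu.-integrable U (EFin \o f) -> mu.-integrable U (EFin \o w) ->
  (forall i, mu.-integrable U (EFin \o F i)) ->
  (forall i, mu.-integrable U (EFin \o W i)) ->
  weak_gradient U f F -> weak_gradient U w W ->
  weak_gradient U (fun x => f x - w x) (fun i x => F i x - W i x).
Proof.
move=> oU jf jw jF jW gf gw e i te; have mU := open_measurable_rV oU.
have tde : test_function U (beval (bderiv i e)).
  by rewrite -partial_beval; exact: test_function_partial.
have distr f1 f2 phi : mu.-integrable U (EFin \o f1) -> mu.-integrable U (EFin \o f2) ->
    test_function U phi ->
    \int[mu]_(x in U) ((f1 x - f2 x) * phi x) =
    \int[mu]_(x in U) (f1 x * phi x) - \int[mu]_(x in U) (f2 x * phi x).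
  move=> j1 j2 tphi; have [M hM] := test_function_bounded tphi.
  have mphi := measurable_test_function tphi.
  under eq_Rintegral do rewrite mulrBl.
  by rewrite RintegralB//; apply: (integrableM_bounded (M := M)) => //;
    exact: measurable_funTS.
by rewrite !distr// gf// gw// opprB opprK addrC.
Qed.

Lemma mderivm_const P a : (msize P <= (mdeg a).+1)%N ->
  mderivm a P = mpolyC N (mcoeff a P *+ (\prod_(i < N) (a i)`!)).
Proof.
move=> sP; apply/mpolyP => b; rewrite mcoeff_mderivm mcoeffC.
have [->|b0] := eqVneq b mnm0.
  rewrite mulr1 addm0; congr (_ *+ _); apply: eq_bigr => i _.
  by rewrite ffactnn.
rewrite mulr0 memN_msupp_eq0 ?mul0rn//.
apply: msize_mdeg_ge; rewrite mdegD; apply: leq_trans sP _.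
by rewrite -addn1 leq_add2l lt0n mdeg_eq0.
Qed.

Lemma mderivm_eq0 P a : (msize P <= mdeg a)%N -> mderivm a P = 0.
Proof.
move=> sP; rewrite mderivm_const ?(leq_trans sP)//.
by rewrite memN_msupp_eq0 ?mul0rn ?mpolyC0//; exact: msize_mdeg_ge.
Qed.

(** [Q] is homogeneous of degree s with coefficients c_b / b!: the derivative of order a, with |a| =
    s, keeps only the monomial of exponent a and multiplies it by a!. *)
Lemma mpoly_top_derivatives (s : nat) (c : multinom N -> R) :
  exists2 Q : mpoly N R, (msize Q <= s.+1)%N &
    forall a, mdeg a = s -> mderivm a Q = mpolyC N (c a).
Proof.
pose fct a := ((\prod_(i < N) (a i)`!)%N)%:R : R.
have fct0 a : fct a != 0.
  by rewrite pnatr_eq0 -lt0n prodn_gt0// => i; exact: fact_gt0.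
pose Q : mpoly N R := \sum_(b : bmultinom N s.+1 | mdeg b == s)
  (c b / fct b) *: mpolyX R (b : multinom N).
have sQ : (msize Q <= s.+1)%N.
  apply: leq_trans (msize_sum _ _ _) _; apply/bigmax_leqP => b /eqP bs.
  by apply: leq_trans (msizeZ_le _ _) _; rewrite msizeX bs.
exists Q => // a das; rewrite mderivm_const ?das//; congr mpolyC.
have bs : (mdeg a < s.+1)%N by rewrite das.
rewrite /Q raddf_sum /= (bigD1 (BMultinom bs)) /= ?das//.
rewrite mcoeffZ mcoeffX eqxx mulr1 big1 ?addr0.
  by rewrite -mulr_natr divfK.
move=> b /andP[_ ba]; rewrite mcoeffZ mcoeffX.
by rewrite (negbTE (_ : (b : multinom N) != a)) ?mulr0//; apply: contra ba => /eqP <-;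
  apply/eqP/val_inj.
Qed.

Lemma lee_sum_card (I : finType) (A : pred I) (X : I -> \bar R) (Y : \bar R) :
  (0 <= Y)%E -> (forall j, A j -> (X j <= Y)%E) ->
  (\sum_(j | A j) X j <= #|I|%:R%:E * Y)%E.
Proof.
move=> Y0 XY; have -> : (#|I|%:R%:E * Y = \sum_(j : I) Y)%E.
  by rewrite mule_natl -[RHS]/(\sum_(j : I) Y)%R; symmetry; exact: sumr_const.
rewrite big_mkcond /=; apply: lee_sum => j _.
by case: ifP => // /XY.
Qed.

Lemma mderivm_addU a i P : mderivm (mnm_add a (mnm1 i)) P = mderiv i (mderivm a P).
Proof. by rewrite mderivmDm mderivmU1m. Qed.

(** Consecutive levels are linked by first-order weak gradients, the hypothesis of [poincare]. Full
    weak derivatives of one function would have to be re-derived after each subtraction of a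
    polynomial. *)
Definition jet U p s g : Prop :=
  (forall a, (mdeg a <= s)%N -> in_Lp U p (g a)) /\
  (forall a, (mdeg a < s)%N -> weak_gradient U (g a) (fun i => g (mnm_add a (mnm1 i)))).

Lemma weak_gradient_peval U P : open U ->
  weak_gradient U (peval P) (fun i => peval (mderiv i P)).
Proof. by move=> oU e i te; rewrite -partial_beval peval_by_parts. Qed.

Lemma jetB_peval U p s g Q : (1 <= p)%E -> open U -> bounded_set U -> jet U p s g ->
  jet U p s (fun a x => g a x - peval (mderivm a Q) x).
Proof.
move=> p1 oU bU [Lg wg]; have mU := open_measurable_rV oU.
have LP P : in_Lp U p (peval P) by exact: in_Lp_peval.
have iP P := in_Lp_integrable p1 mU bU (LP P).
split=> [a sa|a sa]; first by apply: in_LpB => //; exact: Lg.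
have mdegS i : (mdeg (mnm_add a (mnm1 i)) <= s)%N by rewrite mdegD mdeg1 addn1.
apply: weak_gradientB => //.
- by apply: (in_Lp_integrable p1) => //; exact/Lg/ltnW.
- by move=> i; apply: (in_Lp_integrable p1) => //; exact: Lg.
- exact: wg.
- by under eq_fun do rewrite mderivm_addU; exact: weak_gradient_peval.
Qed.

Definition poincare_const (r h : R) : R := (r *+ 2) ^- N * h * (h *+ 4) ^+ N.

Definition top_norm U p s g : \bar R :=
  (\sum_(b : bmultinom N s.+1 | mdeg b == s) Lp_norm U p (g b))%E.

Lemma le_top_norm U p s g a : mdeg a = s -> (Lp_norm U p (g a) <= top_norm U p s g)%E.
Proof.
move=> das; have bs : (mdeg a < s.+1)%N by rewrite das.
rewrite /top_norm (bigD1 (BMultinom bs)) /= ?das// leeDl//.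
by apply: sume_ge0 => b _; exact: Lp_norm_ge0.
Qed.

Lemma top_norm_ge0 U p s g : (0 <= top_norm U p s g)%E.
Proof. by apply: sume_ge0 => b _; exact: Lp_norm_ge0. Qed.

Lemma peval_const (c : R) (x : 'rV[R]_N) : peval (mpolyC N c) x = c.
Proof. by rewrite /peval mevalC. Qed.

(* Peel off the derivatives of order s - 1: subtract a homogeneous polynomial
   whose derivatives of order s - 1 are the constants given by the Poincare
   inequality, then apply the case s - 1. *)
Lemma jet_approx s : exists2 Gam : R, 0 <= Gam &
  forall U c r h p g, (1 <= p)%E -> open U -> bounded_set U -> star_box U c r h ->
    jet U p s g ->
    exists2 Q, (msize Q <= s)%N & forall a, (mdeg a <= s)%N ->
      (Lp_norm U p (fun x => g a x - peval (mderivm a Q) x)%R <=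
        (Gam * poincare_const r h ^+ (s - mdeg a))%:E * top_norm U p s g)%E.
Proof.
elim: s => [|s [Gam Gam0 IH]].
  exists 1 => // U c r h p g p1 oU bU sU jg.
  exists 0; first by rewrite msize0.
  move=> a; rewrite leqn0 => /eqP da; rewrite sub0n expr0 mulr1 mul1e.
  under eq_fun do rewrite raddf0 /peval meval0 subr0.
  exact: le_top_norm.
(* The 1 serves the derivatives of order s + 1, which stay unchanged. For lower orders the case s
   bounds the error by [Gam] times the top norm of the corrected jet: at most
   [#|{: bmultinom N s.+1}|] terms, each controlled through Poincare by N derivatives of order s +
   1. *)
exists (1 + Gam * #|{: bmultinom N s.+1}|%:R * N%:R).
  by rewrite addr_ge0// !mulr_ge0.
move=> U c r h p g p1 oU bU sU jg; have [Lg wg] := jg.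
have mU := open_measurable_rV oU.
set K := poincare_const r h.
have K0 : 0 <= K.
  have [r0 h0 _ _ _] := sU.
  by rewrite !mulr_ge0 ?invr_ge0 ?exprn_ge0 ?mulrn_wge0// ltW.
set S := top_norm U p s.+1 g.
have S0 : (0 <= S)%E by exact: top_norm_ge0.
have [cc hcc] : exists cc : multinom N -> R, forall a, mdeg a = s ->
    (Lp_norm U p (fun x => g a x - cc a)%R <= (K * N%:R)%:E * S)%E.
  suff /choice[cc hcc] : forall a, exists c0, mdeg a = s ->
      (Lp_norm U p (fun x => g a x - c0)%R <= (K * N%:R)%:E * S)%E by exists cc.
  move=> a; have [das|nas] := eqVneq (mdeg a) s; last first.
    by exists 0 => das; rewrite das eqxx in nas.
  have dU i : mdeg (mnm_add a (mnm1 i)) = s.+1 by rewrite mdegD mdeg1 addn1 das.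
  have [|||c0 hc0] := poincare p1 oU bU sU (w := g a)
    (G := fun i => g (mnm_add a (mnm1 i))).
  - by apply: Lg; rewrite das.
  - by move=> i; apply: Lg; rewrite dU.
  - by apply: wg; rewrite das.
  exists c0 => _; apply: le_trans hc0 _.
  rewrite [X in (_ <= X * _)%E]EFinM -[leRHS]muleA; apply: lee_wpmul2l;
    first by rewrite lee_fin.
  rewrite -[X in X%:R]card_ord; apply: lee_sum_card => // i _.
  by apply: le_top_norm.
have [Qt sQt Qtd] := mpoly_top_derivatives s cc.
pose g' a x := g a x - peval (mderivm a Qt) x.
have jg' : jet U p s g'.
  apply: jetB_peval => //; split=> a sa; last by apply: wg; exact: leqW.
  by apply: Lg; exact: leqW.
have [Q' sQ' hQ'] := IH U c r h p g' p1 oU bU sU jg'.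
exists (Q' + Qt).
  by apply: leq_trans (msizeD_le _ _) _; rewrite geq_max sQt (leq_trans sQ').
have top' : (top_norm U p s g' <= (#|{: bmultinom N s.+1}|%:R * (K * N%:R))%:E * S)%E.
  rewrite EFinM -muleA; apply: lee_sum_card => [|b /eqP bs].
    by rewrite mule_ge0// lee_fin mulr_ge0.
  rewrite /g'; under eq_fun do rewrite Qtd// peval_const.
  exact: hcc.
move=> a; rewrite leq_eqVlt => /orP[/eqP das|].
  (* Order s + 1 exceeds the degree of the subtracted polynomial, so its derivative vanishes. *)
  rewrite mderivm_eq0; last first.
    by apply: leq_trans (msizeD_le _ _) _; rewrite das geq_max sQt (leq_trans sQ').
  under eq_fun do rewrite /peval meval0 subr0.
  rewrite das subnn expr0 mulr1; apply: le_trans (le_top_norm U p g das) _.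
  rewrite -[leLHS]mul1e lee_wpmul2r// lee_fin lerDl !mulr_ge0//.
rewrite ltnS => das.
rewrite (_ : (fun x => _) = (fun x => g' a x - peval (mderivm a Q') x)); last first.
  by apply/funext => x; rewrite mderivmD /g' /peval mevalD opprD addrAC addrA.
apply: le_trans (hQ' a das) _.
apply: le_trans (lee_wpmul2l _ top') _; first by rewrite lee_fin mulr_ge0// exprn_ge0.
rewrite muleA -EFinM lee_wpmul2r// lee_fin subSn// exprS.
rewrite [leRHS](_ : _ = K * K ^+ (s - mdeg a) +
  Gam * K ^+ (s - mdeg a) * (#|{: bmultinom N s.+1}|%:R * (K * N%:R))); last by ring.
by rewrite lerDr mulr_ge0// exprn_ge0.
Qed.

End jets.

(** * The L^2 projection on polynomials *)

Section polynomials.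
Context {R : realType} {N : nat}.
Implicit Types (P Q : mpoly N R) (a : multinom N) (i : 'I_N) (p : \bar R).
Implicit Types (U : set 'rV[R]_N) (f w : 'rV[R]_N -> R) (x z c : 'rV[R]_N) (h r : R).
Local Notation mu := (@lebesgue_measure_rV R N).

Lemma Rintegral_eq0 U f : (forall x, U x -> f x = 0) -> \int[mu]_(x in U) f x = 0.
Proof. by move=> f0; rewrite /Rintegral integral0_eq// => x Ux; rewrite f0. Qed.

Lemma peval_integrable U P : open U -> bounded_set U ->
  mu.-integrable U (EFin \o peval P).
Proof.
move=> oU bU; have mU := open_measurable_rV oU.
apply: (@in_Lp_integrable _ _ U 1%E) => //.
exact: in_Lp_peval.
Qed.

Definition pint U P : R := \int[mu]_(x in U) peval P x.

Lemma Rintegral_mul_peval_linear U w I (s : seq I) (A : pred I) (l : I -> R)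
  (F : I -> mpoly N R) :
  measurable U -> (forall P, mu.-integrable U (EFin \o (fun x => w x * peval P x))) ->
  \int[mu]_(x in U) (w x * peval (\sum_(j <- s | A j) l j *: F j) x) =
  \sum_(j <- s | A j) l j * \int[mu]_(x in U) (w x * peval (F j) x).
Proof.
move=> mU iw; elim: s => [|j s IH].
  by rewrite !big_nil Rintegral_eq0// => x _; rewrite /peval meval0 mulr0.
rewrite !big_cons; case: ifP => // _; rewrite -IH -RintegralZl//.
rewrite -RintegralD//; last exact: (integrableZl mU (l j) (iw (F j))).
by apply: eq_Rintegral => x _; rewrite /peval mevalD mevalZ mulrDr mulrCA.
Qed.

Lemma pint_linear U I (s : seq I) (A : pred I) (l : I -> R) (F : I -> mpoly N R) :
  open U -> bounded_set U ->
  pint U (\sum_(j <- s | A j) l j *: F j) = \sum_(j <- s | A j) l j * pint U (F j).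
Proof.
move=> oU bU; have mU := open_measurable_rV oU.
have pintE P : pint U P = \int[mu]_(x in U) (1 * peval P x).
  by apply: eq_Rintegral => x _; rewrite mul1r.
rewrite pintE Rintegral_mul_peval_linear//.
  by apply: eq_bigr => j _; rewrite pintE.
by move=> P; under eq_fun do rewrite mul1r; exact: peval_integrable.
Qed.

(** Differentiating along the leading exponent a gives the constant a! times the leading
    coefficient. It is also a weak derivative of a function that vanishes almost everywhere, so by
    uniqueness it is 0 on a set of positive measure. *)
Lemma peval_ae_eq0 U P : open U -> (0 < mu U)%E ->
  {ae mu, forall x, U x -> peval P x = 0} -> P = 0.
Proof.
move=> oU U0 P0; have mU := open_measurable_rV oU.
apply/eqP; apply: contraT => nzP.
have sP := mlead_deg nzP; set a := mlead P in sP.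
have wP := weak_derivative_peval a P oU.
have w0 : weak_derivative U a (peval P) (peval 0).
  split; [exact: locally_integrable_peval..|] => phi tphi.
  rewrite [X in _ = _ * X](_ : _ = 0) ?mulr0; last first.
    by rewrite Rintegral_eq0// => x _; rewrite /peval meval0 mul0r.
  have mphi := measurable_test_function (test_function_multi a tphi).
  rewrite /Rintegral (_ : integral _ _ _ = integral mu U (cst 0%E));
    first by rewrite integral0.
  apply: ae_eq_integral => //.
    apply/measurable_EFinP; apply: measurable_funM; first exact: measurable_peval.
    exact: measurable_funTS.
  apply: filterS P0 => x Px Ux; by rewrite Px// mul0r.
have := weak_derivative_unique oU wP w0.
rewrite mderivm_const ?sP// => cae.
have U00 : mu U = 0%E.
  apply/(negligibleP mu mU).1; apply: negligibleS cae => x Ux /= /(_ Ux).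
  rewrite peval_const /peval meval0 => /eqP; rewrite mulrn_eq0 mleadc_eq0 (negbTE nzP) orbF.
  by apply/negP; rewrite -lt0n prodn_gt0// => i; exact: fact_gt0.
by rewrite U00 ltxx in U0.
Qed.

Lemma pint_sqr_eq0 U P : open U -> bounded_set U -> (0 < mu U)%E ->
  pint U (P * P) = 0 -> P = 0.
Proof.
move=> oU bU U0; have mU := open_measurable_rV oU.
have iP := peval_integrable (P * P) oU bU.
rewrite /pint /Rintegral => PP0; apply: (peval_ae_eq0 oU U0).
have : (\int[mu]_(x in U) `|(EFin \o peval (P * P)%R) x| = 0)%E.
  rewrite -[RHS](_ : (fine (\int[mu]_(x in U) (peval (P * P)%R x)%:E))%:E = _);
    last by rewrite PP0.
  rewrite fineK; last exact: integrable_fin_num.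
  by apply: eq_integral => x _ /=; rewrite /peval mevalM ger0_norm// -expr2 sqr_ge0.
move=> /(ae_eq_integral_abs _ mU (measurable_int _ iP)).1.
apply: filterS => x /= Px Ux; have := Px Ux => -[] /eqP.
by rewrite /peval mevalM mulf_eq0 orbb => /eqP.
Qed.

Local Notation mon b := (mpolyX R (b : multinom N)).

(* The dual basis of the monomials in the inner product of L^2(U): the Gram
   matrix is invertible, its kernel being made of polynomials of norm 0. *)
Lemma dual_monomials (k : nat) U : open U -> bounded_set U -> (0 < mu U)%E ->
  exists2 e : bmultinom N k.+1 -> mpoly N R, forall b, (msize (e b) <= k.+1)%N &
    forall (b : bmultinom N k.+1) Q, (msize Q <= k.+1)%N -> pint U (Q * e b) = mcoeff b Q.
Proof.
move=> oU bU U0.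
pose n := #|{: bmultinom N k.+1}|.
pose ev (j : 'I_n) : bmultinom N k.+1 := enum_val j.
pose comb (l : 'I_n -> R) := \sum_j l j *: mon (ev j).
have mon_inj j j' : ((ev j : multinom N) == ev j') = (j == j').
  by rewrite (inj_eq val_inj) (inj_eq enum_val_inj).
have scomb l : (msize (comb l) <= k.+1)%N.
  apply: leq_trans (msize_sum _ _ _) _; apply/bigmax_leqP => j _.
  by apply: leq_trans (msizeZ_le _ _) _; rewrite msizeX ltnS -ltnS bmdeg.
pose G : 'M[R]_n := \matrix_(j, j') pint U (mon (ev j) * mon (ev j')).
have pcomb Q l : pint U (Q * comb l) = \sum_j l j * pint U (Q * mon (ev j)).
  rewrite mulr_sumr; under eq_bigr do rewrite -scalerAr.
  exact: pint_linear.
have Gunit : G \in unitmx.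
  rewrite -row_free_unit; apply: inj_row_free => v vG.
  pose Q := comb (fun j => v ord0 j).
  have QE j : pint U (Q * mon (ev j)) = 0.
    have := congr1 (fun A : 'rV_n => A ord0 j) vG; rewrite !mxE => <-.
    rewrite mulrC pcomb; apply: eq_bigr => j' _; rewrite mxE; congr (_ * pint _ _).
    by rewrite mulrC.
  have Q0 : Q = 0.
    apply: (pint_sqr_eq0 oU bU U0); rewrite [in X in _ * X]/Q pcomb big1// => j _.
    by rewrite QE mulr0.
  apply/rowP => j; rewrite mxE.
  have := congr1 (mcoeff (ev j)) Q0; rewrite mcoeff0 => <-.
  rewrite /Q /comb raddf_sum /= (bigD1 j)//= mcoeffZ mcoeffX eqxx mulr1 big1 ?addr0//.
  by move=> j' /negbTE j'j; rewrite mcoeffZ mcoeffX mon_inj j'j mulr0.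
pose e (b : bmultinom N k.+1) := comb (fun j => invmx G j (enum_rank b)).
have he (b b' : bmultinom N k.+1) : pint U (mon b * e b') = (b == b')%:R.
  rewrite pcomb; have := mulmxV Gunit => /matrixP /(_ (enum_rank b) (enum_rank b')).
  rewrite !mxE (inj_eq enum_rank_inj) => <-; apply: eq_bigr => j _.
  by rewrite mxE mulrC /ev enum_rankK.
exists e => [b|b Q sQ]; first exact: scomb.
rewrite [in LHS](mpolywE sQ) mulr_suml; under [in LHS]eq_bigr do rewrite -scalerAl.
rewrite pint_linear// (bigD1 b)//= he eqxx mulr1 big1 ?addr0// => b' /negbTE b'b.
by rewrite he b'b mulr0.
Qed.

End polynomials.

(** * Scaling and inverse inequalities for polynomials *)

Section scaling.
Context {R : realType} {N : nat}.
Implicit Types (P Q : mpoly N R) (a : multinom N) (i : 'I_N) (p : \bar R).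
Implicit Types (U : set 'rV[R]_N) (f w : 'rV[R]_N -> R) (x y z c : 'rV[R]_N) (h r : R).
Local Notation mu := (@lebesgue_measure_rV R N).

Lemma msizeM_deg P Q (m n : nat) : (msize P <= m.+1)%N -> (msize Q <= n.+1)%N ->
  (msize (P * Q) <= (m + n).+1)%N.
Proof.
move=> sP sQ; have [->|P0] := eqVneq P 0; first by rewrite mul0r msize0.
have [->|Q0] := eqVneq Q 0; first by rewrite mulr0 msize0.
by rewrite msizeM//; apply: (@leq_trans (m.+1 + n.+1).-1);
  [rewrite -!subn1 leq_sub2r// leq_add|rewrite addSn addnS].
Qed.

Definition affine_mpoly c h P : mpoly N R :=
  comp_mpoly [tuple mpolyC N (c ord0 i) + h *: mpolyX R (mnm1 i) | i < N] P.

Lemma peval_affine c h P z : peval (affine_mpoly c h P) z = peval P (c + h *: z).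
Proof.
rewrite /affine_mpoly /peval comp_mpoly_meval; apply: meval_eq => i.
by rewrite tnth_mktuple mevalD mevalC mevalZ mevalXU !mxE.
Qed.

Lemma msize_affine c h P k : (msize P <= k.+1)%N -> (msize (affine_mpoly c h P) <= k.+1)%N.
Proof.
move=> sP; rewrite /affine_mpoly comp_mpolyEX.
apply: leq_trans (msize_sum _ _ _) _; apply/bigmax_leqP_seq => m mP _.
have dm : (mdeg m <= k)%N by rewrite -ltnS; exact: leq_trans (msize_mdeg_lt mP) sP.
apply: leq_trans (msizeZ_le _ _) _; apply: (@leq_trans (mdeg m).+1); last by rewrite ltnS.
rewrite comp_mpolyX mdegE; apply: (big_ind2
  (fun (Q : mpoly N R) (n : nat) => (msize Q <= n.+1)%N)).
- by rewrite msize1.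
- by move=> Q1 n1 Q2 n2; exact: msizeM_deg.
move=> i _; elim: (m i) => [|j IH]; first by rewrite expr0 msize1.
rewrite exprS -[j.+1]add1n; apply: msizeM_deg => //; rewrite tnth_mktuple.
apply: leq_trans (msizeD_le _ _) _; rewrite geq_max msizeC.
by rewrite (leq_trans (leq_b1 _))//= (leq_trans (msizeZ_le _ _))// msizeX mdeg1.
Qed.

Lemma mderiv_affine c h P i :
  mderiv i (affine_mpoly c h P) = h *: affine_mpoly c h (mderiv i P).
Proof.
rewrite /affine_mpoly; elim/(@mpoly_ring_ind R N): P => [t|j|P Q IHP IHQ|P Q IHP IHQ].
- by rewrite comp_mpolyC !mderivC comp_mpoly0 scaler0.
- rewrite comp_mpolyXU -tnth_nth tnth_mktuple mderivD mderivC add0r mderivZ !mderivX.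
  rewrite comp_mpolyZ !mnm1E; case: eqVneq => [->|_]; last by rewrite !scale0r.
  by rewrite (_ : mnm_sub _ _ = mnm0) ?mpolyX0 ?comp_mpoly1//; apply/mnmP => l;
    rewrite mnmBE subnn mnm0E.
- by rewrite comp_mpolyD !mderivD IHP IHQ comp_mpolyD scalerDr.
- rewrite rmorphM /= !mderivM IHP IHQ comp_mpolyD !rmorphM /= scalerDr.
  by rewrite -scalerAl -scalerAr.
Qed.

Lemma mderivm_affine c h P a :
  mderivm a (affine_mpoly c h P) = h ^+ mdeg a *: affine_mpoly c h (mderivm a P).
Proof.
rewrite !mderivm_foldr -size_multi_index; elim: (flatten _) => /= [|i s IH].
  by rewrite expr0 scale1r.
by rewrite IH mderivZ mderiv_affine scalerA -exprSr.
Qed.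

Lemma le_Rintegral_norm_peval U P f M : open U -> bounded_set U ->
  mu.-integrable U (EFin \o f) -> (forall x, U x -> `|peval P x| <= M) ->
  `|\int[mu]_(x in U) (f x * peval P x)| <= M * \int[mu]_(x in U) `|f x|.
Proof.
move=> oU bU jf PM; have mU := open_measurable_rV oU.
have jn := integrable_norm jf.
have jfP : mu.-integrable U (EFin \o (fun x => f x * peval P x)).
  by apply: (integrableM_bounded (M := M)) => //; exact: measurable_peval.
apply: le_trans (le_normr_Rintegral mU jfP) _.
rewrite -RintegralZl//; apply: le_Rintegral => //.
- exact: integrable_norm jfP.
- exact: (integrableZl mU M jn).
- by move=> x Ux; rewrite normrM mulrC ler_wpM2r// PM.
Qed.

Lemma bounded_ball_rV c r : bounded_set (ball c r).
Proof.
exists (`|c| + r); split; first exact: num_real.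
move=> M rM x; rewrite mx_norm_ball /ball_/= distrC => xr; apply/ltW/(le_lt_trans _ rM).
by rewrite -[x](subrK c) addrC (le_trans (ler_normD _ _))// lerD2l ltW.
Qed.

(** Equivalence of norms made explicit: pairing [Q] with the dual basis bounds its coefficients by
    its L^1 norm, and the derivatives of the monomials are bounded on the unit ball. *)
Lemma reference_bound (k : nat) r a : 0 < r -> exists2 C : R, 0 <= C &
  forall Q z, (msize Q <= k.+1)%N -> `|z| <= 1 ->
    `|peval (mderivm a Q) z| <= C * \int[mu]_(y in ball 0 r) `|peval Q y|.
Proof.
move=> r0; set B := ball (0 : 'rV[R]_N) r.
have oB : open B by exact: ball_open.
have bB := bounded_ball_rV 0 r : bounded_set B.
have B0 : (0 < mu B)%E by rewrite lebesgue_measure_ball_rV// lte_fin exprn_gt0// mulrn_wgt0.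
have [e se he] := dual_monomials k oB bB B0.
have /choice[M hM] : forall b : bmultinom N k.+1, exists M : R, forall x, B x ->
  `|peval (e b) x| <= M.
  by move=> b; exact: peval_bounded.
have bC : bounded_set [set z : 'rV[R]_N | `|z| <= 1].
  by exists 1; split; [exact: num_real|move=> t t1 x /= /le_trans; apply; exact: ltW].
have /choice[D hD] : forall b : bmultinom N k.+1, exists M : R, forall z, `|z| <= 1 ->
    `|peval (mderivm a (mpolyX R (b : multinom N))) z| <= M.
  by move=> b; exact: (peval_bounded _ bC).
exists (\sum_b `|M b| * `|D b|); first by apply: sumr_ge0 => b _; exact: mulr_ge0.
move=> Q z sQ z1.
have coef_le (b : bmultinom N k.+1) : `|mcoeff b Q| <= `|M b|
  * \int[mu]_(y in B) `|peval Q y|.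
  rewrite -he// /pint; under eq_Rintegral do rewrite /peval mevalM.
  apply: le_Rintegral_norm_peval => //; first exact: peval_integrable.
  by move=> x Bx; apply: le_trans (hM b x Bx) _; exact: ler_norm.
rewrite [in mderivm _ _](mpolywE sQ) raddf_sum /= /peval raddf_sum /=.
apply: le_trans (ler_norm_sum _ _ _) _; rewrite mulr_suml; apply: ler_sum => b _.
rewrite mderivmZ mevalZ normrM mulrAC; apply: ler_pM => //.
by apply: le_trans (hD b z z1) _; exact: ler_norm.
Qed.

Lemma Rintegral_norm_affine c h r P : 0 < h ->
  \int[mu]_(y in ball c (h * r)) `|peval P y| =
  h ^+ N * \int[mu]_(z in ball (0 : 'rV[R]_N) r) `|peval (affine_mpoly c h P) z|.
Proof.
move=> h0; have mB := @measurable_ball_rV R N c (h * r).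
have iQ := peval_integrable (affine_mpoly c h P) (@ball_open _ _ (0 : 'rV[R]_N) r)
  (bounded_ball_rV 0 r).
rewrite /Rintegral integral_mkcond (ge0_integral_affine_rV c h0).
- rewrite [X in (_ * X)%E](_ : _ = \int[mu]_(z in ball (0%R : 'rV[R]_N) r)
      `|peval (affine_mpoly c h P) z|%:E)%E.
    by rewrite fineM//; exact: (@integrable_fin_num _ _ _ mu _
      (@measurable_ball_rV R N 0 r) _ (integrable_norm iQ)).
  rewrite [RHS]integral_mkcond; apply: eq_integral => z _.
  rewrite /patch peval_affine; congr (if _ then _ else _).
  apply/idP/idP; rewrite !inE !mx_norm_ball /ball_/=
    opprD addNKr sub0r !normrN normrZ gtr0_norm//.
    by rewrite ltr_pM2l.
  by rewrite ltr_pM2l.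
- apply: (measurable_restrictT _ mB).1; apply/measurable_EFinP.
  by apply: measurableT_comp => //; exact: measurable_peval.
- by move=> x; rewrite /patch; case: ifP => // _; rewrite lee_fin.
Qed.

(** The substitution x = c + h z reduces to [reference_bound]; each derivative costs a factor 1/h
    and the change of variables in the integral h^-N. The condition on x covers all of a set
    containing c and of diameter at most h. *)
Lemma peval_mderivm_le (k : nat) r a : 0 < r -> exists2 C : R, 0 <= C &
  forall c h Q x, 0 < h -> (msize Q <= k.+1)%N -> `|x - c| <= h ->
    `|peval (mderivm a Q) x| <=
      C * (h ^+ mdeg a * h ^+ N)^-1 * \int[mu]_(y in ball c (h * r)) `|peval Q y|.
Proof.
move=> r0; have [C C0 hC] := reference_bound k a r0; exists C => //.
move=> c h Q x h0 sQ xc; rewrite Rintegral_norm_affine//.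
have hn n : 0 < h ^+ n by exact: exprn_gt0.
set z := h^-1 *: (x - c).
have xE : x = c + h *: z by rewrite /z scalerA divff ?gt_eqF// scale1r addrC subrK.
have z1 : `|z| <= 1.
  by rewrite /z normrZ gtr0_norm ?invr_gt0// mulrC ler_pdivrMr// mul1r.
have := hC _ z (msize_affine c h sQ) z1.
rewrite mderivm_affine /peval mevalZ -/(peval _ _) peval_affine -xE.
rewrite normrM gtr0_norm// mulrC -ler_pdivlMr// => /le_trans; apply.
rewrite le_eqVlt; apply/orP; left; apply/eqP; field.
by rewrite !gt_eqF.
Qed.

End scaling.

Section projection.
Context {R : realType} {N : nat}.
Implicit Types (P Q : mpoly N R) (a : multinom N) (i : 'I_N) (p : \bar R).
Implicit Types (U : set 'rV[R]_N) (f w : 'rV[R]_N -> R) (x y z c : 'rV[R]_N) (h r : R).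
Local Notation mu := (@lebesgue_measure_rV R N).

Lemma integrableM_peval U w P : open U -> bounded_set U ->
  mu.-integrable U (EFin \o w) -> mu.-integrable U (EFin \o (fun x => w x * peval P x)).
Proof.
move=> oU bU iw; have mU := open_measurable_rV oU.
have [M hM] := peval_bounded P bU.
by apply: (integrableM_bounded (M := M)) => //; exact: measurable_peval.
Qed.

Lemma projection_exists (k : nat) U w : open U -> bounded_set U -> (0 < mu U)%E ->
  mu.-integrable U (EFin \o w) ->
  exists2 Q, (msize Q <= k.+1)%N & forall P, (msize P <= k.+1)%N ->
    \int[mu]_(x in U) (peval Q x * peval P x) = \int[mu]_(x in U) (w x * peval P x).
Proof.
move=> oU bU U0 iw; have mU := open_measurable_rV oU.
have [e se he] := dual_monomials k oU bU U0.
pose t (b : bmultinom N k.+1) := \int[mu]_(x in U)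
  (w x * peval (mpolyX R (b : multinom N)) x).
(* Pairing the dual polynomial [e b] with P extracts the coefficient of exponent b of P, so the
   moments of [w] are the right coefficients. *)
exists (\sum_b t b *: e b).
  apply: leq_trans (msize_sum _ _ _) _; apply/bigmax_leqP => b _.
  by apply: leq_trans (msizeZ_le _ _) _.
move=> P sP; transitivity (pint U (P * \sum_b t b *: e b)).
  by apply: eq_Rintegral => x _; rewrite mulrC /peval mevalM.
rewrite mulr_sumr; under eq_bigr do rewrite -scalerAr.
rewrite pint_linear// [in RHS](mpolywE sP) Rintegral_mul_peval_linear//; last first.
  by move=> Q; exact: integrableM_peval.
by apply: eq_bigr => b _; rewrite he// mulrC.
Qed.

(* The L^1 norm I of Q on the ball controls Q on U, hence int_U Q^2 = int_U w Q
   is at most K I W with W the L^1 norm of w; as I^2 <= mu(ball) int_U Q^2 by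
   Cauchy-Schwarz, I <= mu(ball) K W. *)
Lemma projection_le (k : nat) r a : 0 < r -> exists2 D : R, 0 <= D &
  forall U c h w Q, open U -> bounded_set U -> star_box U c (h * r) h ->
    mu.-integrable U (EFin \o w) -> (msize Q <= k.+1)%N ->
    \int[mu]_(x in U) (peval Q x * peval Q x) = \int[mu]_(x in U) (w x * peval Q x) ->
    forall x, U x -> `|peval (mderivm a Q) x| <=
      D * (h ^+ mdeg a * h ^+ N)^-1 * \int[mu]_(y in U) `|w y|.
Proof.
move=> r0; have [Ca Ca0 hCa] := peval_mderivm_le (N := N) k a r0.
have [C0 C00 hC0] := peval_mderivm_le (N := N) k mnm0 r0.
(* [Ca] passes from I to the derivative; I <= V K W with V = (2hr)^N and K = C0 h^-N leaves C0
   (2r)^N. *)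
exists (Ca * C0 * (r *+ 2) ^+ N).
  by rewrite mulr_ge0// ?mulr_ge0// exprn_ge0// mulrn_wge0// ltW.
move=> U c h w Q oU bU [hr0 h0 BU dU _] iw sQ wQ x Ux.
have mU := open_measurable_rV oU.
have Uc : U c by apply: BU; exact: ballxx.
have xc y : U y -> `|y - c| <= h by move=> Uy; exact: dU.
set B := ball c (h * r) in BU.
have mB : measurable B by exact: measurable_ball_rV.
have oB : open B by exact: ball_open.
have bB : bounded_set B by exact: bounded_ball_rV.
have hN : 0 < h ^+ N by exact: exprn_gt0.
have ha : 0 < h ^+ mdeg a by exact: exprn_gt0.
set I := \int[mu]_(y in B) `|peval Q y|.
set W := \int[mu]_(y in U) `|w y|.
have I0 : 0 <= I by exact: Rintegral_ge0.
have W0 : 0 <= W by exact: Rintegral_ge0.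
pose K := C0 * (h ^+ N)^-1.
have K0 : 0 <= K by rewrite mulr_ge0// invr_ge0 ltW.
pose V := ((h * r) *+ 2) ^+ N.
have V0 : 0 < V by rewrite exprn_gt0// mulrn_wgt0.
have QU y : U y -> `|peval Q y| <= K * I.
  move=> Uy; have := hC0 c h Q y h0 sQ (xc y Uy).
  by rewrite mdeg0 expr0 mul1r mderivm0m.
have QQU : \int[mu]_(y in U) (peval Q y * peval Q y) <= K * I * W.
  rewrite wQ; apply: le_trans (ler_norm _) _.
  exact: le_Rintegral_norm_peval.
have QQ P : P = Q * Q -> \int[mu]_(y in B) peval P y <=
  \int[mu]_(y in U) (peval Q y * peval Q y).
  move=> PE; rewrite (_ : (fun y => peval Q y * peval Q y) = peval P); last first.
    by apply/funext => y; rewrite PE /peval mevalM.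
  apply: fine_le.
  - exact: (integrable_fin_num mB (peval_integrable P oB bB)).
  - exact: (integrable_fin_num mU (peval_integrable P oU bU)).
  - apply: ge0_subset_integral => //; first by apply/measurable_EFinP;
      exact: measurable_peval.
    by move=> y _; rewrite lee_fin PE /peval mevalM -expr2 sqr_ge0.
have IVKW : I <= V * K * W.
  have [->|In0] := eqVneq I 0; first exact: mulr_ge0 (mulr_ge0 (ltW V0) K0) W0.
  have Ip : 0 < I by rewrite lt_neqAle eq_sym In0.
  (* Cauchy-Schwarz through the pointwise bound |Q| <= l Q^2 / 2 + 1/(2l). With this l the constant
     term integrates to I/2, which is absorbed on the left. *)
  pose l := V / I; have l0 : 0 < l by exact: divr_gt0.
  have iQQ := peval_integrable (Q * Q) oB bB.
  have iQ := integrable_norm (peval_integrable Q oB bB).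
  have muB : mu B = V%:E by rewrite lebesgue_measure_ball_rV.
  have ic : mu.-integrable B (EFin \o cst ((l *+ 2)^-1)).
    rewrite (_ : cst _ = peval (mpolyC N (l *+ 2)^-1)); first exact: peval_integrable.
    by apply/funext => y; rewrite peval_const.
  have il := integrableZl mB (l / 2) iQQ.
  have : I <= \int[mu]_(y in B) (l / 2 * peval (Q * Q) y + (l *+ 2)^-1).
    apply: le_Rintegral => //; first exact: (integrableD mB il ic).
    move=> y _; rewrite /peval mevalM -/(peval Q y) -[_ * peval Q y]expr2 -real_normK
      ?num_real//=.
    set u := `|peval Q y|.
    rewrite (_ : _ + _ = u + (l *+ 2)^-1 * (l * u - 1) ^+ 2); last first.
      by field; rewrite gt_eqF.
    by rewrite lerDl mulr_ge0 ?sqr_ge0// invr_ge0 mulrn_wge0// ltW.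
  rewrite RintegralD// RintegralZl// (_ : \int[mu]_(y in B) (l *+ 2)^-1 = (l *+ 2)^-1 * V);
    last by rewrite Rintegral_cst//; exact: (congr1 (fun t => (l *+ 2)^-1 * fine t) muB).
  move=> IQ.
  have QQ' := le_trans (QQ _ erefl) QQU.
  have : l / 2 * \int[mu]_(y in B) peval (Q * Q) y <= V * K * W / 2.
    rewrite (_ : V * K * W / 2 = l / 2 * (K * I * W)); last by rewrite /l; field.
    by rewrite ler_pM2l// divr_gt0.
  have lV : (l *+ 2)^-1 * V = I / 2.
    by rewrite /l; field; rewrite In0 gt_eqF.
  rewrite lV in IQ; lra.
apply: le_trans (hCa c h Q x h0 sQ (xc x Ux)) _.
rewrite (_ : _ * W = Ca * (h ^+ mdeg a * h ^+ N)^-1 * (V * K * W)).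
  by rewrite ler_wpM2l// mulr_ge0// invr_ge0 mulr_ge0// ltW.
rewrite /V /K -mulrnAr exprMn; field.
by rewrite !gt_eqF.
Qed.

(** For x in [U] the L^1 norm of [w] equals an average of translates of |w| over the displacements
    of norm less than 2h. Thus [Lnorm_average] covers all p at once, and its factor (4h)^N cancels
    the h^-N of [projection_le]. *)
Lemma projection_Lp_le (k : nat) r a : 0 < r -> exists2 D : R, 0 <= D &
  forall U c h p w Q, (1 <= p)%E -> open U -> bounded_set U -> star_box U c (h * r) h ->
    in_Lp U p w -> (msize Q <= k.+1)%N ->
    \int[mu]_(x in U) (peval Q x * peval Q x) = \int[mu]_(x in U) (w x * peval Q x) ->
    (Lp_norm U p (peval (mderivm a Q)) <= (D / h ^+ mdeg a)%:E * Lp_norm U p w)%E.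
Proof.
move=> r0; have [D D0 hD] := projection_le k a r0.
exists (D * 4 ^+ N); first by rewrite mulr_ge0// exprn_ge0.
move=> U c h p w Q p1 oU bU sU Lw sQ wQ.
have [hr0 h0 BU dU _] := sU.
have mU := open_measurable_rV oU.
have iw := in_Lp_integrable p1 mU bU Lw.
have [mw Nw] := Lw.
have hN : 0 < h ^+ N by exact: exprn_gt0.
have ha : 0 < h ^+ mdeg a by exact: exprn_gt0.
pose F y := `|(w \_ U) y|.
have mF : measurable_fun setT F.
  by apply: measurableT_comp => //; exact: measurable_patch.
have F0 y : 0 <= F y by exact: normr_ge0.
set B := ball (0 : 'rV[R]_N) (h *+ 2).
have mB : measurable B by exact: measurable_ball_rV.
have muB : mu B = ((h *+ 4) ^+ N)%:E.
  by rewrite lebesgue_measure_ball_rV ?mulrn_wgt0// -mulrnA.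
have NF : 'N[mu]_p[EFin \o F]%E = Lp_norm U p w by rewrite /Lp_norm -[RHS]Lnorm_abse.
pose M := D * (h ^+ mdeg a * h ^+ N)^-1.
have M0 : 0 <= M by rewrite mulr_ge0// invr_ge0 mulr_ge0// ltW.
pose av := average mu id B F.
have mav : measurable_fun setT av by apply: measurable_average => //;
  exact: measurable_id_rV.
have avE x : U x -> (\int[mu]_(y in U) `|w y|)%:E = av x.
  move=> Ux; rewrite /Rintegral fineK;
    last exact: (integrable_fin_num mU (integrable_norm iw)).
  rewrite integral_mkcond -(integral_translate x); last first.
    apply: (measurable_restrictT _ mU).1; apply/measurable_EFinP.
    exact: measurableT_comp.
  apply: eq_integral => y _; rewrite /patch /F /patch addrC indicE.
  have [yU|yU] := boolP ((x + y) \in U); last by rewrite normr0 mulr0.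
  rewrite mem_set ?mul1r// /B mx_norm_ball /ball_/= sub0r normrN.
  have := dU (x + y) x (set_mem yU) Ux; rewrite addrC addKr => /le_lt_trans; apply.
  by rewrite mulr2n ltrDl.
apply: (@le_trans _ _ 'N[mu]_p[(fun x => M%:E * av x)%E]%E).
  apply: le_Lnorm => //.
  - by apply/measurable_EFinP; apply: measurable_patch => //; exact: measurable_peval.
  - exact: measurable_funeM.
  apply: aeW => x /=.
  have a0 : (0 <= av x)%E by exact: average_ge0.
  rewrite [leRHS]gee0_abs ?mule_ge0 ?lee_fin//= /patch.
  case: ifPn => [/set_mem Ux|_]; last by rewrite normr0 mule_ge0 ?lee_fin.
  by rewrite -avE// -EFinM lee_fin; exact: (hD U c h w Q oU bU sU iw sQ wQ x Ux).
rewrite Lnorm_ge0_EFin//.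
have := Lnorm_average measurable_id_rV mB muB p1 mF F0.
rewrite NF => /(_ Nw) h1.
apply: le_trans (lee_wpmul2l _ h1) _; first by rewrite lee_fin.
rewrite muleA -EFinM le_eqVlt; apply/orP; left; apply/eqP; congr (_%:E * _)%E.
rewrite /M -[h *+ 4]mulr_natl exprMn; field.
by rewrite !gt_eqF.
Qed.

End projection.

(** * The error of the projection *)

Section star_shaped_box.
Context {R : realType} {N : nat}.
Implicit Types (U : set 'rV[R]_N) (x y c : 'rV[R]_N).

Lemma ler_norm_enorm x : `|x| <= enorm x.
Proof.
have := @closed_ball_rVE R N 0 (enorm x) (sqrtr_ge0 _).
move=> /(congr1 (fun A : set 'rV[R]_N => A x)) /= E.
rewrite -[x in leLHS]opprK normrN -[- x]sub0r E => i.
rewrite mxE sub0r normrN -sqrtr_sqr ler_wsqrtr// (bigD1 i)//= lerDl.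
by apply: sumr_ge0 => j _; exact: sqr_ge0.
Qed.

(** The crude factor N, coming from N <= N^2 under the root, is the origin of the radius rho/N. *)
Lemma ler_enorm_norm x : enorm x <= N%:R * `|x|.
Proof.
rewrite -[leRHS]ger0_norm ?mulr_ge0// -sqrtr_sqr ler_wsqrtr//.
rewrite exprMn -natrX; apply: (@le_trans _ _ (N%:R * `|x| ^+ 2)).
  rewrite mulr_natl -[X in _ *+ X]card_ord -sumr_const; apply: ler_sum => i _.
  by rewrite -real_normK ?num_real// lerXn2r ?nnegrE// ler_norm_coord.
rewrite ler_wpM2r ?sqr_ge0// ler_nat.
by case: (N) => // n; rewrite expnS leq_pmulr.
Qed.

(** Boundedness of [U] provides an upper bound of the set of distances, without which [sup] is only
    a default value. *)
Lemma enorm_le_diameter U x y : bounded_set U -> U x -> U y ->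
  enorm (x - y) <= diameter U.
Proof.
move=> [M0 [_ bU]] Ux Uy; apply: ub_le_sup; last by exists x, y.
pose M := `|M0| + 1; exists (N%:R * (M + M)) => _ [a [b [Ua Ub ->]]].
have UM z : U z -> `|z| <= M.
  by apply: bU; rewrite /M (le_lt_trans (ler_norm _))// ltrDl.
apply: le_trans (ler_enorm_norm _) _; rewrite ler_wpM2l//.
by apply: le_trans (ler_normB _ _) _; rewrite lerD// UM.
Qed.

Lemma diameter_gt0 U : (0 < N)%N -> open U -> bounded_set U -> U !=set0 ->
  0 < diameter U.
Proof.
move=> N0 oU bU [x Ux]; have /nbhs_ballP[e /= e0 eU] := open_nbhs_nbhs (conj oU Ux).
pose y := x + const_mx (e / 2).
have Uy : U y.
  apply: eU; rewrite ball_rVE// => i; rewrite !mxE opprD addNKr normrN gtr0_norm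
    ?divr_gt0//.
  by rewrite ltr_pdivrMr// ltr_pMr// ltr1n.
apply: lt_le_trans (enorm_le_diameter bU Uy Ux).
apply: lt_le_trans (ler_norm_enorm _); rewrite /y addrC addKr.
apply: lt_le_trans (ler_norm_coord _ (Ordinal N0)).
by rewrite mxE gtr0_norm divr_gt0.
Qed.

Lemma star_shaped_segment U B x y t : star_shaped U B -> U x -> B y ->
  0 <= t <= 1 -> U (x + t *: (y - x)).
Proof.
move=> [_ sU] Ux By /andP[t0 t1]; apply: (sU x Ux) => M [[_ cM] xBM].
have tx : M y by apply: xBM; right.
have ty : M x by apply: xBM; left.
have := cM y x (Itv01 t0 t1) (mem_set tx) (mem_set ty); rewrite inE.
by rewrite /conv/= /unstable.onem scalerBl scale1r scalerBr addrCA.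
Qed.

Lemma star_shaped_star_box U c (rho : R) : (0 < N)%N -> open U -> bounded_set U ->
  U !=set0 -> 0 < rho -> star_shaped U (eball c (rho * diameter U)) ->
  star_box U c (diameter U * (rho / N%:R)) (diameter U).
Proof.
move=> N0 oU bU U0 rho0 sU; have d0 := diameter_gt0 N0 oU bU U0.
have NR : 0 < N%:R :> R by rewrite ltr0n.
have Bsub : ball c (diameter U * (rho / N%:R)) `<=` eball c (rho * diameter U).
  move=> x; rewrite mx_norm_ball /ball_/= => cx; apply: le_lt_trans (ler_enorm_norm _) _.
  by rewrite distrC mulrC -ltr_pdivlMr// mulrAC mulrC.
split => //.
- by rewrite mulr_gt0// divr_gt0.
- by move=> x /Bsub; exact: (sU.1).
- move=> x y Ux Uy; apply: le_trans (ler_norm_enorm _) _; exact: enorm_le_diameter.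
- by move=> x y Ux /Bsub By t; exact: (star_shaped_segment sU).
Qed.

End star_shaped_box.

Section projection_error.
Context {R : realType} {N : nat}.
Implicit Types (P Q : mpoly N R) (a b : multinom N) (i : 'I_N) (p : \bar R).
Implicit Types (U : set 'rV[R]_N) (f v w : 'rV[R]_N -> R) (x y z c : 'rV[R]_N) (h r : R).
Implicit Types (g : multinom N -> 'rV[R]_N -> R).
Local Notation mu := (@lebesgue_measure_rV R N).

Lemma weak_partialP U a v : (exists f, weak_derivative U a v f) ->
  weak_derivative U a v (weak_partial U a v).
Proof. exact: getPex. Qed.

(** Weak derivatives are unique almost everywhere, so the representative chosen in the seminorm may
    be replaced by any other. *)
Lemma Lp_norm_partialE U p a v f : (1 <= p)%E -> open U -> weak_derivative U a v f ->
  Lp_norm_partial U p a v = Lp_norm U p f.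
Proof.
move=> p1 oU vf; have ef : exists f0, weak_derivative U a v f0 by exists f.
rewrite /Lp_norm_partial asboolT//; have vw := weak_partialP ef.
apply: Lp_norm_ae_eq => //; first exact: open_measurable_rV.
- by case: vw => _ [].
- by case: vf => _ [].
exact: weak_derivative_unique oU vw vf.
Qed.

(** The zero function is a weak derivative of anything on the empty set, so the value +oo is not
    taken. *)
Lemma Wsp_seminorm_set0 s p v : (1 <= p)%E -> Wsp_seminorm set0 s p v = 0%E.
Proof.
move=> p1; have l0 f : locally_integrable_rV set0 f.
  split; first exact: measurable_fun_set0.
  by move=> K; rewrite subset0 => -> _; rewrite integral_set0.
apply: big1 => b _; rewrite (@Lp_norm_partialE _ _ _ _ (cst 0))//.
- rewrite /Lp_norm (_ : _ \_ _ = cst 0); first by apply: Lnorm0;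
    rewrite gt_eqF// (lt_le_trans lte01).
  by apply/funext => x; rewrite /patch; case: ifP.
- by split => // phi _; rewrite !Rintegral_set0 mulr0.
Qed.

Lemma L2_projectionP (k : nat) U v : open U -> bounded_set U -> (0 < mu U)%E ->
  mu.-integrable U (EFin \o v) ->
  exists P, [/\ (msize P <= k.+1)%N, L2_projection U k v = peval P &
    forall Q, (msize Q <= k.+1)%N ->
    \int[mu]_(x in U) (peval P x * peval Q x) = \int[mu]_(x in U) (v x * peval Q x)].
Proof.
move=> oU bU U0 iv; have [P0 sP0 hP0] := projection_exists k oU bU U0 iv.
have [[P sP PE] hP] : polyfun k (L2_projection U k v) /\ forall q, polyfun k q ->
    \int[mu]_(x in U) (L2_projection U k v x * q x) = \int[mu]_(x in U) (v x * q x).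
  apply: (@getPex _ [set f | polyfun k f /\ forall q, polyfun k q ->
    \int[mu]_(x in U) (f x * q x) = \int[mu]_(x in U) (v x * q x)]).
  exists (peval P0); split; first by exists P0.
  by move=> _ [Q sQ ->]; exact: hP0.
exists P; split => // Q sQ; have := hP (peval Q); rewrite PE; apply.
by exists Q.
Qed.

Lemma Wsp_jet U s p v : (1 <= p)%E -> open U -> in_Wsp U s p v ->
  exists g, [/\ g mnm0 = v, jet U p s g &
    forall a, (mdeg a <= s)%N -> weak_derivative U a v (g a)].
Proof.
move=> p1 oU [[mv Nv] dv]; have mU := open_measurable_rV oU.
have lv : locally_integrable_rV U v.
  by have [|f [] //] := dv mnm0; rewrite mdeg0.
(* At order 0 the function itself is taken instead of an almost everywhere equal representative, so
   that the projection of [v] is literally that of [g mnm0]. *)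
pose g a := if a == mnm0 then v else weak_partial U a v.
have vg a : (mdeg a <= s)%N -> weak_derivative U a v (g a).
  move=> sa; rewrite /g; case: eqP => [->|_]; first exact: weak_derivative0.
  by apply: weak_partialP; have [f vf _] := dv a sa; exists f.
exists g; split => //; first by rewrite /g eqxx.
split=> a sa.
  have [f vf [mf Nf]] := dv a sa; have [_ [mg _] _] := vg a sa.
  split => //; rewrite (Lp_norm_ae_eq p1 mU mg mf) //.
  exact: weak_derivative_unique oU (vg a sa) vf.
apply: (weak_derivative_gradient oU (vg a (ltnW sa))) => i.
by apply: vg; rewrite mdegD mdeg1 addn1.
Qed.

(* With Q the polynomial of jet_approx and q = P - Q, which is the projection
   of v - Q, the error is (g a - d^a Q) - d^a q. *)
Lemma jet_projection_le (k s : nat) r a : 0 < r -> (s <= k.+1)%N -> (mdeg a <= s)%N ->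
  exists2 C : R, 0 <= C &
  forall U c h p g P, (1 <= p)%E -> open U -> bounded_set U -> star_box U c (h * r) h ->
    jet U p s g -> (msize P <= k.+1)%N ->
    (forall Q, (msize Q <= k.+1)%N ->
      \int[mu]_(x in U) (peval P x * peval Q x) =
      \int[mu]_(x in U) (g mnm0 x * peval Q x)) ->
    (Lp_norm U p (fun x => g a x - peval (mderivm a P) x)%R <=
      (C * h ^+ (s - mdeg a))%:E * top_norm U p s g)%E.
Proof.
move=> r0 sk das; have [Gam Gam0 hGam] := @jet_approx R N s.
have [D D0 hD] := projection_Lp_le (N := N) k a r0.
(* For a ball of radius h r the Poincare constant is [kap * h]. *)
pose kap := (r *+ 2) ^- N * 4 ^+ N.
have kap0 : 0 <= kap by rewrite mulr_ge0 ?invr_ge0 ?exprn_ge0// mulrn_wge0// ltW.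
(* The first term is the error of [Q] at order a. The second is the bound D / h^|a| of
   [projection_Lp_le] applied to v - Q, whose norm is at most Gam (kap h)^s times the top norm. *)
exists (Gam * kap ^+ (s - mdeg a) + D * Gam * kap ^+ s).
  by rewrite addr_ge0// !mulr_ge0// exprn_ge0.
move=> U c h p g P p1 oU bU sU jg sP hP; have mU := open_measurable_rV oU.
have [_ h0 _ _ _] := sU; have [Lg _] := jg.
have KE : poincare_const (N := N) (h * r) h = kap * h.
  rewrite /poincare_const /kap -mulrnAr -[h *+ 4]mulr_natl !exprMn.
  field.
  by rewrite !gt_eqF ?exprn_gt0 ?mulrn_wgt0.
have [Q sQ hQ] := hGam U c (h * r) h p g p1 oU bU sU jg.
have sQk : (msize Q <= k.+1)%N by exact: leq_trans sQ sk.
set S := top_norm U p s g in hQ *.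
have S0 : (0 <= S)%E by exact: top_norm_ge0.
set q := P - Q.
have sq : (msize q <= k.+1)%N.
  by apply: leq_trans (msizeD_le _ _) _; rewrite geq_max sP msizeN.
have L0 : in_Lp U p (g mnm0) by apply: Lg; rewrite mdeg0.
have iP T := peval_integrable T oU bU.
have qE : \int[mu]_(x in U) (peval q x * peval q x) =
    \int[mu]_(x in U) ((g mnm0 x - peval Q x) * peval q x).
  under [RHS]eq_Rintegral do rewrite mulrBl.
  have i0 := in_Lp_integrable p1 mU bU L0.
  rewrite RintegralB//; [|exact: integrableM_peval..].
  rewrite -hP// -RintegralB//; [|exact: integrableM_peval..].
  by apply: eq_Rintegral => x _; rewrite -mulrBl /q /peval mevalB.
have LgQ : in_Lp U p (fun x => g mnm0 x - peval Q x).
  by apply: in_LpB => //; exact: in_Lp_peval.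
have hq := hD U c h p _ q p1 oU bU sU LgQ sq qE.
have := hQ mnm0; rewrite mdeg0 subn0 mderivm0m => /(_ isT) hQ0.
rewrite (_ : (fun x => g a x - peval (mderivm a P) x) =
  (fun x => (g a x - peval (mderivm a Q) x) - peval (mderivm a q) x)); last first.
  apply/funext => x; rewrite /q mderivmB /peval mevalB; ring.
apply: le_trans (Lp_normB p1 mU _ _) _.
- by apply: measurable_funB; [case: (Lg a das)|exact: measurable_peval].
- exact: measurable_peval.
apply: le_trans (leeD (hQ a das) hq) _.
have hd := lee_wpmul2l (_ : (0 <= (D / h ^+ mdeg a)%:E)%E) hQ0.
apply: le_trans (leeD (lexx _) (hd _)) _.
  by rewrite lee_fin mulr_ge0// invr_ge0 exprn_ge0// ltW.
rewrite muleA -EFinM -ge0_muleDl ?lee_fin ?KE; last 2 first.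
- by rewrite mulr_ge0// exprn_ge0// mulr_ge0// ltW.
- apply: mulr_ge0; first by rewrite mulr_ge0// invr_ge0 exprn_ge0// ltW.
  by rewrite mulr_ge0// exprn_ge0// mulr_ge0// ltW.
rewrite -EFinD le_eqVlt; apply/orP; left; apply/eqP; congr (_%:E * _)%E.
rewrite !exprMn (_ : h ^+ s = h ^+ (s - mdeg a) * h ^+ mdeg a);
  last by rewrite -exprD subnK.
by field; rewrite expf_neq0// gt_eqF.
Qed.

End projection_error.

Theorem lemma3p4 (R : realType) (N k : nat) (rho : R) (s : nat) (p : \bar R)
    (N_ge1 : (1 <= N)%N) (rho_gt0 : 0 < rho)
    (s_bounds : (1 <= s <= k.+1)%N) (p_ge1 : (1 <= p)%E) :
  exists C : R,
    forall U : set 'rV[R]_N, open U -> bounded_set U ->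
      (exists c, star_shaped U (eball c (rho * diameter U))) ->
      forall m : nat, (m <= s)%N ->
      forall v : 'rV[R]_N -> R, in_Wsp U s p v ->
        (Wsp_seminorm U m p (fun x => v x - L2_projection U k v x)%R
           <= (C * diameter U ^+ (s - m))%R%:E * Wsp_seminorm U s p v)%E.
Proof.
have /andP[s0 sk] := s_bounds.
pose r := rho / N%:R.
have r0 : 0 < r by rewrite divr_gt0// ltr0n.
(* One constant per multi-index, with default 0 when |a| > s, so that finite sums of these constants
   can be formed before [U] is given. *)
have /choice[C hC] : forall a : multinom N, exists C : R, 0 <= C /\ ((mdeg a <= s)%N ->
    forall U c h p g P, (1 <= p)%E -> open U -> bounded_set U -> star_box U c (h * r) h ->
    jet U p s g -> (msize P <= k.+1)%N ->
    (forall Q, (msize Q <= k.+1)%N ->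
      \int[lebesgue_measure_rV]_(x in U) (peval P x * peval Q x) =
      \int[lebesgue_measure_rV]_(x in U) (g mnm0 x * peval Q x)) ->
    (Lp_norm U p (fun x => g a x - peval (mderivm a P) x)%R <=
      (C * h ^+ (s - mdeg a))%:E * top_norm U p s g)%E).
  move=> a; case: (leqP (mdeg a) s) => das; last by exists 0; split.
  by have [C C0 hC] := jet_projection_le r0 sk das; exists C; split.
pose Cm m := \sum_(a : bmultinom N m.+1 | mdeg a == m) C a.
have Cm0 m : 0 <= Cm m by apply: sumr_ge0 => a _; case: (hC a).
(* Summing over all orders m <= s yields a constant independent of m. *)
exists (\sum_(m < s.+1) Cm m) => U oU bU [c sU] m ms v Wv.
(* The empty set is star-shaped in the sense of the hypothesis but contains no ball of positive
   radius; there both seminorms are 0. *)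
have [UE|/set0P U0] := eqVneq U set0.
  rewrite UE !Wsp_seminorm_set0// mule0//.
have mU := open_measurable_rV oU.
set h := diameter U.
have sbU := star_shaped_star_box N_ge1 oU bU U0 rho_gt0 sU.
have [hr0 h0 BU _ _] := sbU.
have muU : (0 < lebesgue_measure_rV U)%E.
  apply: (@lt_le_trans _ _ (lebesgue_measure_rV (ball c (h * r)))).
    by rewrite lebesgue_measure_ball_rV// lte_fin exprn_gt0// mulrn_wgt0.
  by apply: le_measure; rewrite ?inE//; exact: measurable_ball_rV.
have iv := in_Lp_integrable p_ge1 mU bU Wv.1.
have [P [sP PE hP]] := L2_projectionP k oU bU muU iv.
have [g [g0 jg vg]] := Wsp_jet p_ge1 oU Wv.
have topE : top_norm U p s g = Wsp_seminorm U s p v.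
  apply: eq_bigr => b /eqP bs; rewrite (Lp_norm_partialE p_ge1 oU (vg b _))//.
  by rewrite bs.
rewrite -topE PE.
apply: (@le_trans _ _ (\sum_(a : bmultinom N m.+1 | mdeg a == m)
    (C a * h ^+ (s - m))%:E * top_norm U p s g)%E).
  apply: lee_sum => a /eqP am; have das : (mdeg a <= s)%N by rewrite am.
  rewrite (Lp_norm_partialE p_ge1 oU (weak_derivativeB oU (vg a das)
    (weak_derivative_peval a P oU))).
  have -> : (s - m = s - mdeg a)%N by rewrite am.
  apply: (hC a).2 sbU jg sP _ => //.
  by rewrite g0.
rewrite -ge0_sume_distrl; last first.
  move=> a _; rewrite lee_fin mulr_ge0//; first by case: (hC a).
  by rewrite exprn_ge0// ltW.
rewrite sumEFin -mulr_suml lee_wpmul2r ?top_norm_ge0// lee_fin ler_wpM2r//.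
  by rewrite exprn_ge0// ltW.
rewrite (bigD1 (Ordinal (ms : (m < s.+1)%N)))//= lerDl.
by apply: sumr_ge0 => j _; exact: Cm0.
Qed.
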